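(* Let $q\ge 1$ be an integer and let $\mathcal F$ and $\mathcal N$ be two tame bundle maps over $\tau$ which are tangent at the order $q+1$ (in particular they have the same linear part, denoted $\mathcal A$). Assume that there are real numbers $0<m\le M<1$ with $M^{q+1}<m$ such that $m|v|\le |A_x(v)|\le M|v|$ for all $x\in X$ and $v\in\mathbb C^k$. Then $\mathcal F$ is conjugated to $\mathcal N$. More precisely, for every $\kappa>0$ and every sufficiently small $\varepsilon>0$, there exist an $\varepsilon$-slow function $\rho_\varepsilon$ and a bundle map $\mathcal T:E(\rho_\varepsilon)\to E(2\rho_\varepsilon)$ over $\mathrm{Id}_X$ such that: (1) $\mathcal F$ contracts the tube $E(\rho_\varepsilon)$ and maps it into itself, and $\mathcal N$ contracts the tube $E(2\rho_\varepsilon)$ and maps it into itself; (2) $\mathcal T=\lim_{n\to+\infty}\mathcal N^{-n}\mathcal F^n$ on $E(\rho_\varepsilon)$, i.e. $T_x=\lim_{n\to+\infty} N^{-n}_{\tau^n(x)}\circ F^n_x$ on $E_x(\rho_\varepsilon)$ for every $x\in X$; (3) $\mathcal T$ is tangent to $\mathcal I$ at the order $q+1$ and $\mathrm{Lip}(\mathcal T-\mathcal I)<\kappa$ on $E(\rho_\varepsilon)$; (4) $\mathcal T\circ\mathcal F=\mathcal N\circ\mathcal T$ on $E(\rho_\varepsilon)$, i.e. $T_{\tau(x)}\circ F_x=N_x\circ T_x$ on $E_x(\rho_\varepsilon)$ for every $x\in X$. Moreover, with these same $\rho_\varepsilon$ and $\mathcal T$, for any $\theta$ with $M^{q+1}/m<\theta<1$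 there is an $\varepsilon$-fast function $\varphi_\varepsilon$ such that for all $x\in X$, all $n\ge 1$ and all $v\in E_x(\rho_\varepsilon)$, $$|(N_x^n\circ T_x-F_x^n)(v)|\le \varphi_\varepsilon(x)\,(m\theta)^n\,|v|^{q+1}.$$
   Context: $X$ is a set, $\tau:X\to X$ a fixed bijection, $k\ge1$, $|\cdot|$ the Euclidean norm on $\mathbb C^k$, and $\mathcal X=X\times\mathbb C^k$. For $\varepsilon>0$, a function $\phi:X\to\,]0,1]$ is $\varepsilon$-slow if $\phi(\tau^{\pm1}(x))\ge e^{-\varepsilon}\phi(x)$ for all $x$; a function $\psi:X\to[1,+\infty[$ is $\varepsilon$-fast if $1/\psi$ is $\varepsilon$-slow. For a positive function $r$ on $X$, $E_x(r)$ is the ball $\{v\in\mathbb C^k:|v|<r(x)\}$ (viewed in the fibre over $x$) and the tube $E(r)\subset\mathcal X$ is the union of all $\{x\}\times E_x(r)$. For $\sigma\in\{\mathrm{Id}_X,\tau\}$, a bundle map $\mathcal K:E(r)\to\mathcal X$ over $\sigma$ is a map $\mathcal K(x,v)=(\sigma(x),K_x(v))$ with each $K_x:E_x(r)\to\mathbb C^k$ holomorphic and $K_x(0)=0$; its linear part is the bundle map with fibre maps $d_0K_x$. $\mathcal K$ is tame if there is $\varepsilon_0>0$ such that for all $0<\varepsilon<\varepsilon_0$ there are an $\varepsilon$-slow function $r_\varepsilon$ and an $\varepsilon$-fast function $s_\varepsilon$ such that $\mathcal K$ is defined on $E(r_\varepsilon)$ and maps it into $E(s_\varepsilon)$. $\mathrm{Lip}(\mathcal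 K)=\sup_{x\in X}\mathrm{Lip}(K_x)$; $\mathcal K$ contracts $E(r)$ if $\mathrm{Lip}(\mathcal K)<1$ on $E(r)$. $\mathcal I$ is the identity bundle map over $\mathrm{Id}_X$. Two bundle maps over the same $\sigma$ are tangent at the order $p+1$ if for every $x$ their fibre maps have the same Taylor expansion at $0$ up to order $p$; ''tangent'' means tangent at the order $2$. For $\mathcal K$ over $\tau$, $K_x^n=K_{\tau^{n-1}(x)}\circ\cdots\circ K_x$. When the linear part is invertible, $K^{-1}_x=(K_{\tau^{-1}(x)})^{-1}$ denotes the local inverse near $0$ (a germ from the fibre over $x$ to the fibre over $\tau^{-1}(x)$) and $N^{-n}_{\tau^n(x)}=N^{-1}_{\tau(x)}\circ\cdots\circ N^{-1}_{\tau^n(x)}$; it is part of the assertion that the compositions $N^{-n}_{\tau^n(x)}\circ F_x^n$ are well defined on $E_x(\rho_\varepsilon)$. Two bundle maps $\mathcal K_1,\mathcal K_2$ over $\tau$ are conjugated if there are positive functions $r,s$ on $X$ and a bundle map $\mathcal W:E(r)\to E(s)$ over $\mathrm{Id}_X$ tangent to $\mathcal I$, with $\mathcal K_1(E(r))\subset E(r)$, $\mathcal K_2(E(s))\subset E(s)$ and $\mathcal W\circ\mathcal K_1=\mathcal K_2\circ\mathcal W$ on $E(r)$. *)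

(* Defs.v *)
(* Written with MathComp and MathComp-Analysis. *)
From HB Require Import structures.
From mathcomp Require Import all_boot all_order all_algebra.
From mathcomp Require Import all_classical all_reals all_analysis.
From mathcomp Require Import complex.

Set Implicit Arguments.
Unset Strict Implicit.
Unset Printing Implicit Defensive.

Import Order.TTheory GRing.Theory Num.Theory numFieldNormedType.Exports.

Local Open Scope classical_set_scope.
Local Open Scope ring_scope.

(* [R[i]] behind a constant of type [numClosedFieldType], so that the normed
   module structure of an abstract [numFieldType] over itself is found on it. *)
Definition Cplx (R : realType) : numClosedFieldType := R[i].

Notation "''V[' R ]_ k" := 'rV[Cplx R]_k
  (at level 0, k at level 2, format "''V[' R ]_ k") : type_scope.

(* The Euclidean norm; the norm [`|v|] of the library is the sup norm. *)
Definition enorm (R : realType) (k : nat) (v : 'V[R]_k) : R :=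
  Num.sqrt (\sum_(i < k) Normc.normc (v 0 i) ^+ 2).

Section SlowFast.
Context {R : realType} {X : Type}.
(* [tau] is the fixed bijection and [tauV] its inverse. *)
Variables (tau tauV : X -> X).

Definition slow (eps : R) (phi : X -> R) : Prop :=
  (forall x, 0 < phi x <= 1) /\
  (forall x, expR (- eps) * phi x <= phi (tau x) /\
             expR (- eps) * phi x <= phi (tauV x)).

Definition fast (eps : R) (psi : X -> R) : Prop :=
  (forall x, 1 <= psi x) /\ slow eps (fun x => (psi x)^-1).

End SlowFast.

Section Bundles.
Context {R : realType} {X : Type} {k : nat}.
Implicit Types (sigma : X -> X) (r s : X -> R) (K : X -> 'V[R]_k -> 'V[R]_k).

Definition fball r (x : X) : set 'V[R]_k := [set v | enorm v < r x].

Definition tube r : set (X * 'V[R]_k) := [set p | fball r p.1 p.2].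

(* A bundle map [E(r) -> X * C^k] is given by its fibre maps
   [K x : C^k -> C^k], which are total functions whose values outside
   [E_x(r)] are irrelevant; the base map only enters through [bmap].
   [differentiable] is over the scalar field [Cplx R], i.e., it asserts the
   existence of a C-linear differential. *)
Definition bundle_map r K : Prop :=
  [/\ forall x, 0 < r x,
      forall x v, fball r x v -> differentiable (K x) v
    & forall x, K x 0 = 0].

Definition bmap sigma K (p : X * 'V[R]_k) : X * 'V[R]_k :=
  (sigma p.1, K p.1 p.2).

(* [K : E(rK) -> X * C^k] is defined on [E(r)] and maps it into [E(s)]. *)
Definition maps_tube sigma rK K r s : Prop :=
  tube r `<=` tube rK /\ bmap sigma K @` tube r `<=` tube s.

(* [K^n_x = K_{sigma^(n-1) x} o ... o K_x] *)
Definition fiter sigma K (n : nat) (x : X) (v : 'V[R]_k) : 'V[R]_k :=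
  (iter n (bmap sigma K) (x, v)).2.

(* The iterate [K^n] of [K : E(r) -> X * C^k] is defined at [p]. *)
Definition iter_defined sigma r K (n : nat) (p : X * 'V[R]_k) : Prop :=
  forall j, (j < n)%N -> tube r (iter j (bmap sigma K) p).

Definition idbundle : X -> 'V[R]_k -> 'V[R]_k := fun _ v => v.

Definition subbundle K1 K2 : X -> 'V[R]_k -> 'V[R]_k :=
  fun x v => K1 x v - K2 x v.

(* The pairs [u = v] contribute [0 / 0 = 0]. *)
Definition lip_on (A : set 'V[R]_k) (f : 'V[R]_k -> 'V[R]_k) : \bar R :=
  ereal_sup [set (enorm (f p.1 - f p.2) / enorm (p.1 - p.2))%:E
            | p in A `*` A].

Definition Lip r K : \bar R :=
  ereal_sup [set lip_on (fball r x) (K x) | x in [set: X]].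

Definition contracts r K : Prop := (Lip r K < 1)%E.

Definition pderiv (i : 'I_k) (f : 'V[R]_k -> 'V[R]_k) : 'V[R]_k -> 'V[R]_k :=
  fun v => 'D_(delta_mx 0 i) f v.

(* The partial derivative of multi-index [a]. *)
Definition mderiv (a : 'I_k -> nat) (f : 'V[R]_k -> 'V[R]_k) :
    'V[R]_k -> 'V[R]_k :=
  foldr (fun i g => iter (a i) (pderiv i) g) f (enum 'I_k).

Definition taylor_coef (a : 'I_k -> nat) (f : 'V[R]_k -> 'V[R]_k) : 'V[R]_k :=
  ((\prod_(i < k) (a i)`!)%:R)^-1 *: mderiv a f 0.

(* [tangent n] is tangency at the order [n]: the Taylor expansions at [0] agree
   up to order [n - 1]. *)
Definition tangent (n : nat) K1 K2 : Prop :=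
  forall (x : X) (a : 'I_k -> nat), (\sum_(i < k) a i < n)%N ->
    taylor_coef a (K1 x) = taylor_coef a (K2 x).

Variables (tau tauV : X -> X).

Definition tame r K : Prop :=
  exists2 eps0 : R, 0 < eps0 &
    forall eps, 0 < eps < eps0 ->
      exists reps seps : X -> R,
        [/\ slow tau tauV eps reps, fast tau tauV eps seps
          & maps_tube tau r K reps seps].

(* [G], over [tauV], is a representative on [E(s)] of the local inverse of
   [K : E(r) -> X * C^k]; since it is holomorphic on the balls [E_x(s)], it is
   determined there by its germs at [0]. *)
Definition local_inverse r K s (G : X -> 'V[R]_k -> 'V[R]_k) : Prop :=
  [/\ bundle_map s G,
      maps_tube tauV s G s r,
      forall p, tube s p -> bmap tau K (bmap tauV G p) = p
    & forall x, \forall v \near (0 : 'V[R]_k), G x (K (tauV x) v) = v].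

Definition conjugated r1 K1 r2 K2 : Prop :=
  exists (r s : X -> R) (W : X -> 'V[R]_k -> 'V[R]_k),
    [/\ (forall x, 0 < r x) /\ (forall x, 0 < s x),
        [/\ bundle_map r W, maps_tube idfun r W r s & tangent 2 W idbundle],
        maps_tube tau r1 K1 r r,
        maps_tube tau r2 K2 s s
      & forall p, tube r p ->
          bmap idfun W (bmap tau K1 p) = bmap tau K2 (bmap idfun W p)].

End Bundles.

(* Main.v *)
(** Along the orbit [v_j = F^j_x v], the conjugacy is the limit of
    [T^n_x = N^{-n} F^n], which satisfies the recursion
    [T^{n+1}_x = N^{-1}_{tau x} T^n_{tau x} F_x]. One step of [N^{-1}] costs a
    factor [1/m'], while [F] and [N] differ by [K |v|^(q+1)] and [F] contracts by
    [M'], where [m' < m], [M' > M] and the [eps]-slow radii absorb the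
    nonlinearity; the recursion thus contracts by [e^eps M'^(q+1) / m' < 1], whence
    the convergence and [|T_x v - v| <= const K |v|^(q+1)]. For the last
    estimate, [N^n T - F^n] is [T - I] evaluated at [F^n_x v], whose norm is at
    most [const M^n |v|] with the exact rate [M], and the constant [K] may be
    replaced by one that grows along orbits at an arbitrarily small rate.

    All of the complex analysis rests on the inequality [|g'(0)| <= 2 S / r] for
    [g] differentiable and bounded by [S] on the disc of radius [r]. It follows
    from Goursat's theorem for rectangles applied to
    [(g (e^z) - g 0) e^(-z)], which is periodic in the imaginary direction, by
    letting the left side of the rectangle go to minus infinity. Applying it
    to the differences [g (_ + h) - g] gives a second-order Taylor estimate, which
    is uniform on bounded families; hence pointwise limits, and in particular
    partial derivatives, of holomorphic maps are holomorphic. *)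
Require Import Defs.
From HB Require Import structures.
From mathcomp Require Import all_boot all_order all_algebra.
From mathcomp Require Import all_classical all_reals all_analysis.
From mathcomp Require Import complex ring lra.
Import Order.TTheory GRing.Theory Num.Theory numFieldNormedType.Exports.
Local Open Scope classical_set_scope.
Local Open Scope ring_scope.

Set Implicit Arguments.
Unset Strict Implicit.
Unset Printing Implicit Defensive.

(** * The modulus on the complex numbers and the Euclidean norm *)

Section ComplexModulus.
Context {R : realType}.
Local Notation C := (Cplx R).
Implicit Types (x y z : C) (a b : R).

(** The obstacle is that [N^{-1}] exists only on small balls whose size varies with the fibre, so
    every composition must be kept inside its domain. Four radii are nested for this: [T] lives on
    [rho], the estimates on [2 rho], the inverse [G] on [4 rho], and [N] is bi-Lipschitz on
    [r0 = (8/m') rho], its image containing the ball of radius [8 rho]. All smallness comes from one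
    slow function [P] that bounds radii and sizes at once; [rho] is a small multiple of [P^(q+3)]
    because the nonlinear parts on a ball of radius [r] have Lipschitz constant of order [r P^-3]
    and the tangency constant is of order [P^-(q+2)]. The distance estimate also controls the
    domains, so both are proved by one induction, with a constant [K0] for which [rho] is small;
    afterwards any other dominating function may replace [K0]. The last estimate needs this: [rho]
    and [T] are fixed before [theta], while the ratio of [m theta] to [M^(q+1)] may be smaller than
    [e^eps], so a second, slower function [Q] is brought in without shrinking the balls. Orders of
    vanishing are handled by induction on partial derivatives instead of power series. *)

Definition nc (z : C) : R := Normc.normc (z : R[i]).
Definition cx (a b : R) : C := (Complex a b : R[i]).
Definition re (z : C) : R := complex.Re (z : R[i]).
Definition im (z : C) : R := complex.Im (z : R[i]).

Lemma cx_re_im z : z = cx (re z) (im z).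
Proof. by case: z. Qed.
Lemma re0 : re 0 = 0. Proof. by []. Qed.
Lemma im0 : im 0 = 0. Proof. by []. Qed.
Lemma reD x y : re (x + y) = re x + re y.
Proof. by case: x => a b; case: y => c d. Qed.
Lemma imD x y : im (x + y) = im x + im y.
Proof. by case: x => a b; case: y => c d. Qed.
Lemma reN x : re (- x) = - re x.
Proof. by case: x => a b. Qed.
Lemma imN x : im (- x) = - im x.
Proof. by case: x => a b. Qed.
Lemma reM x y : re (x * y) = re x * re y - im x * im y.
Proof. by case: x => a b; case: y => c d. Qed.
Lemma imM x y : im (x * y) = re x * im y + im x * re y.
Proof. by case: x => a b; case: y => c d. Qed.
Lemma cx_inj x y : re x = re y -> im x = im y -> x = y.
Proof. by case: x => a b; case: y => c d /= -> ->. Qed.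

Lemma ncE z : nc z = Num.sqrt (re z ^+ 2 + im z ^+ 2).
Proof. by case: z. Qed.
Lemma nc_ge0 z : 0 <= nc z.
Proof. by rewrite ncE sqrtr_ge0. Qed.
Lemma ncM x y : nc (x * y) = nc x * nc y.
Proof. exact: Normc.normcM. Qed.
Lemma ncD x y : nc (x + y) <= nc x + nc y.
Proof. exact: le_normcD. Qed.
Lemma ncN x : nc (- x) = nc x.
Proof. exact: normcN. Qed.
Lemma ncV x : nc x^-1 = (nc x)^-1.
Proof. exact: Normc.normcV. Qed.
Lemma nc0 : nc 0 = 0.
Proof. exact: Normc.normc0. Qed.
Lemma nc1 : nc 1 = 1.
Proof. exact: Normc.normc1. Qed.
Lemma nc_eq0 x : nc x = 0 -> x = 0.
Proof. exact: Normc.eq0_normc. Qed.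
Lemma nc_gt0 x : x != 0 -> 0 < nc x.
Proof.
move=> x0; rewrite lt_def nc_ge0 andbT; apply: contra x0 => /eqP/nc_eq0 ->//.
Qed.
Lemma ncB x y : nc (x - y) = nc (y - x).
Proof. by rewrite -ncN opprB. Qed.
Lemma ncX x n : nc (x ^+ n) = nc x ^+ n.
Proof. by elim: n => [|n IH]; rewrite ?expr0 ?nc1// !exprS ncM IH. Qed.
Lemma re_le_nc z : `|re z| <= nc z.
Proof. by rewrite ncE -sqrtr_sqr ler_wsqrtr// lerDl sqr_ge0. Qed.
Lemma im_le_nc z : `|im z| <= nc z.
Proof. by rewrite ncE -sqrtr_sqr ler_wsqrtr// lerDr sqr_ge0. Qed.
Lemma nc_le_re_im z : nc z <= `|re z| + `|im z|.
Proof.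
rewrite ncE -[leRHS]ger0_norm ?addr_ge0// -sqrtr_sqr.
rewrite ler_wsqrtr// sqrrD !real_normK ?num_real//.
by rewrite lerD2r lerDl mulrn_wge0 ?mulr_ge0.
Qed.
Lemma nc_re a : nc (cx a 0) = `|a|.
Proof. by rewrite ncE /= expr0n addr0 sqrtr_sqr. Qed.
(** The norm of the library on [C] takes its values in [C] itself; with [cx_le] and [cx_lt],
    estimates on it become estimates on the real modulus [nc]. *)
Lemma normE z : `|z| = cx (nc z) 0.
Proof. by case: z => a b. Qed.
Lemma cx_le a b : (cx a 0 <= cx b 0) = (a <= b).
Proof. exact: lecR. Qed.
Lemma cx_lt a b : (cx a 0 < cx b 0) = (a < b).
Proof. exact: ltcR. Qed.
End ComplexModulus.

Section EuclideanNorm.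
Context {R : realType} {k : nat}.
Local Notation C := (Cplx R).
Implicit Types (u v w : 'V[R]_k).

Lemma enorm_ge0 v : 0 <= enorm v.
Proof. exact: sqrtr_ge0. Qed.

Lemma sqr_enorm v : enorm v ^+ 2 = \sum_(i < k) nc (v 0 i) ^+ 2.
Proof. by rewrite sqr_sqrtr// sumr_ge0// => i _; rewrite sqr_ge0. Qed.

Lemma enorm_lepP v (e : R) : 0 <= e ->
  (enorm v <= e) = (\sum_(i < k) nc (v 0 i) ^+ 2 <= e ^+ 2).
Proof.
by move=> e0; rewrite -sqr_enorm ler_pXn2r// ?nnegrE ?enorm_ge0.
Qed.

Lemma nc_le_enorm v i : nc (v 0 i) <= enorm v.
Proof.
rewrite -(@ler_pXn2r _ 2)// ?nnegrE ?enorm_ge0 ?nc_ge0//.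
by rewrite sqr_enorm (bigD1 i)//= lerDl sumr_ge0// => j _; rewrite sqr_ge0.
Qed.

Lemma enorm_le_sum v : enorm v <= \sum_(i < k) nc (v 0 i).
Proof.
have s0 (s : seq 'I_k) : 0 <= \sum_(i <- s) nc (v 0 i).
  by rewrite sumr_ge0// => i _; rewrite nc_ge0.
rewrite enorm_lepP//; elim: (index_enum _) => [|i s IH].
  by rewrite !big_nil expr0n.
rewrite !big_cons; apply: (le_trans (lerD (lexx _) IH)).
by rewrite sqrrD addrAC lerDl mulrn_wge0// mulr_ge0 ?nc_ge0.
Qed.

Lemma enorm_le v (e : R) : (forall i, nc (v 0 i) <= e) -> enorm v <= k%:R * e.
Proof.
move=> h; apply: (le_trans (enorm_le_sum v)).
by apply: (le_trans (ler_sum _ (fun i _ => h i))); rewrite sumr_const card_ord mulr_natl.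
Qed.

Lemma enorm0 : enorm (0 : 'V[R]_k) = 0.
Proof.
apply/le_anti; rewrite enorm_ge0 andbT -[leRHS](mulr0 k%:R); apply: enorm_le => i.
by rewrite mxE nc0.
Qed.

Lemma enorm_eq0 v : enorm v = 0 -> v = 0.
Proof.
move=> v0; apply/rowP => i; rewrite mxE; apply: nc_eq0; apply/le_anti.
by rewrite nc_ge0 andbT -v0 nc_le_enorm.
Qed.

Lemma enorm_gt0 v : v != 0 -> 0 < enorm v.
Proof.
by move=> x0; rewrite lt_def enorm_ge0 andbT; apply: contra x0 => /eqP/enorm_eq0 ->.
Qed.

Lemma enormZ (t : C) v : enorm (t *: v) = nc t * enorm v.
Proof.
apply/eqP; rewrite -(@eqrXn2 _ 2)// ?mulr_ge0 ?nc_ge0 ?enorm_ge0//.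
rewrite exprMn !sqr_enorm mulr_sumr; apply/eqP/eq_bigr => i _.
by rewrite mxE ncM exprMn.
Qed.

Lemma enormN v : enorm (- v) = enorm v.
Proof. by rewrite -scaleN1r enormZ ncN nc1 mul1r. Qed.

Lemma enormB u v : enorm (u - v) = enorm (v - u).
Proof. by rewrite -enormN opprB. Qed.

Lemma enormD u v : enorm (u + v) <= enorm u + enorm v.
Proof.
pose a i := nc (u 0 i); pose b i := nc (v 0 i).
have CS : \sum_i a i * b i <= enorm u * enorm v.
  have [u0|u0] := eqVneq u 0.
    rewrite u0 enorm0 mul0r big1// => i _.
    by rewrite /a u0 mxE nc0 mul0r.
  have [v0|v0] := eqVneq v 0.
    rewrite v0 enorm0 mulr0 big1// => i _.
    by rewrite /b v0 mxE nc0 mulr0.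
  have P := enorm_gt0 u0; have Q := enorm_gt0 v0.
  (* Termwise [0 <= (|v| a_i - |u| b_i)^2]; with the weights [|v|/|u|] and [|u|/|v|] both halves of
     the sum equal [|u| |v| / 2]. *)
  have : \sum_i a i * b i <=
      \sum_i (enorm v / enorm u * a i ^+ 2 + enorm u / enorm v * b i ^+ 2) / 2.
    apply: ler_sum => i _.
    have -> : (enorm v / enorm u * a i ^+ 2 + enorm u / enorm v * b i ^+ 2) / 2
      = a i * b i + (enorm v * a i - enorm u * b i) ^+ 2 / (2 * (enorm u * enorm v)).
      by field; rewrite !gt_eqF.
    by rewrite lerDl mulr_ge0 ?sqr_ge0// invr_ge0 !mulr_ge0// ltW.
  move/le_trans; apply; rewrite -mulr_suml big_split/= -!mulr_sumr -!sqr_enorm.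
  rewrite le_eqVlt; apply/orP; left; apply/eqP; field; by rewrite !gt_eqF.
rewrite enorm_lepP ?addr_ge0 ?enorm_ge0//.
apply: (@le_trans _ _ (\sum_i (a i ^+ 2 + b i ^+ 2 + 2 * (a i * b i)))).
  apply: ler_sum => i _; rewrite mxE.
  apply: (@le_trans _ _ ((a i + b i) ^+ 2)).
    by rewrite ler_pXn2r// ?nnegrE ?addr_ge0 ?nc_ge0 ?ncD.
  by rewrite le_eqVlt; apply/orP; left; apply/eqP; ring.
rewrite big_split big_split/= -mulr_sumr -!sqr_enorm sqrrD; lra.
Qed.

Lemma enormD3 u v w : enorm (u - w) <= enorm (u - v) + enorm (v - w).
Proof. by rewrite -[u - w](subrKA v) enormD. Qed.

Lemma enorm_delta (i : 'I_k) : enorm (delta_mx 0 i : 'V[R]_k) = 1.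
Proof.
rewrite /enorm (bigD1 i)//= big1 ?addr0.
  by rewrite mxE !eqxx -[Normc.normc _]/(nc 1) nc1 expr1n sqrtr1.
move=> j ji; rewrite mxE (negbTE ji) andbF -[Normc.normc _]/(nc 0) nc0 expr0n//.
Qed.

End EuclideanNorm.

(** * Goursat's theorem on rectangles *)

Section Goursat.
Context {R : realType}.
Implicit Types (f g : R -> R) (a b c d e x y : R).
Local Notation mu := (@lebesgue_measure R).

Definition Int f a b : R := (\int[mu]_(x in `[a, b]) f x)%R.

(** Continuity is that of a function on the line, hence two-sided at the endpoints as well;
    [cauchy_riemann] provides it. *)
Definition cont_on f a b := forall x, a <= x <= b -> {for x, continuous f}.

Lemma cont_on_integrable f a b : cont_on f a b ->
  mu.-integrable `[a, b] (EFin \o f).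
Proof.
move=> hf; apply: continuous_compact_integrable; first exact: segment_compact.
apply: continuous_in_subspaceT => x; rewrite inE /= in_itv/= => hx.
exact: hf.
Qed.

Lemma Int_chasles f a b c : a <= b -> b <= c -> cont_on f a c ->
  Int f a c = Int f a b + Int f b c.
Proof.
move=> ab bc hf; have fi := cont_on_integrable hf.
have := @Rintegral_itvB R f (BLeft a) (BRight c) b fi.
rewrite !bnd_simp => /(_ ab bc) h.
rewrite /Int -(@Rintegral_itv_obnd_cbnd _ b (BRight c)); first by rewrite -h addrC subrK.
apply: integrableS fi => //.
by apply: subset_itvr; rewrite bnd_simp.
Qed.

Lemma IntB f g a b : cont_on f a b -> cont_on g a b ->
  Int (fun x => f x - g x) a b = Int f a b - Int g a b.
Proof.
by move=> hf hg; rewrite /Int RintegralB//; apply: cont_on_integrable.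
Qed.

Lemma Int_cst a b r : a <= b -> Int (fun=> r) a b = r * (b - a).
Proof.
move=> ab; rewrite /Int Rintegral_cst//= lebesgue_measure_itv/= lte_fin.
have [//|ba] := ltP a b.
have ab' : a = b by apply/le_anti; rewrite ab ba.
by rewrite ab' subrr.
Qed.

Lemma Int_le f g a b : cont_on f a b -> cont_on g a b ->
  (forall x, a <= x <= b -> f x <= g x) -> Int f a b <= Int g a b.
Proof.
move=> hf hg hfg; apply: le_Rintegral => //; try exact: cont_on_integrable.
Qed.

Lemma cont_on_cst r a b : cont_on (fun=> r) a b.
Proof. by move=> x _; exact: cvg_cst. Qed.

Lemma Int_near_cst f a b e r : a <= b -> cont_on f a b ->
  (forall x, a <= x <= b -> `|f x - r| <= e) ->
  `|Int f a b - r * (b - a)| <= e * (b - a).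
Proof.
move=> ab hf h; rewrite ler_distl -!mulrBl -!mulrDl -!Int_cst//.
by apply/andP; split; apply: Int_le => //; try exact: cont_on_cst;
  move=> x /h; rewrite ler_distl => /andP[].
Qed.

Lemma nested_segments (u v : nat -> R) :
  (forall n, u n <= u n.+1) -> (forall n, v n.+1 <= v n) ->
  (forall n, u n <= v n) -> exists x, forall n, u n <= x <= v n.
Proof.
move=> hu hv huv.
have um i j : (i <= j)%N -> u i <= u j.
  by move=> /(@homo_leq _ u _ (@lexx _ _) (fun y x z => @le_trans _ _ y x z) hu).
have vm i j : (i <= j)%N -> v j <= v i.
  move=> /(@homo_leq _ v (fun x y => y <= x)) h; apply: h => //.
  by move=> y x z h1 h2; exact: le_trans h2 h1.
have uv i j : u i <= v j.
  apply: (le_trans (um _ _ (leq_maxl i j))); apply: (le_trans (huv _)).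
  exact: vm (leq_maxr i j).
exists (sup (range u)) => n; apply/andP; split.
  apply: ub_le_sup; last by exists n.
  by exists (v 0) => _ [i _ <-].
apply: ge_sup; first by exists (u 0), 0%N.
by move=> _ [i _ <-].
Qed.

(** Induction on rectangles: if [P] failed, one quarter would fail at each stage, and the nested bad
    quarters would shrink to a point [(x, y)], around which small rectangles satisfy [P]. The point
    need only lie in the closed rectangles, so it may sit on an edge. *)
Lemma quadrisection (P : R -> R -> R -> R -> Prop) a b c d :
  a <= b -> c <= d ->
  (forall a b c d, a <= b -> c <= d ->
    P a ((a + b) / 2) c ((c + d) / 2) -> P ((a + b) / 2) b c ((c + d) / 2) ->
    P a ((a + b) / 2) ((c + d) / 2) d -> P ((a + b) / 2) b ((c + d) / 2) d ->
    P a b c d) ->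
  (forall x y, a <= x <= b -> c <= y <= d -> exists2 dl, 0 < dl &
    forall a' b' c' d', a <= a' -> b' <= b -> c <= c' -> d' <= d ->
      a' <= x <= b' -> c' <= y <= d' -> b' - a' < dl -> d' - c' < dl ->
      P a' b' c' d') ->
  P a b c d.
Proof.
move=> ab cd quad loc; apply: contrapT => nP.
pose bad (q : (R * R) * (R * R)) :=
  [/\ q.1.1 <= q.1.2, q.2.1 <= q.2.2 & ~ P q.1.1 q.1.2 q.2.1 q.2.2].
pose sub (q q' : (R * R) * (R * R)) :=
  [/\ q.1.1 <= q'.1.1, q'.1.2 <= q.1.2, q.2.1 <= q'.2.1 & q'.2.2 <= q.2.2] /\
  (q'.1.2 - q'.1.1 = (q.1.2 - q.1.1) / 2 /\ q'.2.2 - q'.2.1 = (q.2.2 - q.2.1) / 2).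
(* [choice] wants a successor for every [q]; a rectangle that is not bad gets itself. *)
have step q : exists q', bad q -> bad q' /\ sub q q'.
  have [[ab' cd' nPq]|] := pselect (bad q); last by exists q.
  apply: contrapT => nE; apply: nPq.
  case: q => [[a1 b1] [c1 d1]] /= in ab' cd' nE *.
  apply: quad => //; apply: contrapT => nP'; apply: nE.
  - exists ((a1, (a1 + b1) / 2), (c1, (c1 + d1) / 2)) => _.
    by rewrite /bad /sub /=; split; [split=> //; lra|split; split; lra].
  - exists (((a1 + b1) / 2, b1), (c1, (c1 + d1) / 2)) => _.
    by rewrite /bad /sub /=; split; [split=> //; lra|split; split; lra].
  - exists ((a1, (a1 + b1) / 2), ((c1 + d1) / 2, d1)) => _.
    by rewrite /bad /sub /=; split; [split=> //; lra|split; split; lra].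
  - exists (((a1 + b1) / 2, b1), ((c1 + d1) / 2, d1)) => _.
    by rewrite /bad /sub /=; split; [split=> //; lra|split; split; lra].
have [nxt hnxt] := choice step.
pose Q n := iter n nxt ((a, b), (c, d)).
have badQ n : bad (Q n).
  elim: n => [|n IH]; first by split.
  by have [] := hnxt _ IH.
have subQ n : sub (Q n) (Q n.+1) by have [] := hnxt _ (badQ n).
have [x hx] : exists x, forall n, (Q n).1.1 <= x <= (Q n).1.2.
  by apply: nested_segments => n; [have [[]] := subQ n|have [[]] := subQ n|have [] := badQ n].
have [y hy] : exists y, forall n, (Q n).2.1 <= y <= (Q n).2.2.
  by apply: nested_segments => n; [have [[]] := subQ n|have [[]] := subQ n|have [] := badQ n].
have inQ n : [/\ a <= (Q n).1.1, (Q n).1.2 <= b, c <= (Q n).2.1 & (Q n).2.2 <= d].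
  elim: n => [|n [h1 h2 h3 h4]]; first by split.
  by have [[k1 k2 k3 k4] _] := subQ n; split; [exact: le_trans k1|exact: le_trans h2|
    exact: le_trans k3|exact: le_trans h4].
have wQ n : (Q n).1.2 - (Q n).1.1 = (b - a) / 2 ^+ n /\
            (Q n).2.2 - (Q n).2.1 = (d - c) / 2 ^+ n.
  elim: n => [|n [h1 h2]]; first by rewrite expr0 !divr1.
  have [_ [-> ->]] := subQ n; rewrite h1 h2 !exprSr !invfM !mulrA.
  by split.
have [dl dl0 hdl] := loc x y (hx 0%N) (hy 0%N).
(* Since [2^n > n], any integer above the half-perimeter divided by [dl] will do. *)
have [n hn] : exists n, (b - a + (d - c)) / 2 ^+ n < dl.
  pose w := (b - a + (d - c)); have w0 : 0 <= w by rewrite /w; lra.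
  exists (Num.truncn (w / dl)).+1; rewrite ltr_pdivrMr ?exprn_gt0// mulrC -ltr_pdivrMr//.
  apply: (@lt_le_trans _ _ (Num.truncn (w / dl)).+1%:R); first by rewrite Num.Theory.truncnS_gt.
  by rewrite -natrX ler_nat ltnW// ltn_expl.
have [h1 h2 h3 h4] := inQ n; have [w1 w2] := wQ n.
have p0 : 0 < (2 ^+ n : R)^-1 by rewrite invr_gt0 exprn_gt0.
have [_ _] := badQ n; apply; apply: hdl => //.
- rewrite w1; apply: le_lt_trans hn; rewrite ler_pM2r//; lra.
- rewrite w2; apply: le_lt_trans hn; rewrite ler_pM2r//; lra.
Qed.

(* [p + i s] is the complex derivative at [x + i y] of [U + i V] *)
Definition cauchy_riemann (U V : R -> R -> R) x y p s :=
  forall e, 0 < e -> exists2 dl, 0 < dl & forall x' y',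
    `|x' - x| < dl -> `|y' - y| < dl ->
    `|U x' y' - U x y - (p * (x' - x) - s * (y' - y))| <= e * (`|x' - x| + `|y' - y|) /\
    `|V x' y' - V x y - (s * (x' - x) + p * (y' - y))| <= e * (`|x' - x| + `|y' - y|).

Lemma linear_growth_continuous f x D : (forall e, 0 < e -> exists2 dl, 0 < dl & forall x',
  `|x' - x| < dl -> `|f x' - f x| <= (e + D) * `|x' - x|) -> {for x, continuous f}.
Proof.
move=> hg; have [dl dl0 hdl] := hg 1 ltr01.
apply/cvgrPdist_lt => e e0; near=> x'; rewrite distrC.
have x'x : `|x' - x| < dl.
  by rewrite distrC; near: x'; apply: cvgr_dist_lt => //; exact: cvg_id.
have x'e : `|x' - x| < e / (`|1 + D| + 1).
  rewrite distrC; near: x'; apply: cvgr_dist_lt; first exact: cvg_id.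
  by rewrite divr_gt0// addr_gt0.
apply: (le_lt_trans (hdl _ x'x)).
apply: (@le_lt_trans _ _ ((`|1 + D| + 1) * `|x' - x|)).
  by rewrite ler_wpM2r//; have := ler_norm (1 + D); lra.
by rewrite mulrC -ltr_pdivlMr// addr_gt0.
Unshelve. all: by end_near. Qed.

Lemma cauchy_riemann_cont1 (U V : R -> R -> R) x y p s :
  cauchy_riemann U V x y p s -> {for x, continuous (U ^~ y)}.
Proof.
move=> ps; apply: (@linear_growth_continuous _ _ `|p|) => e e0; have [dl dl0 hdl] := ps e e0.
exists dl => // x' hx'; have := hdl x' y hx'; rewrite subrr normr0 => /(_ dl0)[+ _].
rewrite mulr0 subr0 addr0 => h; rewrite mulrDl -normrM.
have := ler_normD (U x' y - U x y - p * (x' - x)) (p * (x' - x)); rewrite subrK; lra.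
Qed.

Lemma cauchy_riemann_cont2 (U V : R -> R -> R) x y p s :
  cauchy_riemann U V x y p s -> {for y, continuous (V x)}.
Proof.
move=> ps; apply: (@linear_growth_continuous _ _ `|p|) => e e0; have [dl dl0 hdl] := ps e e0.
exists dl => // y' hy'; have := hdl x y'; rewrite subrr normr0 => /(_ dl0 hy')[_ +].
rewrite mulr0 add0r add0r => h; rewrite mulrDl -normrM.
have := ler_normD (V x y' - V x y - p * (y' - y)) (p * (y' - y)); rewrite subrK; lra.
Qed.

(** This is the real part of the vanishing contour integral of [U + iV], the only half used for the
    Cauchy estimate. The boundary term [B] is additive under quadrisection and is compared with [e]
    times the squared half-perimeter, which is additive over the four quarters too. *)
Lemma goursat (U V : R -> R -> R) a b c d : a <= b -> c <= d ->
  (forall x y, a <= x <= b -> c <= y <= d -> exists p s, cauchy_riemann U V x y p s) ->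
  Int (fun x => U x c - U x d) a b = Int (fun y => V b y - V a y) c d.
Proof.
move=> ab cd hCR.
have contUx y : c <= y <= d -> cont_on (U ^~ y) a b.
  by move=> hy x hx; have [p [s ps]] := hCR x y hx hy; exact: cauchy_riemann_cont1 ps.
have contVy x : a <= x <= b -> cont_on (V x) c d.
  by move=> hx y hy; have [p [s ps]] := hCR x y hx hy; exact: cauchy_riemann_cont2 ps.
have cU a1 b1 y : a <= a1 -> b1 <= b -> c <= y -> y <= d -> cont_on (U ^~ y) a1 b1.
  move=> h1 h2 h3 h4 x /andP[h5 h6]; apply: contUx; first by rewrite h3.
  by rewrite (le_trans h1)//= (le_trans h6).
have cV c1 d1 x : c <= c1 -> d1 <= d -> a <= x -> x <= b -> cont_on (V x) c1 d1.
  move=> h1 h2 h3 h4 y /andP[h5 h6]; apply: contVy; first by rewrite h3.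
  by rewrite (le_trans h1)//= (le_trans h6).
have cUU a1 b1 y1 y2 : a <= a1 -> b1 <= b -> c <= y1 -> y1 <= d -> c <= y2 -> y2 <= d ->
    cont_on (fun x => U x y1 - U x y2) a1 b1.
  by move=> h1 h2 h3 h4 h5 h6 x hx; apply: cvgB; apply: cU hx.
have cVV c1 d1 x1 x2 : c <= c1 -> d1 <= d -> a <= x1 -> x1 <= b -> a <= x2 -> x2 <= b ->
    cont_on (fun y => V x1 y - V x2 y) c1 d1.
  by move=> h1 h2 h3 h4 h5 h6 y hy; apply: cvgB; apply: cV hy.
pose B a b c d := Int (fun x => U x c - U x d) a b - Int (fun y => V b y - V a y) c d.
suff key e : 0 < e -> `|B a b c d| <= e * ((b - a) + (d - c)) ^+ 2.
  apply/eqP; rewrite -subr_eq0 -normr_le0 -/(B a b c d); apply/ler_addgt0Pl => e e0.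
  rewrite addr0; pose w := ((b - a) + (d - c)) ^+ 2 + 1.
  have w0 : 0 < w by rewrite /w ltr_wpDl// sqr_ge0.
  apply: (le_trans (key (e / w) (divr_gt0 e0 w0))).
  by rewrite mulrAC ler_pdivrMr// ler_pM2l// /w lerDl.
move=> e0; pose P a' b' c' d' := a <= a' -> b' <= b -> c <= c' -> d' <= d ->
  `|B a' b' c' d'| <= e * ((b' - a') + (d' - c')) ^+ 2.
suff : P a b c d by apply.
apply: quadrisection => //.
- move=> a1 b1 c1 d1 ab1 cd1; set p := (a1 + b1) / 2; set r := (c1 + d1) / 2.
  have [p1 p2] : a1 <= p /\ p <= b1 by rewrite /p; lra.
  have [r1 r2] : c1 <= r /\ r <= d1 by rewrite /r; lra.
  move=> P1 P2 P3 P4 h1 h2 h3 h4.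
  have ap := le_trans h1 p1; have pb := le_trans p2 h2.
  have cr := le_trans h3 r1; have rd := le_trans r2 h4.
  have c1d := le_trans r1 rd; have cd1' := le_trans cr r2.
  have a1b := le_trans p1 pb; have ab1' := le_trans ap p2.
  have -> : B a1 b1 c1 d1 = (B a1 p c1 r + B p b1 c1 r) + (B a1 p r d1 + B p b1 r d1).
    rewrite /B !IntB; do ?by [apply: cU|apply: cV].
    rewrite (Int_chasles p1 p2 (cU _ _ _ h1 h2 h3 c1d)).
    rewrite (Int_chasles p1 p2 (cU _ _ _ h1 h2 cd1' h4)).
    rewrite (Int_chasles r1 r2 (cV _ _ _ h3 h4 h1 a1b)).
    rewrite (Int_chasles r1 r2 (cV _ _ _ h3 h4 ab1' h2)).
    by ring.
  have h (w1 w2 w3 w4 z1 z2 z3 z4 : R) : `|w1| <= z1 -> `|w2| <= z2 -> `|w3| <= z3 ->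
      `|w4| <= z4 -> `|w1 + w2 + (w3 + w4)| <= z1 + z2 + (z3 + z4).
    move=> k1 k2 k3 k4; apply: (le_trans (ler_normD _ _)); apply: lerD;
    by apply: (le_trans (ler_normD _ _)); apply: lerD.
  have {}P1 := P1 h1 pb h3 rd.
  have {}P2 := P2 ap h2 h3 rd.
  have {}P3 := P3 h1 pb cr h4.
  have {}P4 := P4 ap h2 cr h4.
  apply: (le_trans (h _ _ _ _ _ _ _ _ P1 P2 P3 P4)).
  rewrite le_eqVlt; apply/orP; left; apply/eqP; rewrite /p /r; by field.
- move=> x y hx hy; have [p [s ps]] := hCR x y hx hy.
  have e20 : 0 < e / 2 by rewrite divr_gt0.
  have [dl dl0 hdl] := ps _ e20; exists dl => // a1 b1 c1 d1 k1 k2 k3 k4 hx1 hy1 w1 w2.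
  move=> _ _ _ _.
  have /andP[ax xb] := hx1; have /andP[cy yd] := hy1.
  have ab1 := le_trans ax xb; have cd1 := le_trans cy yd.
  have a1b := le_trans ab1 k2; have ab1' := le_trans k1 ab1.
  have c1d := le_trans cd1 k4; have cd1' := le_trans k3 cd1.
  set W := (b1 - a1) + (d1 - c1).
  have near_box x' y' : a1 <= x' <= b1 -> c1 <= y' <= d1 ->
    `|U x' y' - U x y - (p * (x' - x) - s * (y' - y))| <= e / 2 * W /\
    `|V x' y' - V x y - (s * (x' - x) + p * (y' - y))| <= e / 2 * W.
    have dist (z z' l r : R) : l <= z <= r -> l <= z' <= r -> `|z' - z| <= r - l.
      by move=> h h'; rewrite ler_norml; clear -h h'; lra.
    move=> hx' hy'.
    have nx := dist _ _ _ _ hx1 hx'; have ny := dist _ _ _ _ hy1 hy'.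
    have [] := hdl x' y' (le_lt_trans nx w1) (le_lt_trans ny w2).
    have : e / 2 * (`|x' - x| + `|y' - y|) <= e / 2 * W by rewrite ler_pM2l// lerD.
    by move=> h H1 H2; split; [exact: le_trans H1 h|exact: le_trans H2 h].
  have diff_le (z1 z2 z0 t1 t2 t : R) : `|z1 - z0 - t1| <= e / 2 * W ->
      `|z2 - z0 - t2| <= e / 2 * W -> t1 - t2 = t -> `|z1 - z2 - t| <= e * W.
    move=> h1 h2 <-; rewrite (_ : _ - _ - _ = (z1 - z0 - t1) - (z2 - z0 - t2)); last by ring.
    apply: (le_trans (ler_normB _ _)); apply: (le_trans (lerD h1 h2)).
    by rewrite -mulrDl -splitr.
  have HU : `|Int (fun x => U x c1 - U x d1) a1 b1 - s * (d1 - c1) * (b1 - a1)|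
      <= e * W * (b1 - a1).
    apply: Int_near_cst => //; first by apply: cUU.
    move=> x' hx'.
    have [h1 _] := near_box x' c1 hx' (introT andP (conj (lexx _) cd1)).
    have [h2 _] := near_box x' d1 hx' (introT andP (conj cd1 (lexx _))).
    by apply: diff_le h1 h2 _; ring.
  have HV : `|Int (fun y => V b1 y - V a1 y) c1 d1 - s * (b1 - a1) * (d1 - c1)|
      <= e * W * (d1 - c1).
    apply: Int_near_cst => //; first by apply: cVV.
    move=> y' hy'.
    have [_ h2] := near_box a1 y' (introT andP (conj (lexx _) ab1)) hy'.
    have [_ h1] := near_box b1 y' (introT andP (conj ab1 (lexx _))) hy'.
    by apply: diff_le h1 h2 _; ring.
  (* The linear parts of [U] and [V] contribute the same multiple [s] of the area to both integrals
     and cancel. *)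
  have -> : B a1 b1 c1 d1 = (Int (fun x => U x c1 - U x d1) a1 b1 - s * (d1 - c1) * (b1 - a1))
     - (Int (fun y => V b1 y - V a1 y) c1 d1 - s * (b1 - a1) * (d1 - c1)).
    by rewrite /B; ring.
  apply: (le_trans (ler_normB _ _)); apply: (le_trans (lerD HU HV)).
  by rewrite -mulrDr -mulrA -expr2.
Qed.
End Goursat.

(** * The Cauchy estimate in one variable *)

Section CauchyEstimate.
Context {R : realType}.
Local Notation C := (Cplx R).
Implicit Types (f g : C -> C) (z w d h : C) (e x y : R).

Definition cdif f z d := forall e, 0 < e -> exists2 dl, 0 < dl &
  forall h, nc h < dl -> nc (f (z + h) - f z - d * h) <= e * nc h.

Lemma cdif_lip f z d : cdif f z d -> exists2 dl, 0 < dl &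
  forall h, nc h < dl -> nc (f (z + h) - f z) <= (nc d + 1) * nc h.
Proof.
move=> /(_ 1 ltr01)[dl dl0 hdl]; exists dl => // h /hdl hh.
rewrite -[_ - f z](subrK (d * h)); apply: (le_trans (ncD _ _)).
by rewrite mulrDl addrC ncM lerD2l.
Qed.

Lemma cdif_cst c z : cdif (fun=> c) z 0.
Proof.
by move=> e e0; exists 1 => // h _; rewrite mul0r !subrr nc0 mulr_ge0 ?nc_ge0// ltW.
Qed.

Lemma cdifB f g z d d' : cdif f z d -> cdif g z d' -> cdif (fun z => f z - g z) z (d - d').
Proof.
move=> hf hg e e0; have e20 : 0 < e / 2 by rewrite divr_gt0.
have [d1 d10 h1] := hf _ e20; have [d2 d20 h2] := hg _ e20.
exists (Num.min d1 d2); first by rewrite lt_min d10.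
move=> h; rewrite lt_min => /andP[/h1 k1 /h2 k2].
rewrite (_ : _ - _ = (f (z + h) - f z - d * h) - (g (z + h) - g z - d' * h)); last by ring.
by apply: (le_trans (ncD _ _)); rewrite ncN [e]splitr mulrDl lerD.
Qed.

Lemma cdifM f g z d d' : cdif f z d -> cdif g z d' ->
  cdif (fun z => f z * g z) z (d * g z + f z * d').
Proof.
move=> hf hg e e0.
have [d0 d00 h0] := cdif_lip hf.
(* The coefficients of the three error terms of the product rule; the final [1] makes [m]
   positive. *)
pose m := nc (f z) + (nc d + 1) + nc (g z) + (nc d + 1) * nc d' + 1.
have m0 : 0 < m.
  by rewrite /m ltr_wpDl// !addr_ge0 ?mulr_ge0 ?addr_ge0 ?nc_ge0.
have em : 0 < e / m by rewrite divr_gt0.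
have [d1 d10 h1] := hf _ em; have [d2 d20 h2] := hg _ em.
exists (Num.min (Num.min d0 1) (Num.min (e / m) (Num.min d1 d2))).
  by rewrite !lt_min d00 ltr01 em d10 d20.
move=> h; rewrite !lt_min => /andP[/andP[/h0 k0 hl1] /andP[hem /andP[/h1 k1 /h2 k2]]].
rewrite (_ : _ - _ = (f (z + h) - f z + f z) * (g (z + h) - g z - d' * h)
  + (f (z + h) - f z - d * h) * g z + (f (z + h) - f z) * d' * h); last by ring.
have n1 : nc (f (z + h) - f z + f z) <= nc (f z) + (nc d + 1).
  apply: (le_trans (ncD _ _)); rewrite addrC lerD2l (le_trans k0)//.
  by rewrite ler_piMr ?addr_ge0 ?nc_ge0// ltW.
apply: (le_trans (ncD _ _)); apply: (le_trans (lerD (ncD _ _) (lexx _))).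
rewrite !ncM.
have t1 : nc (f (z + h) - f z + f z) * nc (g (z + h) - g z - d' * h) <=
    (nc (f z) + (nc d + 1)) * (e / m * nc h) by rewrite ler_pM ?nc_ge0.
have t2 : nc (f (z + h) - f z - d * h) * nc (g z) <= e / m * nc h * nc (g z).
  by rewrite ler_wpM2r ?nc_ge0.
have t3 : nc (f (z + h) - f z) * nc d' * nc h <= (nc d + 1) * nc h * nc d' * (e / m).
  by rewrite ler_pM ?mulr_ge0 ?nc_ge0 ?ler_wpM2r ?nc_ge0// ltW.
apply: (le_trans (lerD (lerD t1 t2) t3)).
have -> : e * nc h = m * (e / m * nc h) by field; rewrite gt_eqF.
rewrite [leLHS](_ : _ = (m - 1) * (e / m * nc h)); last by rewrite /m; ring.
apply: ler_wpM2r; rewrite ?gerBl ?(mulr_ge0 (ltW em)) ?nc_ge0//.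
Qed.

Lemma cdif_comp f g z d d' : cdif f z d -> cdif g (f z) d' -> cdif (g \o f) z (d' * d).
Proof.
move=> hf hg e e0; have [d0 d00 h0] := cdif_lip hf.
pose m := nc d + 1 + nc d' + 1.
have m0 : 0 < m by rewrite /m !ltr_wpDl// ?addr_ge0 ?nc_ge0.
have em : 0 < e / m by rewrite divr_gt0.
have n0 : 0 < nc d + 1 by rewrite ltr_wpDl ?nc_ge0.
have [d1 d10 h1] := hf _ em; have [d2 d20 h2] := hg _ em.
exists (Num.min (Num.min d0 d1) (d2 / (nc d + 1))).
  by rewrite !lt_min d00 d10 divr_gt0.
move=> h; rewrite !lt_min => /andP[/andP[/h0 k0 /h1 k1] k2] /=.
have k3 : nc (f (z + h) - f z) < d2.
  by apply: (le_lt_trans k0); rewrite mulrC -ltr_pdivlMr.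
have := h2 _ k3; rewrite [f z + _]addrC subrK => k4.
rewrite (_ : _ - _ = (g (f (z + h)) - g (f z) - d' * (f (z + h) - f z))
   + d' * (f (z + h) - f z - d * h)); last by ring.
apply: (le_trans (ncD _ _)); rewrite ncM.
have t1 : e / m * nc (f (z + h) - f z) <= e / m * ((nc d + 1) * nc h).
  by rewrite ler_pM2l.
have t2 : nc d' * nc (f (z + h) - f z - d * h) <= nc d' * (e / m * nc h).
  by rewrite ler_wpM2l ?nc_ge0.
apply: (le_trans (lerD (le_trans k4 t1) t2)).
have -> : e * nc h = m * (e / m * nc h) by field; rewrite gt_eqF.
rewrite [leLHS](_ : _ = (nc d + 1 + nc d') * (e / m * nc h)); last by ring.
by apply: ler_wpM2r; rewrite ?lerDl ?(mulr_ge0 (ltW em)) ?nc_ge0//.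
Qed.

Definition cexp z : C := cx (expR (re z) * cos (im z)) (expR (re z) * sin (im z)).

Lemma cexpD z w : cexp (z + w) = cexp z * cexp w.
Proof.
apply: cx_inj; rewrite ?reM ?imM /cexp /= reD imD expRD ?cosD ?sinD; ring.
Qed.

Lemma nc_cexp z : nc (cexp z) = expR (re z).
Proof.
rewrite ncE /= !exprMn -mulrDr cos2Dsin2 mulr1 sqrtr_sqr ger0_norm// expR_ge0.
Qed.

Lemma is_derive_eps (f : R -> R) x (d : R) : is_derive x 1 f d -> forall e, 0 < e ->
  exists2 dl, 0 < dl & forall h : R, `|h| < dl -> `|f (x + h) - f x - d * h| <= e * `|h|.
Proof.
move=> [dfx fd] e e0.
have : h^-1 *: (f (h *: 1 + x) - f x) @[h --> 0^'] --> d by rewrite -fd; exact: dfx.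
move=> /cvgrPdist_le/(_ _ e0); rewrite near_withinE => /nbhs_ballP[dl /= dl0 hdl].
exists dl => // h hh; have [->|h0] := eqVneq h 0.
  by rewrite addr0 subrr mulr0 subrr normr0 mulr0.
have := hdl h; rewrite /ball/= sub0r normrN => /(_ hh h0).
rewrite distrC => hq.
rewrite (_ : _ - _ = (h^-1 *: (f (h *: 1 + x) - f x) - d) * h); first by rewrite normrM ler_wpM2r.
rewrite [h *: 1]mulr1 [h + x]addrC mulrBl; congr (_ - _).
by rewrite -[_ *: _]/(h^-1 * _) mulrAC mulVf// mul1r.
Qed.

Lemma cdif_cexp0 : cdif cexp 0 1.
Proof.
(* The real and imaginary errors add up to [9 e' |h|], and [e' <= 1] gives [|a| <= 1], hence
   [e^a <= 3]. *)
move=> e e0; have [e' [e'0 e'1 e'9]] : exists e', [/\ 0 < e', e' <= 1 & e' <= e / 9].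
  by exists (Num.min (e / 9) 1); rewrite lt_min ltr01 divr_gt0// !ge_min !lexx orbT.
have [d1 d10 h1] := is_derive_eps (is_derive_expR 0) e'0.
have [d2 d20 h2] := is_derive_eps (is_derive_cos 0) e'0.
have [d3 d30 h3] := is_derive_eps (is_derive_sin 0) e'0.
exists (Num.min (Num.min e' d1) (Num.min d2 d3)); first by rewrite !lt_min e'0 d10 d20 d30.
move=> h; rewrite !lt_min => /andP[/andP[k0 k1] /andP[k2 k3]].
have := h1 _ (le_lt_trans (re_le_nc _) k1).
have := h2 _ (le_lt_trans (im_le_nc _) k2).
have := h3 _ (le_lt_trans (im_le_nc _) k3).
rewrite !add0r expR0 sin0 cos0 oppr0 mul0r !subr0 addr0 !mul1r.
set a := re h; set b := im h => hs hc hx.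
have a1 : `|a| <= e' by rewrite ltW// (le_lt_trans (re_le_nc _) k0).
have x1 : `|expR a - 1| <= 2 * `|a|.
  rewrite -[_ - 1](subrK a); apply: (le_trans (ler_normD _ _)).
  have : e' * `|a| <= 1 * `|a| by rewrite ler_wpM2r.
  by move: hx; clear; lra.
have x3 : expR a <= 3.
  by move: x1 a1 e'1; rewrite ler_norml; clear; lra.
have -> : cexp h - cexp 0 - h =
  cx ((expR a - 1 - a) + expR a * (cos b - 1)) (expR a * (sin b - b) + (expR a - 1) * b).
  apply: cx_inj; rewrite !(reD, imD, reN, imN) /= ?expR0 ?cos0 ?sin0 -/a -/b; ring.
apply: (le_trans (nc_le_re_im _)) => /=.
have t1 : `|expR a - 1 - a + expR a * (cos b - 1)| <= e' * nc h + 3 * (e' * nc h).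
  apply: (le_trans (ler_normD _ _)); apply: lerD.
    by apply: (le_trans hx); rewrite ler_pM2l ?re_le_nc.
  rewrite normrM ger0_norm ?expR_ge0// ler_pM ?expR_ge0//.
  by apply: (le_trans hc); rewrite ler_pM2l ?im_le_nc.
have t2 : `|expR a * (sin b - b) + (expR a - 1) * b| <= 3 * (e' * nc h) + 2 * e' * nc h.
  apply: (le_trans (ler_normD _ _)); apply: lerD.
    rewrite normrM ger0_norm ?expR_ge0// ler_pM ?expR_ge0//.
    by apply: (le_trans hs); rewrite ler_pM2l ?im_le_nc.
  rewrite normrM ler_pM ?im_le_nc//; apply: (le_trans x1); rewrite ler_pM2l//.
apply: (le_trans (lerD t1 t2)).
have -> : e' * nc h + 3 * (e' * nc h) + (3 * (e' * nc h) + 2 * e' * nc h) = 9 * e' * nc h by ring.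
by apply: ler_wpM2r; rewrite ?nc_ge0// mulrC -ler_pdivlMr.
Qed.

Lemma cdif_cexp z : cdif cexp z (cexp z).
Proof.
move=> e e0; have p := expR_gt0 (re z).
have [dl dl0 hdl] := cdif_cexp0 (divr_gt0 e0 p).
exists dl => // h /hdl; rewrite add0r mul1r (_ : cexp 0 = 1); last first.
  by apply: cx_inj; rewrite /= expR0 ?cos0 ?sin0 ?mulr1 ?mulr0.
move=> hh; rewrite cexpD (_ : _ - _ = cexp z * (cexp h - 1 - h)); last by ring.
by rewrite ncM nc_cexp mulrC -ler_pdivlMr// mulrAC.
Qed.

Lemma cdif_opp z : cdif -%R z (-1).
Proof.
move=> e e0; exists 1 => // h _.
rewrite (_ : _ - _ = 0) ?nc0 ?mulr_ge0 ?nc_ge0 ?(ltW e0)//.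
by rewrite mulN1r !opprK opprD [- z - h + z]addrAC addNr add0r addNr.
Qed.

Lemma cdif_cauchy_riemann f x y d : cdif f (cx x y) d ->
  cauchy_riemann (fun x y => re (f (cx x y))) (fun x y => im (f (cx x y))) x y (re d) (im d).
Proof.
move=> hf e e0; have [dl dl0 hdl] := hf _ e0; exists (dl / 2); first by rewrite divr_gt0.
move=> x' y' hx hy; pose h := cx (x' - x) (y' - y).
have nh : nc h <= `|x' - x| + `|y' - y| := nc_le_re_im h.
have /hdl : nc h < dl by rewrite (le_lt_trans nh)// [dl]splitr ltrD.
have -> : cx x y + h = cx x' y' by apply: cx_inj; rewrite ?reD ?imD /= addrC subrK.
move=> hh; have {}hh := le_trans hh (ler_wpM2l (ltW e0) nh).
have := le_trans (re_le_nc _) hh; have := le_trans (im_le_nc _) hh.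
rewrite !(reD, imD, reN, imN, reM, imM) /=; move=> h1 h2; split => //.
by rewrite [im d * _ + _]addrC.
Qed.

(** The factor 2 comes from bounding [g (e^z) - g 0] by [2 S] on the right side of the rectangle.
    The left side is not sent to the limit but placed where the difference quotient of [g] at [0] is
    within [e] of [d]; the horizontal sides cancel because the height is [2 pi]. *)
Lemma cauchy_estimate0 g r S d : 0 < r -> (forall z, nc z < r -> exists d, cdif g z d) ->
  (forall z, nc z < r -> nc (g z) <= S) -> cdif g 0 d -> nc d * r <= 2 * S.
Proof.
move=> r0 hg hS hd.
have S0 : 0 <= S by apply: le_trans (hS 0 _); rewrite ?nc_ge0 ?nc0.
have [->|d0] := eqVneq d 0; first by rewrite nc0 mul0r mulr_ge0.
have nd : 0 < nc d := nc_gt0 d0.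
(* [rho] will be the midpoint of [2 S / |d|] and [r]: strictly below [r], where [g] is
   differentiable, yet still violating the bound. *)
rewrite leNgt; apply/negP => hlt.
have [rho [rho0 rhor hrho]] : exists rho, [/\ 0 < rho, rho < r & 2 * S < nc d * rho].
  exists ((2 * S / nc d + r) / 2).
  have : 2 * S / nc d < r by rewrite ltr_pdivrMr// [r * _]mulrC.
  have : 0 <= 2 * S / nc d by rewrite divr_ge0 ?nc_ge0// mulr_ge0.
  set t := _ / nc d => t0 tr; split; [lra|lra|].
  by rewrite [nc d * _]mulrC -ltr_pdivrMr// -/t; lra.
pose e := (nc d - 2 * S / rho) / 2.
have e0 : 0 < e by rewrite divr_gt0// subr_gt0 ltr_pdivrMr.
(* [c] is [i] times the conjugate of [d], so [c d = i |d|^2] and the imaginary part sees the whole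
   modulus. *)
pose c := cx (im d) (re d).
have nca : nc c = nc d by rewrite !ncE /= addrC.
pose f z := c * ((g (cexp z) - g 0) * cexp (- z)).
have hf z : re z < ln r -> exists d, cdif f z d.
  move=> hz; have [w hw] : exists w, cdif g (cexp z) w.
    by apply: hg; rewrite nc_cexp -[ltRHS]lnK ?posrE// ltr_expR.
  eexists; apply: cdifM; first exact: cdif_cst.
  apply: cdifM; first by apply: cdifB; [apply: cdif_comp (cdif_cexp z) hw|exact: cdif_cst].
  exact: cdif_comp (cdif_opp z) (cdif_cexp (- z)).
have [dl dl0 hdl] := hd _ e0.
pose b := ln rho; pose a := Num.min b (ln (dl / 2)).
have ab : a <= b by rewrite /a ge_min lexx.
have ea : expR a < dl.
  apply: (@le_lt_trans _ _ (dl / 2)); last by rewrite ltr_pdivrMr// ltr_pMr// ltr1n.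
  by rewrite -[leRHS]lnK ?posrE ?divr_gt0// ler_expR /a ge_min lexx orbT.
have pi0 : 0 <= 2 * pi :> R by rewrite mulr_ge0// pi_ge0.
pose U x y := re (f (cx x y)); pose V x y := im (f (cx x y)).
have CR x y : a <= x <= b -> exists p s, cauchy_riemann U V x y p s.
  move=> /andP[_ xb]; have [w /cdif_cauchy_riemann hw] : exists w, cdif f (cx x y) w.
    by apply: hf; rewrite /= (le_lt_trans xb)// ltr_ln.
  by exists (re w), (im w).
have := goursat ab pi0 (fun x y hx _ => CR x y hx).
have -> : (fun x => U x 0 - U x (2 * pi)) = (fun=> 0).
  apply/funext => x; rewrite /U /f.
  have p2 : 2 * pi = pi *+ 2 :> R by rewrite mulrC mulr_natr.
  have per u : cexp (cx u (2 * pi)) = cexp (cx u 0).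
    by rewrite /cexp /= p2 cos2pi sin2pi cos0 sin0.
  have perN : cexp (- cx x (2 * pi)) = cexp (- cx x 0).
    rewrite /cexp !(reN, imN) /= cosN sinN oppr0 p2.
    by rewrite cos2pi sin2pi cos0 sin0 oppr0.
  by rewrite per perN subrr.
rewrite Int_cst// mul0r => h0.
(* With [e] half of [|d| - 2 S / rho], [V b - V a <= - |d| e] on the whole period, whereas its
   integral is zero. *)
pose kap := nc d * e.
have kap0 : 0 < kap by rewrite mulr_gt0.
have inab : (a <= a <= b) /\ (a <= b <= b) by rewrite !lexx ab.
have contV x : a <= x <= b -> cont_on (V x) 0 (2 * pi).
  by move=> hx y _; have [p [s ps]] := CR x y hx; exact: cauchy_riemann_cont2 ps.
have : Int (fun y => V b y - V a y) 0 (2 * pi) <= Int (fun=> - kap) 0 (2 * pi).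
  apply: Int_le; [|exact: cont_on_cst|].
    by move=> y hy; apply: cvgB; apply: contV hy; case: inab.
  move=> y _.
  have hb : V b y <= nc d * (2 * S / rho).
    apply: le_trans (ler_norm _) _; apply: le_trans (im_le_nc _) _.
    rewrite /f !ncM nca ler_pM2l//.
    have nb : nc (cexp (cx b y)) = rho by rewrite nc_cexp /= lnK.
    have nbN : nc (cexp (- cx b y)) = rho^-1 by rewrite nc_cexp reN /= expRN lnK.
    rewrite nbN ler_pM2r ?invr_gt0//; apply: (le_trans (ncD _ _)).
    by rewrite ncN mulr_natl mulr2n lerD// hS ?nb ?nc0.
  have ha : nc d * nc d - nc d * e <= V a y.
    pose w := cexp (cx a y).
    have nw : nc w < dl by rewrite nc_cexp.
    have w1 : w * cexp (- cx a y) = 1.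
      rewrite -cexpD subrr; apply: cx_inj;
      by rewrite /= expR0 ?cos0 ?sin0 ?mulr1 ?mulr0.
    have := hdl _ nw; rewrite add0r => hw.
    have fE : f (cx a y) = c * d + c * ((g w - g 0 - d * w) * cexp (- cx a y)).
      by rewrite /f -/w [in RHS]mulrBl -[d * w * _]mulrA w1 mulr1; ring.
    have icd : im (c * d) = nc d * nc d.
      rewrite -expr2 ncE sqr_sqrtr ?addr_ge0 ?sqr_ge0// imM /=; ring.
    rewrite /V fE imD icd lerD2l.
    have : `|im (c * ((g w - g 0 - d * w) * cexp (- cx a y)))| <= nc d * e.
      apply: le_trans (im_le_nc _) _; rewrite !ncM nca ler_pM2l//.
      apply: (le_trans (ler_wpM2r (nc_ge0 _) hw)).
      by rewrite -mulrA -ncM w1 nc1 mulr1.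
    by rewrite ler_norml => /andP[].
  have -> : - kap = nc d * (2 * S / rho) - (nc d * nc d - nc d * e).
    by rewrite /kap /e; field; rewrite gt_eqF.
  exact: lerB.
rewrite -h0 Int_cst// subr0 leNgt; apply/negP; rewrite negbK.
by rewrite mulNr oppr_lt0 mulr_gt0// mulr_gt0// pi_gt0.
Qed.
End CauchyEstimate.

(** * Differentials in terms of the Euclidean norm *)

Lemma differentiable_eps (K : numFieldType) (V W : normedModType K) (f : V -> W)
    (L : {linear V -> W}) (x : V) : continuous L ->
  (forall e, 0 < e -> \forall h \near (0 : V), `|f (h + x) - (f x + L h)| <= e * `|h|) ->
  differentiable f x /\ 'd f x = L :> (V -> W).
Proof.
move=> cL hL; have dL : f \o shift x = cst (f x) + L +o_ (0 : V) id.
  by apply/eqaddoP => e /hL.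
have dfE := diff_unique cL dL; split=> //.
by apply/diff_locallyP; rewrite dfE.
Qed.

Section Interface.
Context {R : realType} {k : nat}.
Local Notation C := (Cplx R).
Local Notation V := 'V[R]_k.
Implicit Types (u v w h : V) (f g : V -> V) (A B : 'M[C]_k) (e r : R).

Lemma ge0_cx (z : C) : 0 <= z -> z = cx (re z) 0.
Proof. by case: z => a b; rewrite lecE /= => /andP[/eqP -> _]. Qed.

Lemma gt0_cx (z : C) : 0 < z -> z = cx (re z) 0 /\ 0 < re z.
Proof.
move=> z0; have zE := ge0_cx (ltW z0); split=> //.
by rewrite -cx_lt -zE.
Qed.

(** The library builds the topology and the differentials of row vectors on the sup norm, with
    values in [C]. This comparison carries neighbourhoods, limits and differentials over to the
    Euclidean norm. *)
Lemma norm_row_enorm v : exists N : R,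
  [/\ `|v| = cx N 0, 0 <= N, N <= enorm v & enorm v <= k%:R * N].
Proof.
exists (re `|v|); have vE := ge0_cx (normr_ge0 v); split=> //.
  by rewrite -cx_le -vE normr_ge0.
  have [/eqP|] := eqVneq (mx_norm v) 0.
    rewrite -[mx_norm v]/(`|v|) normr_eq0 => /eqP ->.
    by rewrite normr0 enorm0.
  move=> /mx_norm_neq0[[i j] /=]; rewrite -[mx_norm v]/(`|v|) normE => ->.
  by rewrite (ord1 i) nc_le_enorm.
apply: enorm_le => i; rewrite -cx_le -vE -normE.
rewrite -[leRHS]/(mx_norm v) mx_normE -[leLHS]nngE num_le.
exact: (@le_bigmax _ _ _ 0%:nng (fun p : 'I_1 * 'I_k => `|v p.1 p.2|%:nng) (0, i)).
Qed.

Lemma nbhs_enormP v (P : set V) :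
  nbhs v P <-> exists2 d : R, 0 < d & forall w, enorm (w - v) < d -> P w.
Proof.
split=> [/nbhs_ballP[e /= e0 he]|[d d0 hd]].
  have [eE re0] := gt0_cx e0; exists (re e) => // w hw; apply: he.
  rewrite mx_norm_ball /ball_ /=; have [N [-> _ hN _]] := norm_row_enorm (v - w).
  by rewrite eE cx_lt (le_lt_trans hN)// enormB.
have k1 : 0 < k%:R + 1 :> R by rewrite ltr_wpDl.
have dk : 0 < d / (k%:R + 1) by rewrite divr_gt0.
apply/nbhs_ballP; exists (cx (d / (k%:R + 1)) 0) => /=.
  by rewrite -[0]/(cx (0 : R) 0) cx_lt.
move=> w; rewrite mx_norm_ball /ball_ /=; have [N [-> N0 _ hN]] := norm_row_enorm (v - w).
rewrite cx_lt => hNd; apply: hd; rewrite enormB (le_lt_trans hN)//.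
move: hNd; rewrite ltr_pdivlMr// => hNd.
by apply: le_lt_trans hNd; rewrite mulrDr mulr1 mulrC lerDl.
Qed.

Lemma cvg_enormP (T : Type) (F : set_system T) (FF : Filter F) (f : T -> V) (l : V) :
  f @ F --> l <-> forall e, 0 < e -> \forall x \near F, enorm (f x - l) < e.
Proof.
split=> [h e e0|h P /nbhs_enormP[d d0 hd]].
  by apply: (h [set w | enorm (w - l) < e]); apply/nbhs_enormP; exists e.
by near=> x; apply: hd; near: x; exact: h.
Unshelve. all: by end_near. Qed.

Lemma mulmx_bound A : exists2 b : R, 0 <= b & forall h, enorm (h *m A) <= b * enorm h.
Proof.
pose b := \sum_i \sum_j nc (A i j).
have b0 : 0 <= b by do 2!rewrite sumr_ge0// => ? _; rewrite nc_ge0.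
exists (k%:R * b); first by rewrite mulr_ge0.
move=> h; rewrite -mulrA; apply: enorm_le => j; rewrite mxE.
apply: (@le_trans _ _ (\sum_i nc (h 0 i * A i j))).
  elim: (index_enum _) => [|i s IH]; first by rewrite !big_nil nc0.
  by rewrite !big_cons (le_trans (ncD _ _))// lerD2l.
rewrite /b mulr_suml; apply: ler_sum => i _; rewrite ncM mulrC.
rewrite ler_pM ?nc_ge0 ?nc_le_enorm//.
by rewrite (bigD1 j)//= lerDl sumr_ge0// => ? _; rewrite nc_ge0.
Qed.

(* [A] acts on row vectors from the right, as everywhere in MathComp. *)
Definition hasd f v A := forall e, 0 < e -> exists2 d, 0 < d &
  forall h, enorm h < d -> enorm (f (v + h) - f v - h *m A) <= e * enorm h.

Lemma differentiable_hasd f v : differentiable f v ->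
  hasd f v (lin1_mx ('d f v)).
Proof.
move=> df e e0; have k1 : 0 < k%:R + 1 :> R by rewrite ltr_wpDl.
have /diff_locally/eqaddoP := df.
have ek : 0 < cx (e / (k%:R + 1)) 0.
  by rewrite -[0]/(cx (0 : R) 0) cx_lt divr_gt0.
move=> /(_ _ ek) /nbhs_enormP[d d0 hd]; exists d => // h hh.
have := hd h; rewrite subr0 => /(_ hh) /=.
rewrite !fctE /= opprD addrA [h + v]addrC mul_rV_lin1.
have [N [-> N0 _ hN]] := norm_row_enorm (f (v + h) - f v - 'd f v h).
have [N' [-> _ hN' _]] := norm_row_enorm h.
have -> (a b : R) : cx a 0 * cx b 0 = cx (a * b) 0.
  by apply: cx_inj; rewrite ?reM ?imM /= ?mulr0 ?mul0r ?subr0 ?addr0.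
rewrite cx_le => hNN; apply: (le_trans hN).
apply: (@le_trans _ _ (k%:R * (e / (k%:R + 1) * enorm h))).
  apply: ler_wpM2l => //; apply: (le_trans hNN); apply: ler_wpM2l => //.
  by rewrite divr_ge0// ltW.
rewrite mulrA; apply: ler_wpM2r; first exact: enorm_ge0.
rewrite mulrCA ler_piMr// ?(ltW e0)// ler_pdivrMr// mul1r lerDl//.
Qed.

Lemma hasd_diff f v A : hasd f v A ->
  differentiable f v /\ (forall h, 'd f v h = h *m A).
Proof.
move=> hA; have k1 : 0 < k%:R + 1 :> R by rewrite ltr_wpDl.
have cA : continuous (mulmxr A : V -> V).
  move=> w; apply/(@cvg_enormP _ (nbhs w) _ _ _) => e e0; have [b b0 hb] := mulmx_bound A.
  have b1 : 0 < b + 1 by rewrite ltr_wpDl.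
  apply/nbhs_enormP; exists (e / (b + 1)); first by rewrite divr_gt0.
  move=> u; rewrite ltr_pdivlMr// => hu /=; rewrite -mulmxBl (le_lt_trans (hb _))//.
  apply: le_lt_trans hu; rewrite mulrDr mulr1 mulrC lerDl enorm_ge0//.
have [|df dfE] := @differentiable_eps _ _ _ f (mulmxr A) v cA; last first.
  by split=> // h; rewrite dfE.
move=> e e0; have [eE re0] := gt0_cx e0.
have ek : 0 < re e / (k%:R + 1) by rewrite divr_gt0.
  have [d d0 hd] := hA _ ek.
  apply/nbhs_enormP; exists d => // h; rewrite subr0 => /hd hh.
  rewrite opprD addrA [h + v]addrC.
  have [N [-> _ hN _]] := norm_row_enorm (f (v + h) - f v - h *m A).
  have [N' [-> N'0 _ hN']] := norm_row_enorm h.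
  rewrite eE.
  have -> (a b : R) : cx a 0 * cx b 0 = cx (a * b) 0.
    by apply: cx_inj; rewrite ?reM ?imM /= ?mulr0 ?mul0r ?subr0 ?addr0.
  rewrite cx_le; apply: (le_trans hN); apply: (le_trans hh).
  rewrite mulrAC ler_pdivrMr// -mulrA ler_pM2l//.
  by rewrite mulrC (le_trans hN')// ler_wpM2r// lerDl.
Qed.

End Interface.

(** * Holomorphic maps in several variables *)

Section Holomorphic.
Context {R : realType} {k : nat}.
Local Notation C := (Cplx R).
Local Notation V := 'V[R]_k.
Implicit Types (u v w h : V) (f g : V -> V) (A B : 'M[C]_k) (e r S : R).

Definition hol f v r := forall w, enorm (w - v) < r -> exists A, hasd f w A.

Definition bnd f v r S := forall w, enorm (w - v) < r -> enorm (f w) <= S.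

Lemma sub_ball v w w' r r' : enorm (w - v) + r' <= r -> enorm (w' - w) < r' ->
  enorm (w' - v) < r.
Proof.
move=> h h'; apply: le_lt_trans (enormD3 _ w _) _.
by apply: lt_le_trans h; rewrite addrC ltrD2l.
Qed.

Lemma hol_sub f v r w r' : enorm (w - v) + r' <= r -> hol f v r -> hol f w r'.
Proof. by move=> h hf w' hw'; apply: hf; exact: sub_ball h hw'. Qed.

Lemma bnd_sub f v r w r' S : enorm (w - v) + r' <= r -> bnd f v r S -> bnd f w r' S.
Proof. by move=> h hf w' hw'; apply: hf; exact: sub_ball h hw'. Qed.

Lemma hasd_shift f u v A : hasd f (v + u) A -> hasd (fun w => f (w + u)) v A.
Proof.
move=> hf e e0; have [d d0 hd] := hf _ e0; exists d => // h /hd.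
by rewrite [v + u + h]addrAC.
Qed.

Lemma hasdB f g v A B : hasd f v A -> hasd g v B -> hasd (fun w => f w - g w) v (A - B).
Proof.
move=> hf hg e e0; have e2 : 0 < e / 2 by rewrite divr_gt0.
have [d1 d10 h1] := hf _ e2; have [d2 d20 h2] := hg _ e2.
exists (Num.min d1 d2); first by rewrite lt_min d10.
move=> h; rewrite lt_min => /andP[/h1 k1 /h2 k2]; rewrite mulmxBr.
rewrite (_ : _ - _ = (f (v + h) - f v - h *m A) - (g (v + h) - g v - h *m B)).
  by apply: (le_trans (enormD _ _)); rewrite enormN [e]splitr mulrDl lerD.
by rewrite !opprD !opprK [f _ - _ + _]addrACA [LHS]addrACA.
Qed.

Lemma hasdZ (c : C) f v A : hasd f v A -> hasd (fun w => c *: f w) v (c *: A).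
Proof.
move=> hf e e0; have c1 : 0 < nc c + 1 by rewrite ltr_wpDl ?nc_ge0.
have [d d0 hd] := hf _ (divr_gt0 e0 c1); exists d => // h /hd.
rewrite -scalemxAr -!scalerBr enormZ => hh.
apply: (le_trans (ler_wpM2l (nc_ge0 c) hh)).
rewrite mulrA; apply: ler_wpM2r; first exact: enorm_ge0.
by rewrite mulrCA ler_piMr ?(ltW e0)// ler_pdivrMr// mul1r lerDl.
Qed.

Lemma hasd_linear A v : hasd (mulmx^~ A) v A.
Proof.
move=> e e0; exists 1 => // h _.
by rewrite /= mulmxDl addrAC addrK subrr enorm0 mulr_ge0 ?enorm_ge0// ltW.
Qed.

Lemma hasd_cst u v : hasd (fun=> u) v 0.
Proof.
move=> e e0; exists 1 => // h _.
by rewrite subrr mulmx0 subr0 enorm0 mulr_ge0 ?enorm_ge0// ltW.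
Qed.

Lemma hasd_uniq f v A B : hasd f v A -> hasd f v B -> A = B.
Proof.
move=> /hasd_diff[_ hA] /hasd_diff[_ hB]; apply/row_matrixP => i.
by rewrite !rowE -hA -hB.
Qed.

Lemma hasd_lip f v A : hasd f v A -> exists2 d, 0 < d &
  exists2 c, 0 <= c & forall h, enorm h < d -> enorm (f (v + h) - f v) <= c * enorm h.
Proof.
move=> hf; have [d d0 hd] := hf 1 ltr01; have [b b0 hb] := mulmx_bound A.
exists d => //; exists (1 + b); first by rewrite addr_ge0.
move=> h /hd hh; rewrite -[_ - f v](subrK (h *m A)) (le_trans (enormD _ _))//.
by rewrite mulrDl lerD.
Qed.

Lemma hasd_cont f v A : hasd f v A -> forall e, 0 < e -> exists2 d, 0 < d &
  forall w, enorm (w - v) < d -> enorm (f w - f v) < e.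
Proof.
move=> /hasd_lip[d d0 [c c0 hd]] e e0.
have c1 : 0 < c + 1 by rewrite ltr_wpDl.
exists (Num.min d (e / (c + 1))); first by rewrite lt_min d0 divr_gt0.
move=> w; rewrite lt_min ltr_pdivlMr// => /andP[/hd + hw]; rewrite [v + _]addrC subrK.
move/le_lt_trans; apply; apply: le_lt_trans hw.
by rewrite mulrC mulrDr mulr1 lerDl enorm_ge0.
Qed.

Lemma hasd_comp f g v A B : hasd f v A -> hasd g (f v) B -> hasd (g \o f) v (A *m B).
Proof.
move=> hf hg; have [df _] := hasd_diff hf; have [dg _] := hasd_diff hg.
have dgf := differentiable_comp df dg.
suff -> : A *m B = lin1_mx ('d (g \o f) v) by exact: differentiable_hasd.
apply/row_matrixP => i; rewrite !rowE mul_rV_lin1.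
have [_ hA] := hasd_diff hf; have [_ hB] := hasd_diff hg.
have e1 := congr1 ('d g (f v)) (hA (delta_mx 0 i)).
have e2 := hB (delta_mx 0 i *m A).
have e3 := congr1 (fun F => F (delta_mx 0 i)) (diff_comp df dg).
by rewrite mulmxA; exact: (esym (etrans e3 (etrans e1 e2))).
Qed.

(** The constant shared by the estimates below: [k] from passing to coordinates, 2 from the Cauchy
    estimate in [cauchy_vec] and from splitting into real and imaginary parts in [mean_value]. *)
Definition cV : R := 2 * k%:R.
Lemma cV_ge0 : 0 <= cV. Proof. by rewrite mulr_ge0. Qed.

Lemma entryB u v i : (u - v) 0 i = u 0 i - v 0 i.
Proof. by rewrite !mxE. Qed.

Lemma entryZ (c : C) v i : (c *: v) 0 i = c * v 0 i.
Proof. by rewrite mxE. Qed.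

Lemma cdif_slice f v h (z : C) A i : hasd f (v + z *: h) A ->
  cdif (fun t : C => f (v + t *: h) 0 i) z ((h *m A) 0 i).
Proof.
move=> hf e e0; have h1 : 0 < enorm h + 1 by rewrite ltr_wpDl ?enorm_ge0.
have [d d0 hd] := hf _ (divr_gt0 e0 h1).
exists (d / (enorm h + 1)); first by rewrite divr_gt0.
move=> t; rewrite ltr_pdivlMr// => ht.
have th : nc t * enorm h <= nc t * (enorm h + 1).
  by apply: ler_wpM2l; rewrite ?nc_ge0 ?lerDl.
have /hd : enorm (t *: h) < d by rewrite enormZ (le_lt_trans th).
rewrite -[v + z *: h + t *: h]addrA -scalerDl enormZ => hh.
rewrite (_ : _ - _ = (f (v + (z + t) *: h) - f (v + z *: h) - t *: h *m A) 0 i).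
  apply: (le_trans (nc_le_enorm _ i)); apply: (le_trans hh).
  by rewrite mulrAC ler_pdivrMr// -mulrA ler_pM2l.
by rewrite -scalemxAl !entryB entryZ mulrC.
Qed.

(** The one-variable estimate applied to each coordinate of [t |-> f (v + t h)] on the disc of
    radius [r / |h|]. *)
Lemma cauchy_vec f v r S A h : 0 < r -> hol f v r -> bnd f v r S -> hasd f v A ->
  enorm (h *m A) * r <= cV * S * enorm h.
Proof.
move=> r0 hf bf hA; have [->|h0] := eqVneq h 0.
  by rewrite mul0mx enorm0 mul0r mulr0.
have nh := enorm_gt0 h0.
have inb (z : C) : nc z < r / enorm h -> enorm (v + z *: h - v) < r.
  by rewrite addrC addKr enormZ ltr_pdivlMr.
have key i : nc ((h *m A) 0 i) <= 2 * S * enorm h / r.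
  rewrite ler_pdivlMr// -ler_pdivrMr// -mulrA.
  apply: (@cauchy_estimate0 _ (fun t => f (v + t *: h) 0 i)).
  - by rewrite divr_gt0.
  - by move=> z /inb/hf[B hB]; exists ((h *m B) 0 i); exact: cdif_slice.
  - by move=> z /inb/bf; apply: le_trans; exact: nc_le_enorm.
  - by apply: cdif_slice; rewrite scale0r addr0.
rewrite -ler_pdivlMr//; apply: (le_trans (enorm_le key)).
by rewrite /cV !mulrA [k%:R * 2]mulrC.
Qed.

Lemma is_derive_of_eps (f : R -> R) (x d : R) : (forall e, 0 < e ->
  exists2 dl, 0 < dl & forall h : R, `|h| < dl -> `|f (x + h) - f x - d * h| <= e * `|h|) ->
  is_derive x 1 f d.
Proof.
move=> hf.
suff H : h^-1 *: (f (h *: 1 + x) - f x) @[h --> 0^'] --> d.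
  by split; [apply/cvg_ex; exists d|apply/cvg_lim].
apply/cvgrPdist_le => e e0; have [dl dl0 hdl] := hf _ e0.
rewrite near_withinE; apply/nbhs_ballP; exists dl => //= h.
rewrite /ball/= sub0r normrN => hh h0.
have h0' : 0 < `|h| by rewrite normr_gt0.
have := hdl _ hh; rewrite -ler_pdivrMr// -normfV -normrM distrC => hq.
rewrite (_ : _ - _ = (f (x + h) - f x - d * h) / h)//.
rewrite [h *: 1]mulr1 [h + x]addrC mulrBl mulfK//; congr (_ - _).
by rewrite -[_ *: _]/(h^-1 * _) mulrC.
Qed.

(** The real mean value theorem on [[0, 1]], applied to the real and the imaginary part of each
    coordinate; the parameter [p] of [seg] stands for either. *)
Lemma mean_value f u h b : (forall t : R, 0 <= t <= 1 ->
    exists2 A, hasd f (u + cx t 0 *: h) A & enorm (h *m A) <= b) ->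
  enorm (f (u + h) - f u) <= cV * b.
Proof.
move=> hf.
have cxD (a c : R) : cx (a + c) 0 = cx a 0 + cx c 0 :> C.
  by apply: cx_inj; rewrite ?reD ?imD /= ?addr0.
have seg (p : C -> R) i : (forall x y, p (x + y) = p x + p y) -> (forall x, p (- x) = - p x) ->
    (forall x (a : R), p (x * cx a 0) = p x * a) -> (forall x, `|p x| <= nc x) ->
    `|p ((f (u + h) - f u) 0 i)| <= b.
  move=> pD pN pM pn.
  pose phi (t : R) := p (f (u + cx t 0 *: h) 0 i).
  have der (t : R) : 0 <= t <= 1 -> exists2 d : R, is_derive t 1 phi d & `|d| <= b.
    move=> /hf[A hA bA]; exists (p ((h *m A) 0 i)).
      apply: is_derive_of_eps => e e0.
      have [dl dl0 hdl] := cdif_slice i hA e0; exists dl => // t' ht'.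
      have := hdl (cx t' 0); rewrite nc_re => /(_ ht') /(le_trans (pn _)).
      by rewrite !pD !pN pM /phi cxD.
    by apply: le_trans (pn _) _; apply: le_trans (nc_le_enorm _ _) bA.
  (* [MVT_segment] takes the derivative as a function on the line; off the segment it is given the
     value [0]. *)
  have [d hd] : exists d : R -> R, forall t : R, 0 <= t <= 1 -> is_derive t 1 phi (d t) /\ `|d t| <= b.
    have : forall t : R, exists d : R, 0 <= t <= 1 -> is_derive t 1 phi d /\ `|d| <= b.
      move=> t; have [/der[d h1 h2]|] := boolP (0 <= t <= 1); first by exists d.
      by exists 0.
    by move=> /(@choice R R)[d hd]; exists d => t; exact: hd.
  have [||c hc] := @MVT_segment R phi d 0 1 ler01.
  - by move=> x; rewrite in_itv/= => /andP[x0 x1]; apply: (hd _ _).1; rewrite !ltW.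
  - apply: derivable_within_continuous => x; rewrite in_itv/= => hx.
    by have [[]] := hd _ hx.
  rewrite subr0 mulr1 /phi => h1; rewrite entryB pD pN.
  have <- : phi 1 = p (f (u + h) 0 i).
    by rewrite /phi (_ : cx 1 0 = 1) ?scale1r.
  have <- : phi 0 = p (f u 0 i).
    by rewrite /phi (_ : cx 0 0 = 0) ?scale0r ?addr0.
  by rewrite -[_ - _]/(_ - _) h1; apply: (hd _ _).2; move: hc; rewrite in_itv.
rewrite /cV -mulrA mulrCA; apply: enorm_le => i.
apply: (le_trans (nc_le_re_im _)); rewrite mulr_natl mulr2n; apply: lerD; apply: seg.
- exact: reD.
- exact: reN.
- by move=> x a; rewrite reM /= mulr0 subr0.
- exact: re_le_nc.
- exact: imD.
- exact: imN.
- by move=> x a; rewrite imM /= mulr0 add0r.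
- exact: im_le_nc.
Qed.

End Holomorphic.

Ltac vring := apply/rowP => ?; rewrite !mxE; ring.

(** * Lipschitz and Taylor estimates, limits and partial derivatives of bounded holomorphic maps *)

Section CauchyConsequences.
Context {R : realType} {k : nat}.
Local Notation C := (Cplx R).
Local Notation V := 'V[R]_k.
Local Notation cV := (@cV R k).
Implicit Types (u v w h : V) (f g : V -> V) (A B : 'M[C]_k) (e r S t : R).

Lemma ball_convex v u w r t : 0 <= t <= 1 -> enorm (u - v) < r -> enorm (w - v) < r ->
  enorm (u + cx t 0 *: (w - u) - v) < r.
Proof.
move=> /andP[t0 t1] hu hw.
have -> : u + cx t 0 *: (w - u) - v = cx (1 - t) 0 *: (u - v) + cx t 0 *: (w - v).
  have -> : cx (1 - t) 0 = 1 - cx t 0 :> C.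
    by apply: cx_inj; rewrite ?reD ?imD ?reN ?imN /= ?subr0.
  by vring.
apply: (le_lt_trans (enormD _ _)); rewrite !enormZ !nc_re !ger0_norm ?subr_ge0//.
move: t1; rewrite le_eqVlt => /predU1P[->|t1]; first by rewrite subrr mul0r add0r mul1r.
apply: (@lt_le_trans _ _ ((1 - t) * r + t * r)); last by rewrite -mulrDl subrK mul1r.
by apply: ltr_leD; rewrite ?ltr_pM2l ?subr_gt0// ler_wpM2l// ltW.
Qed.

Lemma bounded_deriv_lip f v r b : (forall w, enorm (w - v) < r ->
    exists2 A, hasd f w A & forall h, enorm (h *m A) <= b * enorm h) ->
  forall u w, enorm (u - v) < r -> enorm (w - v) < r ->
  enorm (f u - f w) <= cV * b * enorm (u - w).
Proof.
move=> hf u w hu hw; rewrite -[in f u](subrK w u) [u - w + w]addrC -mulrA.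
apply: mean_value => t ht; have [A hA bA] := hf _ (ball_convex ht hw hu).
by exists A.
Qed.

Lemma hol_lip f v r S u w : 0 < r -> hol f v r -> bnd f v r S ->
  enorm (u - v) < r / 2 -> enorm (w - v) < r / 2 ->
  enorm (f u - f w) <= 2 * cV ^+ 2 * S / r * enorm (u - w).
Proof.
move=> r0 hf bf hu hw; have r2 : 0 < r / 2 by rewrite divr_gt0.
rewrite (_ : 2 * _ * _ / _ = cV * (cV * S / (r / 2))); last by field; rewrite gt_eqF.
apply: (@bounded_deriv_lip _ v (r / 2)) => // x hx.
have sub : enorm (x - v) + r / 2 <= r by rewrite [leRHS](splitr r) lerD2r ltW.
have [|A hA] := hf x; first by rewrite (lt_le_trans hx)// ler_piMr ?invf_le1 ?ler1n// ltW.
exists A => // h; rewrite mulrAC ler_pdivlMr//.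
exact: cauchy_vec r2 (hol_sub sub hf) (bnd_sub sub bf) hA.
Qed.

(** The map [w |-> f (w + z) - f w] has differential [B - A] at [v] and, by [hol_lip], size at most
    a constant times [|z|]; the Cauchy estimate for it avoids any second derivative. On the ball of
    radius [r / 4] both [w] and [w + z] remain in the half ball. *)
Lemma hol_deriv_lip f v r S z h A B : enorm z < r / 4 -> hol f v r -> bnd f v r S ->
  hasd f v A -> hasd f (v + z) B ->
  enorm (h *m (B - A)) <= 8 * cV ^+ 3 * S / r ^+ 2 * enorm z * enorm h.
Proof.
move=> hz hf bf hA hB.
have r40 : 0 < r / 4 := le_lt_trans (enorm_ge0 z) hz.
have r0 : 0 < r by move: r40; rewrite pmulr_lgt0.
have r42 : r / 4 + r / 4 = r / 2 by field.
have r42' : r / 4 <= r / 2 by rewrite -r42 lerDl ltW.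
have r2r : r / 2 <= r by rewrite ler_piMr ?(ltW r0)// invf_le1 ?ler1n.
have inz w : enorm (w - v) < r / 4 -> enorm (w + z - v) < r / 2.
  move=> hw; rewrite addrAC (le_lt_trans (enormD _ _))// -r42 ltrD//.
have := @cauchy_vec _ _ (fun w => f (w + z) - f w) v (r / 4)
  (2 * cV ^+ 2 * S / r * enorm z) (B - A) h r40.
rewrite -ler_pdivlMr// => H; apply: le_trans (H _ _ _) _.
- move=> w hw; have [|A1 hA1] := hf w.
    by apply: lt_le_trans hw _; exact: le_trans r2r.
  have [|A2 hA2] := hf (w + z); first exact: lt_le_trans (inz _ hw) r2r.
  by exists (A2 - A1); apply: hasdB => //; exact: hasd_shift.
- move=> w hw; have := hol_lip r0 hf bf (inz _ hw) (lt_le_trans hw r42').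
  by rewrite [w + z - w]addrAC subrr add0r.
- by apply: hasdB => //; exact: hasd_shift.
by rewrite le_eqVlt; apply/orP; left; apply/eqP; field; rewrite gt_eqF.
Qed.

(** Mean value theorem for [f] minus its linear part at [v]. The constant depends on [f] only
    through the bound [S], as passing to limits requires. *)
Lemma hol_quad f v r S h A : enorm h < r / 4 -> hol f v r -> bnd f v r S ->
  hasd f v A ->
  enorm (f (v + h) - f v - h *m A) <= 8 * cV ^+ 4 * S / r ^+ 2 * enorm h ^+ 2.
Proof.
move=> hh hf bf hA.
have r40 : 0 < r / 4 := le_lt_trans (enorm_ge0 h) hh.
have r0 : 0 < r by move: r40; rewrite pmulr_lgt0.
have S0 : 0 <= S by apply: le_trans (enorm_ge0 _) (bf v _); rewrite subrr enorm0.
rewrite (_ : _ - _ - _ = (f (v + h) - (v + h) *m A) - (f v - v *m A)); last first.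
  by rewrite mulmxDl; move: (v *m A) (h *m A) => x y; vring.
rewrite (_ : 8 * _ * _ / _ * _ = cV * (8 * cV ^+ 3 * S / r ^+ 2 * enorm h * enorm h)); last first.
  by field; rewrite gt_eqF.
apply: (@mean_value _ _ (fun w => f w - w *m A)) => t /andP[t0 t1].
have th : enorm (cx t 0 *: h) <= enorm h.
  by rewrite enormZ nc_re ger0_norm// ler_piMl ?enorm_ge0.
have [|B hB] := hf (v + cx t 0 *: h).
  rewrite addrC addKr (le_lt_trans th)// (lt_trans hh)// gtr_pMr//.
  by rewrite invf_lt1// ltr1n.
exists (B - A); first by apply: hasdB => //; exact: hasd_linear.
apply: le_trans (hol_deriv_lip h (le_lt_trans th hh) hf bf hA hB) _.
apply: ler_wpM2r; first exact: enorm_ge0.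
apply: ler_wpM2l => //.
by rewrite mulr_ge0 ?invr_ge0 ?sqr_ge0// !mulr_ge0// exprn_ge0// cV_ge0.
Qed.

Lemma complete_real (u : nat -> R) :
  (forall e, 0 < e -> exists N, forall n m, (N <= n)%N -> (N <= m)%N -> `|u n - u m| < e) ->
  exists l : R, u @ \oo --> l.
Proof.
move=> hu; suff : cvg (u @ \oo) by move=> /cvg_ex.
apply/cauchy_cvgP/cauchy_exP => e e0; have [N hN] := hu _ e0.
exists (u N); exists N => // n /= Nn; rewrite /ball/=; exact: hN.
Qed.

Lemma complete_enorm (u : nat -> V) :
  (forall e, 0 < e -> exists N, forall n m, (N <= n)%N -> (N <= m)%N -> enorm (u n - u m) < e) ->
  exists l : V, u @ \oo --> l.
Proof.
move=> hu.
have part (p : C -> R) i : (forall x y, p (x - y) = p x - p y) -> (forall x, `|p x| <= nc x) ->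
    exists l : R, (fun n => p (u n 0 i)) @ \oo --> l.
  move=> pB pn; apply: complete_real => e /hu[N hN]; exists N => n m Nn Nm.
  rewrite -pB; apply: le_lt_trans (pn _) _; rewrite -entryB.
  by apply: le_lt_trans (nc_le_enorm _ _) (hN _ _ Nn Nm).
have reB (x y : C) : re (x - y) = re x - re y by rewrite reD reN.
have imB (x y : C) : im (x - y) = im x - im y by rewrite imD imN.
have [a ha] := choice (fun i => part re i reB re_le_nc).
have [b hb] := choice (fun i => part im i imB im_le_nc).
exists (\row_i cx (a i) (b i)); apply/(@cvg_enormP _ _ _ \oo) => e e0.
have e1 : 0 < e / (2 * k%:R + 1) by rewrite divr_gt0// ltr_wpDl ?mulr_ge0.
have na : \forall n \near \oo, forall i, `|re (u n 0 i) - a i| < e / (2 * k%:R + 1).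
  by apply: filter_forall => i; have /cvgrPdistC_lt := ha i; exact.
have nb : \forall n \near \oo, forall i, `|im (u n 0 i) - b i| < e / (2 * k%:R + 1).
  by apply: filter_forall => i; have /cvgrPdistC_lt := hb i; exact.
near=> n; apply: (@le_lt_trans _ _ (k%:R * (2 * (e / (2 * k%:R + 1))))).
  apply: enorm_le => i; rewrite entryB mxE.
  apply: (le_trans (nc_le_re_im _)); rewrite reD reN imD imN /= mulr_natl mulr2n.
  by apply: lerD; apply: ltW; move: i; near: n.
rewrite mulrA mulrA ltr_pdivrMr; last by rewrite ltr_wpDl ?mulr_ge0.
by rewrite mulrC ltr_pM2l// [k%:R * 2]mulrC ltrDl.
Unshelve. all: by end_near. Qed.

Lemma enorm_lim_le (u : nat -> V) (l : V) b : u @ \oo --> l ->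
  (forall n, enorm (u n) <= b) -> enorm l <= b.
Proof.
move=> /(@cvg_enormP _ _ _ \oo) ul hb; apply/ler_addgt0Pr => e e0.
have [N _ hN] := ul _ e0; have := hN N (leqnn N) => /= h.
rewrite -[l](subrK (u N)) (le_trans (enormD _ _))// addrC lerD//.
by rewrite enormB ltW.
Qed.

Lemma cvg_mulmx (An : nat -> 'M[C]_k) (l : 'I_k -> V) h :
  (forall i, (fun n => delta_mx 0 i *m An n) @ \oo --> l i) ->
  (fun n => h *m An n) @ \oo --> h *m (\matrix_(i, j) l i 0 j).
Proof.
move=> hl; rewrite mulmx_sum_row.
rewrite (_ : (fun n => _) = (fun n => \sum_i h 0 i *: row i (An n))); last first.
  by apply/funext => n; rewrite mulmx_sum_row.
have cvgi i : (fun n => h 0 i *: row i (An n)) @ \oo --> h 0 i *: row i (\matrix_(i, j) l i 0 j).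
  apply: cvgZ; first exact: cvg_cst.
  rewrite (_ : row i _ = l i); last by apply/rowP => j; rewrite !mxE.
  by under eq_fun do rewrite rowE; exact: hl.
elim: (index_enum _) => [|i s IH].
  by under eq_fun do rewrite big_nil; rewrite big_nil; exact: cvg_cst.
rewrite big_cons (_ : (fun n => _) = (fun n => h 0 i *: row i (An n)) \+
  (fun n => \sum_(j <- s) h 0 j *: row j (An n))).
  exact: (cvgD (cvgi i) IH).
by apply/funext => n; rewrite big_cons.
Qed.

(** The rows of the differentials [An n] form Cauchy sequences: tested on a vector of length [t],
    they differ from increments of [fn n] by at most [K t^2], uniformly in [n], and the increments
    converge. Passing to the limit in the quadratic estimate gives the differential of [f]. *)
Lemma hol_limit_center (fn : nat -> V -> V) f v r S : 0 < r ->
  (forall n, hol (fn n) v r) -> (forall n, bnd (fn n) v r S) ->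
  (forall w, enorm (w - v) < r -> (fun n => fn n w) @ \oo --> f w) -> exists A, hasd f v A.
Proof.
move=> r0 hfn bfn cfn.
have vv : enorm (v - v) < r by rewrite subrr enorm0.
have S0 : 0 <= S by apply: le_trans (enorm_ge0 _) (bfn 0%N v vv).
have [An hAn] := choice (fun n => hfn n v vv).
pose K := 8 * cV ^+ 4 * S / r ^+ 2.
have K0 : 0 <= K.
  by rewrite mulr_ge0 ?invr_ge0 ?sqr_ge0// !mulr_ge0// exprn_ge0// cV_ge0.
have K1 : 0 < K + 1 by rewrite ltr_wpDl.
have r40 : 0 < r / 4 by rewrite divr_gt0.
have r4r : r / 4 < r by rewrite gtr_pMr// invf_lt1// ltr1n.
have quad n h : enorm h < r / 4 -> enorm (fn n (v + h) - fn n v - h *m An n) <= K * enorm h ^+ 2.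
  by move=> hh; exact: hol_quad.
have inb h : enorm h < r / 4 -> enorm (v + h - v) < r.
  by move=> hh; rewrite addrC addKr (lt_trans hh).
have crow i : exists l : V, (fun n => delta_mx 0 i *m An n) @ \oo --> l.
  apply: complete_enorm => e e0.
  (* After division by [t] the two quadratic errors add up to [2 K t <= e / 4], and the convergent
     increments add at most another [e / 4]. *)
  have [t [t0 tr te]] : exists t, [/\ 0 < t, t < r / 4 & K * t <= e / 8].
    exists (Num.min (r / 8) (e / 8 / (K + 1))); split.
    - by rewrite lt_min !divr_gt0.
    - apply: (@le_lt_trans _ _ (r / 8)); first by rewrite ge_min lexx.
      by rewrite ltr_pM2l// ltf_pV2 ?posrE// ltr_nat.
    - apply: (@le_trans _ _ (K * (e / 8 / (K + 1)))).
        by apply: ler_wpM2l => //; rewrite ge_min lexx orbT.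
      rewrite mulrA ler_pdivrMr// mulrC ler_wpM2l ?lerDl//.
      by rewrite divr_ge0// ltW.
  pose h : V := cx t 0 *: delta_mx 0 i.
  have nh : enorm h = t by rewrite enormZ enorm_delta mulr1 nc_re gtr0_norm.
  have hr : enorm h < r / 4 by rewrite nh.
  have et : 0 < e * t / 8 by rewrite !mulr_gt0// invr_gt0.
  have cd : (fun n => fn n (v + h) - fn n v) @ \oo --> f (v + h) - f v.
    exact: (cvgB (cfn _ (inb _ hr)) (cfn _ vv)).
  have [N _ hN] := (@cvg_enormP _ _ _ \oo _ _ _).1 cd _ et.
  exists N => n m /hN /= /ltW n1 /hN /= /ltW m1.
  have q1 := quad n h hr; have q2 := quad m h hr; move: q1 q2 n1 m1.
  rewrite nh; set d := f (v + h) - f v; set dn := fn n _ - _; set dm := fn m _ - _.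
  move=> q1 q2 n1 m1.
  have E : enorm (h *m An n - h *m An m) = t * enorm (delta_mx 0 i *m An n - delta_mx 0 i *m An m).
    by rewrite -!scalemxAl -scalerBr enormZ nc_re gtr0_norm.
  rewrite -(ltr_pM2l t0) -E.
  have split5 (a b x y z : V) : a - b = (x - z) - (x - a) + ((y - b) - (y - z)) by vring.
  rewrite (split5 _ _ dn dm d).
  apply: (@le_lt_trans _ _ (e * t / 8 + K * t ^+ 2 + (K * t ^+ 2 + e * t / 8))).
    have tri (a b : V) (p q : R) : enorm a <= p -> enorm b <= q -> enorm (a - b) <= p + q.
      by move=> ha hb; rewrite (le_trans (enormD _ _))// enormN lerD.
    by apply: (le_trans (enormD _ _)); exact: (lerD (tri _ _ _ _ n1 q1) (tri _ _ _ _ q2 m1)).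
  have : K * t * t <= e / 8 * t by rewrite ler_wpM2r// ltW.
  have : 0 < e * t by rewrite mulr_gt0.
  by rewrite expr2 mulrA; clear; lra.
have [l hl] := choice crow.
exists (\matrix_(i, j) l i 0 j) => e e0.
exists (Num.min (r / 4) (e / (K + 1))); first by rewrite lt_min r40 divr_gt0.
move=> h; rewrite lt_min [_ < e / _]ltr_pdivlMr// => /andP[hr he].
have c3 := cvgB (cvgB (cfn _ (inb _ hr)) (cfn _ vv)) (@cvg_mulmx An l h hl).
apply: (le_trans (enorm_lim_le (c3 _ _) (fun n => quad n h hr))).
rewrite expr2 mulrA; apply: ler_wpM2r; first exact: enorm_ge0.
by apply: ltW; apply: le_lt_trans he; rewrite mulrDr mulr1 mulrC lerDl enorm_ge0.
Qed.

Lemma hol_limit (fn : nat -> V -> V) f v r S :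
  (forall n, hol (fn n) v r) -> (forall n, bnd (fn n) v r S) ->
  (forall w, enorm (w - v) < r -> (fun n => fn n w) @ \oo --> f w) -> hol f v r.
Proof.
move=> hfn bfn cfn w hw; have sub : enorm (w - v) + (r - enorm (w - v)) <= r.
  by rewrite addrC subrK.
apply: (@hol_limit_center fn f w (r - enorm (w - v)) S); rewrite ?subr_gt0//.
- by move=> n; exact: hol_sub sub (hfn n).
- by move=> n; exact: bnd_sub sub (bfn n).
- by move=> w' hw'; apply: cfn; exact: sub_ball sub hw'.
Qed.

Lemma pderiv_hasd f v i A : hasd f v A -> pderiv i f v = delta_mx 0 i *m A.
Proof. by move=> /hasd_diff[df dfE]; rewrite /pderiv deriveE. Qed.

(** A partial derivative is the pointwise limit of difference quotients, which are holomorphic and,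
    by [hol_lip], uniformly bounded. The radius drops to [r / 4] so that the shifted points stay in
    the half ball. *)
Lemma hol_pderiv f v r S i : 0 < r -> hol f v r -> bnd f v r S -> hol (pderiv i f) v (r / 4).
Proof.
move=> r0 hf bf.
have r40 : 0 < r / 4 by rewrite divr_gt0.
have r42 : r / 4 + r / 4 = r / 2 by field.
have r42' : r / 4 <= r / 2 by rewrite -r42 lerDl ltW.
have r2r : r / 2 <= r by rewrite ler_piMr ?(ltW r0)// invf_le1 ?ler1n.
pose t n := r / 4 / n.+1%:R.
have t0 n : 0 < t n by rewrite divr_gt0.
have tr n : t n <= r / 4 by rewrite /t ler_pdivrMr// ler_peMr ?ler1n// ltW.
pose h n : V := cx (t n) 0 *: delta_mx 0 i.
have nh n : enorm (h n) = t n by rewrite enormZ enorm_delta mulr1 nc_re gtr0_norm.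
have inh n w : enorm (w - v) < r / 4 -> enorm (w + h n - v) < r / 2.
  move=> hw; rewrite addrAC (le_lt_trans (enormD _ _))// nh -r42 ltr_leD//.
have tC n : cx (t n) 0 != 0 :> C.
  by apply/eqP => /(congr1 nc); rewrite nc_re nc0 gtr0_norm// => /eqP; rewrite gt_eqF.
have nct n : nc (cx (t n) 0)^-1 = (t n)^-1 by rewrite ncV nc_re gtr0_norm.
apply: (@hol_limit (fun n w => (cx (t n) 0)^-1 *: (f (w + h n) - f w)) _ _ _
  (2 * cV ^+ 2 * S / r)).
- move=> n w hw; have [|A1 hA1] := hf w.
    by apply: lt_le_trans hw _; exact: le_trans r2r.
  have [|A2 hA2] := hf (w + h n); first exact: lt_le_trans (inh _ _ hw) r2r.
  by exists ((cx (t n) 0)^-1 *: (A2 - A1)); apply: hasdZ; apply: hasdB => //; exact: hasd_shift.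
- move=> n w hw; rewrite enormZ nct mulrC ler_pdivrMr//.
  have := hol_lip r0 hf bf (inh n _ hw) (lt_le_trans hw r42').
  by rewrite [w + h n - w]addrAC subrr add0r nh.
- move=> w hw; have [|A hA] := hf w.
    by apply: lt_le_trans hw _; exact: le_trans r2r.
  rewrite (pderiv_hasd i hA); apply/(@cvg_enormP _ _ _ \oo) => e e0.
  have e2 : 0 < e / 2 by rewrite divr_gt0.
  have [d d0 hd] := hA _ e2.
  have p : 0 < d / (r / 4) by rewrite divr_gt0.
  near=> n; have td : t n < d.
    rewrite /t mulrC -ltr_pdivlMr//; near: n.
    exact: (near_infty_natSinv_lt (PosNum p)).
  have := hd (h n); rewrite nh => /(_ td) hh.
  rewrite (_ : _ - _ = (cx (t n) 0)^-1 *: (f (w + h n) - f w - h n *m A)); last first.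
    by rewrite -scalemxAl [RHS]scalerBr scalerA mulVf// scale1r.
  rewrite enormZ nct mulrC; apply: (@le_lt_trans _ _ (e / 2)); first by rewrite ler_pdivrMr.
  by rewrite ltr_pdivrMr// ltr_pMr// ltr1n.
Unshelve. all: by end_near. Qed.

End CauchyConsequences.

(** * Taylor coefficients and order of vanishing *)

Section Taylor.
Context {R : realType} {k : nat}.
Local Notation C := (Cplx R).
Local Notation V := 'V[R]_k.
Local Notation cV := (@cV R k).
Implicit Types (u v w h : V) (f g : V -> V) (A B : 'M[C]_k) (e r S t : R) (a : 'I_k -> nat).

Lemma bnd_pderiv f v r S i : 0 < r -> hol f v r -> bnd f v r S ->
  bnd (pderiv i f) v (r / 4) (2 * cV * S / r).
Proof.
move=> r0 hf bf w hw; have r2 : 0 < r / 2 by rewrite divr_gt0.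
have hw2 : enorm (w - v) < r / 2.
  by apply: lt_le_trans hw _; rewrite ler_pM2l// lef_pV2 ?posrE// ler_nat.
have sub : enorm (w - v) + r / 2 <= r by rewrite [leRHS](splitr r) lerD2r ltW.
have [|A hA] := hf w.
  by apply: lt_le_trans hw2 _; rewrite ler_piMr ?(ltW r0)// invf_le1 ?ler1n.
rewrite (pderiv_hasd i hA).
have := cauchy_vec (delta_mx 0 i) r2 (hol_sub sub hf) (bnd_sub sub bf) hA.
rewrite enorm_delta mulr1 -ler_pdivlMr// => /le_trans; apply.
by rewrite le_eqVlt; apply/orP; left; apply/eqP; field; rewrite gt_eqF.
Qed.

Lemma enorm_mono u w : (forall i, nc (u 0 i) <= nc (w 0 i)) -> enorm u <= enorm w.
Proof.
move=> h; rewrite enorm_lepP ?enorm_ge0// sqr_enorm; apply: ler_sum => i _.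
by rewrite ler_pXn2r ?nnegrE ?nc_ge0.
Qed.

(** [mderiv] differentiates with respect to the last variable first. A derivative taken before all
    others is thus absorbed without commuting partial derivatives, provided no variable after [i0]
    occurs in [a]. *)
Lemma mderiv_pderiv a (i0 : 'I_k) f : (forall i : 'I_k, (i0 < i)%N -> a i = 0%N) ->
  mderiv a (pderiv i0 f) = mderiv (fun i => (a i + (i == i0))%N) f.
Proof.
move=> ha; have : sorted ltn (map val (enum 'I_k)) by rewrite val_enum_ord iota_ltn_sorted.
have : i0 \in enum 'I_k by rewrite mem_enum.
rewrite /mderiv; elim: (enum 'I_k) => //= i s IH; rewrite inE => /orP[/eqP <-|i0s] srt.
  rewrite eqxx addn1 iterSr; have gt j : j \in s -> (i0 < j)%N.
    move=> js; have := order_path_min ltn_trans srt => /allP; apply.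
    exact: map_f.
  have tl b g : (forall j, j \in s -> b j = 0%N) ->
      foldr (fun i g => iter (b i) (pderiv i) g) g s = g.
    move=> hb; elim: s hb {IH srt gt} => //= j s IH hb.
    rewrite hb ?mem_head//= IH// => j' j's; apply: hb; by rewrite inE j's orbT.
  by rewrite !tl// => j /gt ij; rewrite ha// add0n; case: eqP ij => // ->; rewrite ltnn.
rewrite IH ?(path_sorted srt)//; congr (iter _ _ _).
have : (i < i0)%N by have := order_path_min ltn_trans srt => /allP; apply; exact: map_f.
by case: eqP => [->|_ _]; rewrite ?ltnn// addn0.
Qed.

Lemma mderiv0 f : mderiv (fun=> 0%N) f = f.
Proof. by rewrite /mderiv; elim: (enum _). Qed.

(** Double induction, on [q] and on the number [l] of coordinates allowed to be nonzero. Removing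
    the last allowed coordinate leaves a point covered by induction on [l]; the increment in that
    direction is governed by the corresponding partial derivative, which vanishes to order [q].
    Taking the last coordinate each time is what makes [mderiv_pderiv] applicable. Each derivative
    costs a factor 4 in the radius, whence [r / 4 ^+ q]. *)
Lemma vanishing_growth_partial (q l : nat) : (l <= k)%N -> exists2 c : R, 0 <= c &
  forall f r S, 0 < r -> hol f 0 r -> bnd f 0 r S ->
  (forall a, (forall i : 'I_k, (l <= i)%N -> a i = 0%N) -> (\sum_i a i < q)%N ->
     mderiv a f 0 = 0) ->
  forall v, (forall i : 'I_k, (l <= i)%N -> v 0 i = 0) -> enorm v < r / 4 ^+ q ->
    enorm (f v) <= c * S * (enorm v / r) ^+ q.
Proof.
elim: q l => [|q IHq] l.
  move=> _; exists 1 => // f r S r0 hf bf _ v _; rewrite expr0 divr1 mulr1 mul1r => hv.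
  by apply: bf; rewrite subr0.
elim: l => [_|l IHl lk].
  exists 0 => // f r S r0 hf bf ha v hv _.
  have -> : v = 0 by apply/rowP => i; rewrite hv// mxE.
  have -> : f 0 = 0.
    by rewrite -(mderiv0 f); apply: ha => //; rewrite big1.
  by rewrite enorm0 !mul0r.
have [c c0 hc] := IHl (ltnW lk); have [c' c'0 hc'] := IHq l.+1 lk.
exists (c + cV * (c' * (2 * cV) * 4 ^+ q)).
  by rewrite addr_ge0// !mulr_ge0// ?cV_ge0// exprn_ge0.
move=> f r S r0 hf bf ha v hv hvr.
have S0 : 0 <= S by apply: le_trans (enorm_ge0 _) (bf 0 _); rewrite subrr enorm0.
pose i0 := Ordinal lk; pose v' := v - v 0 i0 *: delta_mx 0 i0.
have vE i : v' 0 i = if i == i0 then 0 else v 0 i.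
  rewrite entryB entryZ mxE eqxx /=; case: eqP => [->|_]; first by rewrite mulr1 subrr.
  by rewrite mulr0 subr0.
have v'v : enorm v' <= enorm v.
  by apply: enorm_mono => i; rewrite vE; case: eqP => // _; rewrite nc0 nc_ge0.
have r40 : 0 < r / 4 by rewrite divr_gt0.
have q4 n : r / 4 ^+ n <= r.
  by rewrite ler_piMr ?(ltW r0)// invf_le1 ?exprn_gt0// exprn_ege1// ler1n.
have fv' : enorm (f v') <= c * S * (enorm v / r) ^+ q.+1.
  apply: (@le_trans _ _ (c * S * (enorm v' / r) ^+ q.+1)).
    apply: hc => //.
    - by move=> a hal; apply: ha => i li; apply: hal; exact: ltnW.
    - move=> i li; rewrite vE; case: eqP => // /eqP ii0; apply: hv.
      by rewrite ltn_neqAle li andbT eq_sym.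
    - exact: le_lt_trans v'v hvr.
  apply: ler_wpM2l; first by rewrite mulr_ge0.
  rewrite ler_pXn2r ?nnegrE ?divr_ge0 ?enorm_ge0 ?(ltW r0)//.
  by rewrite ler_pM2r ?invr_gt0.
have q4' : r / 4 / 4 ^+ q = r / 4 ^+ q.+1.
  by rewrite exprS invfM mulrA.
have hg : hol (pderiv i0 f) 0 (r / 4) by apply: hol_pderiv bf.
have bg := bnd_pderiv i0 r0 hf bf.
have hag a : (forall i : 'I_k, (l < i)%N -> a i = 0%N) -> (\sum_i a i < q)%N ->
    mderiv a (pderiv i0 f) 0 = 0.
  move=> hal aq; rewrite mderiv_pderiv//; apply: ha.
    by move=> i li; rewrite hal// add0n; case: eqP li => // ->; rewrite ltnn.
  have s1 : (\sum_(i < k) (i == i0) = 1)%N.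
    by rewrite (bigD1 i0)//= eqxx big1// => i /negbTE ->.
  by rewrite big_split/= s1 addn1.
have step : enorm (f (v' + v 0 i0 *: delta_mx 0 i0) - f v') <=
    cV * (c' * (2 * cV) * 4 ^+ q * S * (enorm v / r) ^+ q.+1).
  apply: mean_value => t /andP[t0 t1]; set z := v' + _.
  have zE i : nc (z 0 i) <= nc (v 0 i).
    rewrite /z mxE vE entryZ entryZ mxE eqxx /=; case: eqP => [->|_].
      rewrite mulr1 add0r ncM nc_re ger0_norm// ler_piMl ?nc_ge0//.
    by rewrite !mulr0 addr0.
  have zv : enorm z <= enorm v := enorm_mono zE.
  have [|A hA] := hf z.
    by rewrite subr0 (le_lt_trans zv)// (lt_le_trans hvr).
  exists A => //; rewrite -scalemxAl enormZ -(pderiv_hasd i0 hA).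
  have := hc' _ _ _ r40 hg bg hag z _ _.
  rewrite q4' => /(_ _ (le_lt_trans zv hvr)) H.
  have {}H : enorm (pderiv i0 f z) <= c' * (2 * cV * S / r) * (enorm z / (r / 4)) ^+ q.
    apply: H => i li; apply: nc_eq0; apply/le_anti; rewrite nc_ge0 andbT.
    by apply: le_trans (zE i) _; rewrite hv// nc0.
  apply: le_trans (ler_pM (nc_ge0 _) (enorm_ge0 _) (nc_le_enorm v i0) H) _.
  apply: (@le_trans _ _ (enorm v * (c' * (2 * cV * S / r) * (enorm v / (r / 4)) ^+ q))).
    apply: ler_wpM2l; first exact: enorm_ge0.
    apply: ler_wpM2l; first by rewrite !mulr_ge0// ?cV_ge0// invr_ge0 ltW.
    apply: lerXn2r; rewrite ?nnegrE ?divr_ge0 ?enorm_ge0 ?(ltW r0)//.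
    by rewrite ler_pM2r ?invr_gt0.
  rewrite le_eqVlt; apply/orP; left; apply/eqP.
  have -> : enorm v / (r / 4) = 4 * (enorm v / r) by field; rewrite gt_eqF.
  by rewrite exprMn exprS; field; rewrite gt_eqF.
move: step; rewrite {1}/v' subrK => step; rewrite -[f v](subrK (f v')).
apply: (le_trans (enormD _ _)).
apply: (le_trans (lerD step fv')).
by rewrite le_eqVlt; apply/orP; left; apply/eqP; ring.
Qed.

Lemma vanishing_growth (q : nat) : exists2 c : R, 0 <= c &
  forall f r S, 0 < r -> hol f 0 r -> bnd f 0 r S ->
  (forall a, (\sum_i a i < q)%N -> mderiv a f 0 = 0) ->
  forall v, enorm v < r / 4 ^+ q -> enorm (f v) <= c * S * (enorm v / r) ^+ q.
Proof.
have [c c0 hc] := vanishing_growth_partial q (leqnn k); exists c => //.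
move=> f r S r0 hf bf ha v; apply: hc => //.
  by move=> a _; exact: ha.
by move=> i; rewrite leqNgt ltn_ord.
Qed.

Definition hol0 f := exists r S, [/\ 0 < r, hol f 0 r & bnd f 0 r S].

Lemma hol0_pderiv i f : hol0 f -> hol0 (pderiv i f).
Proof.
move=> [r [S [r0 hf bf]]]; exists (r / 4), (2 * cV * S / r); split.
- by rewrite divr_gt0.
- exact: hol_pderiv bf.
- exact: bnd_pderiv.
Qed.

Lemma mderiv_ind (P : nat -> (V -> V) -> Prop) a f :
  (forall n i g, P n g -> P n.+1 (pderiv i g)) -> P 0%N f ->
  P (\sum_i a i)%N (mderiv a f).
Proof.
move=> step P0; rewrite /mderiv -big_enum/=; elim: (enum _) => [|i s IH] /=.
  by rewrite big_nil.
rewrite big_cons; elim: (a i) => [|m IHm] //=; rewrite addSn; exact: step.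
Qed.

Definition growth n f := hol0 f /\ exists c r, [/\ 0 <= c, 0 < r &
  forall v, enorm v < r -> enorm (f v) <= c * enorm v ^+ n].

(** Cauchy estimate on the ball of radius [|v|] around [v], where [|f|] is at most a constant times
    [(2 |v|)^n]. At [v = 0] this ball is empty, and balls of radius [d] tending to [0] are used
    instead. *)
Lemma growth_pderiv n i f : growth n f -> growth n.-1 (pderiv i f).
Proof.
move=> [hf [c [r [c0 r0 hc]]]]; split; first exact: hol0_pderiv.
case: n hc => [|n] hc /=.
  have [r1 [S [r10 _ b1]]] := hol0_pderiv i hf.
  have S0 : 0 <= S by apply: le_trans (enorm_ge0 _) (b1 0 _); rewrite subrr enorm0.
  by exists S, r1; split=> // v hv; rewrite expr0 mulr1; apply: b1; rewrite subr0.
have [r1 [S [r10 h1 b1]]] := hf.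
(* Halving leaves room for the ball around [v]; the cap at [1] gives [d ^+ n.+1 <= d] at the end. *)
pose r2 := Num.min (Num.min r r1 / 2) 1.
have r20 : 0 < r2 by rewrite lt_min ltr01 andbT divr_gt0// lt_min r0.
have key v d A : enorm v + d <= Num.min r r1 -> 0 < d -> hasd f v A ->
    enorm (delta_mx 0 i *m A) <= cV * c * (enorm v + d) ^+ n.+1 / d.
  rewrite le_min => /andP[vr vr1] d0 hA; rewrite ler_pdivlMr// -mulrA -[leRHS]mulr1.
  rewrite -(@enorm_delta R k i); apply: (@cauchy_vec _ _ f v d) => //.
    by apply: (hol_sub _ h1); rewrite subr0.
  move=> w hw; have wv : enorm w < enorm v + d.
    by rewrite -[w](subrK v) (le_lt_trans (enormD _ _))// addrC ltrD2l.
  apply: (le_trans (hc w (lt_le_trans wv vr))); apply: ler_wpM2l => //.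
  by rewrite ler_pXn2r ?nnegrE ?addr_ge0 ?enorm_ge0// ?ltW// ltW.
exists (cV * c * 2 ^+ n.+1), r2; split=> //.
  by rewrite !mulr_ge0// ?cV_ge0// exprn_ge0.
move=> v; rewrite lt_min => /andP[hv v1].
have hv2 : enorm v + enorm v <= Num.min r r1.
  by rewrite -mulr2n -mulr_natr -ler_pdivlMr// ltW.
have [|A hA] := h1 v.
  rewrite subr0; have := lt_le_trans hv (_ : _ <= Num.min r r1).
  rewrite lt_min => H; have /H/andP[] // : Num.min r r1 / 2 <= Num.min r r1.
  by rewrite ler_piMr ?invf_le1 ?ler1n// le_min !ltW.
rewrite (pderiv_hasd i hA); have [v0|v0] := eqVneq v 0; last first.
  have := key v (enorm v) A hv2 (enorm_gt0 v0) hA; move/le_trans; apply.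
  rewrite (_ : enorm v + enorm v = 2 * enorm v); last by ring.
  rewrite exprMn [enorm v ^+ n.+1]exprS.
  rewrite le_eqVlt; apply/orP; left; apply/eqP; field.
  by rewrite gt_eqF// enorm_gt0.
have key0 d : 0 < d -> d <= r2 -> enorm (delta_mx 0 i *m A) <= cV * c * d ^+ n.
  move=> d0 dr; have := key v d A; rewrite v0 enorm0 add0r.
  have dr' : d <= Num.min r r1.
    apply: (le_trans dr); apply: (@le_trans _ _ (Num.min r r1 / 2)).
      by rewrite ge_min lexx.
    by rewrite ler_piMr ?invf_le1 ?ler1n// le_min !ltW.
  rewrite -v0 => /(_ dr' d0 hA) /le_trans; apply.
  by rewrite exprSr mulrA mulfK// gt_eqF.
have X0 : 0 <= cV * c by rewrite mulr_ge0// cV_ge0.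
case: n key0 {key hc} => [|n] key0.
  have := key0 r2 r20 (lexx _); rewrite !expr0 !mulr1 => /le_trans; apply.
  by rewrite expr1 ler_peMr// ler1n.
rewrite v0 enorm0 expr0n mulr0; apply/ler_addgt0Pr => e e0; rewrite add0r.
have X1 : 0 < cV * c + 1 by rewrite ltr_wpDl.
pose d := Num.min r2 (e / (cV * c + 1)).
have d0 : 0 < d by rewrite lt_min r20 divr_gt0.
have d1 : d <= 1 by rewrite ge_min; apply/orP; left; rewrite ge_min lexx orbT.
have dr2 : d <= r2 by rewrite ge_min lexx.
apply: (le_trans (key0 d d0 dr2)); apply: (@le_trans _ _ ((cV * c + 1) * d)).
  apply: ler_pM; rewrite ?exprn_ge0 ?(ltW d0) ?lerDl//.
  by rewrite exprS ler_piMr ?(ltW d0)// exprn_ile1// ltW.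
by rewrite mulrC -ler_pdivlMr// ge_min lexx orbT.
Qed.

(** Converse of [vanishing_growth]: each derivative lowers the order of growth by one, and a
    positive order forces the value [0] at the origin. *)
Lemma growth_mderiv n a f : growth n f -> (\sum_i a i < n)%N -> mderiv a f 0 = 0.
Proof.
move=> hf an.
have [_ [c [r [c0 r0 hc]]]] : growth (n - \sum_i a i)%N (mderiv a f).
  apply: (@mderiv_ind (fun m g => growth (n - m)%N g)); last by rewrite subn0.
  by move=> m i g /(growth_pderiv i); rewrite subnS.
apply: enorm_eq0; apply/le_anti; rewrite enorm_ge0 andbT.
have := hc 0; rewrite enorm0 => /(_ r0).
by rewrite expr0n subn_eq0 leqNgt an mulr0.
Qed.

Lemma hasd_eq f g v r A : 0 < r -> (forall w, enorm (w - v) < r -> f w = g w) ->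
  hasd f v A -> hasd g v A.
Proof.
move=> r0 fg hf e e0; have [d d0 hd] := hf e e0.
exists (Num.min d r); first by rewrite lt_min d0.
move=> h; rewrite lt_min => /andP[/hd hh hr].
by rewrite -!fg ?subrr ?enorm0// addrC addKr.
Qed.

(** The functions are holomorphic near [0] only, so the identity between iterated derivatives is
    carried along on some ball that may shrink at each derivative; this is what [rel] records. *)
Lemma mderivB a f g : hol0 f -> hol0 g ->
  mderiv a (fun w => f w - g w) 0 = mderiv a f 0 - mderiv a g 0.
Proof.
move=> hf hg.
pose rel f g (p : V -> V) := [/\ hol0 f, hol0 g & exists2 r : R, 0 < r &
  forall w : V, enorm w < r -> p w = f w - g w].
have relp i f1 g1 (h1 : V -> V) : rel f1 g1 h1 -> rel (pderiv i f1) (pderiv i g1) (pderiv i h1).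
  move=> [H1 H2 [r r0 hr]]; split; try exact: hol0_pderiv.
  have [r1 [_ [r10 k1 _]]] := H1; have [r2 [_ [r20 k2 _]]] := H2.
  exists (Num.min r (Num.min r1 r2)); first by rewrite !lt_min r0 r10.
  move=> w; rewrite !lt_min => /andP[wr /andP[w1 w2]].
  have [|A hA] := k1 w; first by rewrite subr0.
  have [|B hB] := k2 w; first by rewrite subr0.
  rewrite (pderiv_hasd i hA) (pderiv_hasd i hB) -mulmxBr; apply: pderiv_hasd.
  apply: (@hasd_eq (fun w => f1 w - g1 w) _ w (r - enorm w)); rewrite ?subr_gt0//.
    move=> w' hw'; rewrite hr//.
    by rewrite -[w'](subrK w) (le_lt_trans (enormD _ _))// -ltrBrDr.
  exact: hasdB.
have : rel (mderiv a f) (mderiv a g) (mderiv a (fun w => f w - g w)).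
  rewrite /mderiv; elim: (enum _) => [|i s IH] /=.
    by split=> //; exists 1.
  by elim: (a i) => [|m IHm] //=; exact: relp.
by move=> [_ _ [r r0 hr]]; apply: hr; rewrite enorm0.
Qed.

Lemma taylor_coef_mderiv a f g :
  taylor_coef a f = taylor_coef a g <-> mderiv a f 0 = mderiv a g 0.
Proof.
rewrite /taylor_coef; split=> [|->//]; apply: scalerI.
rewrite invr_eq0 pnatr_eq0 -lt0n prodn_gt0// => i; exact: fact_gt0.
Qed.

End Taylor.

(** * Local inverses *)

Section InverseFunction.
Context {R : realType} {k : nat}.
Local Notation C := (Cplx R).
Local Notation V := 'V[R]_k.
Implicit Types (u v w h : V) (f g : V -> V) (A B D : 'M[C]_k) (c e r t : R).

Lemma expr_lt L e : 0 <= L -> L < 1 -> 0 < e -> exists N, forall n, (N <= n)%N -> L ^+ n < e.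
Proof.
move=> L0 L1 e0; have L1' : `|L| < 1 by rewrite ger0_norm.
have /cvgrPdistC_lt/(_ e e0)[N _ hN] := cvg_expr L1'.
exists N => n Nn; have := hN n Nn; rewrite /= subr0; apply: le_lt_trans.
exact: ler_norm.
Qed.

Lemma geometric_dist (u : nat -> V) c L : 0 <= c -> 0 <= L -> L < 1 ->
  (forall n, enorm (u n.+1 - u n) <= c * L ^+ n) ->
  forall n j, enorm (u (n + j)%N - u n) <= c * L ^+ n / (1 - L).
Proof.
move=> c0 L0 L1 hu n j; have L10 : 0 < 1 - L by rewrite subr_gt0.
have : enorm (u (n + j)%N - u n) <= c * L ^+ n * (1 - L ^+ j) / (1 - L).
  elim: j => [|j IH]; first by rewrite addn0 subrr enorm0 expr0 subrr mulr0 mul0r.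
  rewrite addnS; apply: (le_trans (enormD3 _ (u (n + j)%N) _)).
  apply: (le_trans (lerD (hu _) IH)).
  rewrite le_eqVlt; apply/orP; left; apply/eqP; rewrite exprD exprS; field.
  by rewrite gt_eqF.
move/le_trans; apply; rewrite ler_pM2r ?invr_gt0// ler_piMr ?gerBl ?exprn_ge0//.
by rewrite mulr_ge0 ?exprn_ge0.
Qed.

Lemma geometric_cvg (u : nat -> V) c L : 0 <= c -> 0 <= L -> L < 1 ->
  (forall n, enorm (u n.+1 - u n) <= c * L ^+ n) ->
  exists2 l : V, u @ \oo --> l & forall n, enorm (l - u n) <= c * L ^+ n / (1 - L).
Proof.
move=> c0 L0 L1 hu; have L10 : 0 < 1 - L by rewrite subr_gt0.
have hd := geometric_dist c0 L0 L1 hu.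
have [l hl] : exists l : V, u @ \oo --> l.
  apply: complete_enorm => e e0.
  have c1 : 0 < 2 * (c + 1) by rewrite mulr_gt0// ltr_wpDl.
  have [N hN] := expr_lt L0 L1 (divr_gt0 (mulr_gt0 e0 L10) c1).
  have half n : (N <= n)%N -> enorm (u n - u N) < e / 2.
    move=> Nn; rewrite -(subnKC Nn); apply: (le_lt_trans (hd N (n - N)%N)).
    rewrite ltr_pdivrMr// (@le_lt_trans _ _ ((c + 1) * L ^+ N))//.
      by apply: ler_wpM2r; rewrite ?exprn_ge0// lerDl.
    have := hN N (leqnn _); rewrite ltr_pdivlMr// => h.
    by move: h; clear; lra.
  exists N => n m /half hn /half hm; apply: (le_lt_trans (enormD3 _ (u N) _)).
  by rewrite [enorm (u N - _)]enormB [e]splitr ltrD.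
exists l => // n; apply/ler_addgt0Pl => e e0.
have [N _ hN] := (@cvg_enormP _ _ _ \oo _ _ _).1 hl e e0.
apply: (le_trans (enormD3 _ (u (n + N)%N) _)); rewrite enormB; apply: lerD; last exact: hd.
by apply: ltW; exact: hN (leq_addl n N).
Qed.

Lemma enorm_split u v : enorm u <= enorm (u - v) + enorm v.
Proof. by rewrite -{1}[u](subrK v) enormD. Qed.

Lemma lower_bound_unitmx D c : 0 < c -> (forall h, c * enorm h <= enorm (h *m D)) ->
  D \in unitmx /\ forall h, enorm (h *m invmx D) <= enorm h / c.
Proof.
move=> c0 hD; have uD : D \in unitmx.
  rewrite -row_free_unit; apply: inj_row_free => v vD.
  apply: enorm_eq0; apply/le_anti; rewrite enorm_ge0 andbT.
  by have := hD v; rewrite vD enorm0 pmulr_rle0.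
split=> // h; have := hD (h *m invmx D); rewrite mulmxKV//.
by rewrite ler_pdivlMr// mulrC.
Qed.

(** By homogeneity it is enough to test the differential on [t h] with [t] small, where the error is
    at most [e t]. *)
Lemma hasd_lower f v D c r : 0 < r -> hasd f v D ->
  (forall h, enorm h < r -> c * enorm h <= enorm (f (v + h) - f v)) ->
  forall h, c * enorm h <= enorm (h *m D).
Proof.
move=> r0 hf hc h; have [->|h0] := eqVneq h 0; first by rewrite enorm0 mulr0 enorm_ge0.
have nh := enorm_gt0 h0.
rewrite -subr_ge0 -oppr_le0 opprB; apply/ler_addgt0Pl => e e0; rewrite addr0.
have [d d0 hd] := hf _ (divr_gt0 e0 nh).
pose m := Num.min d r; have m0 : 0 < m by rewrite lt_min d0.
pose t := m / (2 * enorm h).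
have t0 : 0 < t by rewrite divr_gt0// mulr_gt0.
have nth : enorm (cx t 0 *: h) = t * enorm h by rewrite enormZ nc_re gtr0_norm.
have tm : t * enorm h < m.
  rewrite /t (_ : _ * _ = m / 2); last by field; rewrite gt_eqF.
  by rewrite gtr_pMr// invf_lt1// ltr1n.
have [td tr] : t * enorm h < d /\ t * enorm h < r.
  by move: tm; rewrite lt_min => /andP[].
have := hd (cx t 0 *: h); have := hc (cx t 0 *: h); rewrite nth -scalemxAl => /(_ tr) h1 /(_ td) h2.
have h3 := le_trans h1 (enorm_split _ (cx t 0 *: (h *m D))); move: h3.
rewrite [enorm (_ *: (h *m D))]enormZ nc_re gtr0_norm// => h3.
have : t * (c * enorm h) <= t * (e + enorm (h *m D)).
  rewrite mulrDr mulrCA; apply: (le_trans h3); rewrite lerD2r (le_trans h2)//.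
  by rewrite mulrCA mulfVK// gt_eqF.
by rewrite ler_pM2l// lerBlDr.
Qed.

(** * Quantitative inversion of a Lipschitz-small perturbation of a linear map *)

Section Perturbation.
Variables (f : V -> V) (A : 'M[C]_k) (r m eta : R).
Hypotheses (r0 : 0 < r) (eta0 : 0 <= eta) (etam : eta < m) (f0 : f 0 = 0)
  (hA : forall h, m * enorm h <= enorm (h *m A))
  (hlip : forall u w, enorm u < r -> enorm w < r ->
     enorm ((f u - u *m A) - (f w - w *m A)) <= eta * enorm (u - w)).

Lemma perturbation_lower u w : enorm u < r -> enorm w < r ->
  (m - eta) * enorm (u - w) <= enorm (f u - f w).
Proof.
move=> hu hw; have := hlip hu hw; have := hA (u - w).
set x := f u - f w; have -> : f u - u *m A - (f w - w *m A) = x - (u - w) *m A.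
  by rewrite mulmxBl; move: (u *m A) (w *m A) => a b; rewrite /x; vring.
move=> h1 h2; have := enorm_split ((u - w) *m A) x; rewrite enormB.
by move: h1 h2; rewrite mulrBl; lra.
Qed.

(** Solving [f v = w] amounts to finding a fixed point of [v |-> (w - (f v - v A)) A^-1], which is
    [eta / m]-Lipschitz and preserves the closed ball of radius [|w| / (m - eta)]. *)
Lemma perturbation_onto w : enorm w < (m - eta) * r -> exists2 v, enorm v < r & f v = w.
Proof.
move=> hw; have m0 : 0 < m := le_lt_trans eta0 etam.
have me0 : 0 < m - eta by rewrite subr_gt0.
have [uA hB] := lower_bound_unitmx m0 hA; set B := invmx A in hB.
pose rho := enorm w / (m - eta).
have rho_r : rho < r by rewrite ltr_pdivrMr// mulrC.
have rho0 : 0 <= rho by rewrite divr_ge0 ?enorm_ge0// ltW.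
pose phi v := f v - v *m A.
pose step v := (w - phi v) *m B.
have phi0 : phi 0 = 0 by rewrite /phi f0 mul0mx subrr.
have stepP v : enorm v <= rho -> enorm (step v) <= rho.
  move=> hv; apply: (le_trans (hB _)); rewrite ler_pdivrMr//.
  apply: (le_trans (enormD _ _)); rewrite enormN.
  have z0 : enorm (0 : V) < r by rewrite enorm0.
  have := hlip (le_lt_trans hv rho_r) z0; rewrite -/(phi v) -/(phi 0) phi0 !subr0 => hp.
  have hp' := le_trans hp (ler_wpM2l eta0 hv).
  apply: (le_trans (lerD (lexx _) hp')).
  by rewrite /rho le_eqVlt; apply/orP; left; apply/eqP; field; rewrite gt_eqF.
have stepL u v : enorm u <= rho -> enorm v <= rho ->
    enorm (step u - step v) <= eta / m * enorm (u - v).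
  move=> hu hv; rewrite -mulmxBl; apply: (le_trans (hB _)).
  rewrite ler_pdivrMr// mulrAC mulfVK ?gt_eqF//.
  have -> : w - phi u - (w - phi v) = phi v - phi u by move: (phi u) (phi v) => a b; vring.
  by rewrite enormB; apply: hlip; exact: le_lt_trans rho_r.
have [u [u0 uS]] : exists u : nat -> V, u 0%N = 0 /\ forall n, u n.+1 = step (u n).
  by exists (fun n => iter n step 0).
have uP n : enorm (u n) <= rho by elim: n => [|n IH]; [rewrite u0 enorm0|rewrite uS; exact: stepP].
have L0 : 0 <= eta / m by rewrite divr_ge0// ltW.
have L1 : eta / m < 1 by rewrite ltr_pdivrMr// mul1r.
have [|v uv _] := @geometric_cvg u (enorm (u 1%N - u 0%N)) (eta / m) (enorm_ge0 _) L0 L1.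
  elim=> [|n IH]; first by rewrite expr0 mulr1.
  have h := stepL _ _ (uP n.+1) (uP n); rewrite -!uS in h.
  by apply: (le_trans h); rewrite exprS mulrCA; exact: (ler_wpM2l L0 IH).
have hv : enorm v <= rho := enorm_lim_le uv uP.
exists v; first exact: le_lt_trans rho_r.
have fix_v : v = step v.
  apply/eqP; rewrite -subr_eq0; apply/eqP/enorm_eq0/le_anti; rewrite enorm_ge0 andbT.
  apply/ler_addgt0Pl => e e0; rewrite addr0.
  have e2 : 0 < e / 2 by rewrite divr_gt0.
  have [N _ hN] := (@cvg_enormP _ _ _ \oo _ _ _).1 uv _ e2.
  have q1 := ltW (hN N.+1 (leqnSn N)); have q2 := ltW (hN N (leqnn N)); move: q1 q2 => /= q1 q2.
  have q3 : eta / m * enorm (u N - v) <= e / 2.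
    by apply: le_trans _ q2; rewrite ler_piMl ?enorm_ge0// ltW.
  have q4 := le_trans (stepL _ _ (uP N) hv) q3; rewrite -uS in q4.
  rewrite enormB in q1; rewrite [e]splitr.
  exact: (le_trans (enormD3 _ (u N.+1) _) (lerD q1 q4)).
have : v *m A = w - phi v by rewrite {1}fix_v mulmxKV.
by move=> E; rewrite -[f v](subrK (v *m A)) -/(phi v) E addrC subrK.
Qed.

Lemma perturbation_inverse_hasd g w : hol f 0 r -> enorm w < (m - eta) * r ->
  (forall w, enorm w < (m - eta) * r -> enorm (g w) < r /\ f (g w) = w) ->
  exists D, hasd g w D.
Proof.
move=> hf hw hg; have me0 : 0 < m - eta by rewrite subr_gt0.
have [gw fgw] := hg _ hw; have [|D hD] := hf (g w); first by rewrite subr0.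
have r1 : 0 < r - enorm (g w) by rewrite subr_gt0.
have low : forall h, (m - eta) * enorm h <= enorm (h *m D).
  apply: (hasd_lower r1 hD) => h hh.
  have hgh : enorm (g w + h) < r.
    by rewrite (le_lt_trans (enormD _ _))// addrC -ltrBrDr.
  by have := perturbation_lower hgh gw; rewrite addrAC subrr add0r.
have [uD hB] := lower_bound_unitmx me0 low; exists (invmx D) => e e0.
(* One factor [m - eta] pays for the Lipschitz constant of [g], the other for the norm of
   [invmx D]. *)
have e1 : 0 < e * (m - eta) * (m - eta) by rewrite !mulr_gt0.
have [d d0 hd] := hD _ e1.
have w1 : 0 < (m - eta) * r - enorm w by rewrite subr_gt0.
exists (Num.min ((m - eta) * r - enorm w) (d * (m - eta))).
  by rewrite lt_min w1 mulr_gt0.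
move=> h; rewrite lt_min => /andP[h1 h2].
have hwh : enorm (w + h) < (m - eta) * r.
  by rewrite (le_lt_trans (enormD _ _))// addrC -ltrBrDr.
have [gwh fgwh] := hg _ hwh.
set u := g (w + h) - g w.
have guE : g w + u = g (w + h) by rewrite addrC subrK.
have hu' : (m - eta) * enorm u <= enorm h.
  have := perturbation_lower gwh gw.
  by rewrite fgwh fgw [w + h - w]addrAC subrr add0r.
have hu : enorm u <= enorm h / (m - eta) by rewrite ler_pdivlMr// mulrC.
have /hd : enorm u < d by apply: (le_lt_trans hu); rewrite ltr_pdivrMr.
rewrite guE fgwh fgw [w + h - w]addrAC subrr add0r => h3.
have -> : u - h *m invmx D = (u *m D - h) *m invmx D by rewrite mulmxBl mulmxK.
apply: (le_trans (hB _)); rewrite ler_pdivrMr// enormB (le_trans h3)//.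
rewrite (_ : _ * enorm u = (m - eta) * enorm u * (e * (m - eta))); last by ring.
rewrite (_ : _ * _ * (m - eta) = enorm h * (e * (m - eta))); last by ring.
by rewrite ler_pM2r ?mulr_gt0.
Qed.

End Perturbation.
End InverseFunction.

(** * Convergence of the conjugacies *)

Section Conjugacy.
Context {R : realType} {X : Type} {k : nat}.
Local Notation C := (Cplx R).
Local Notation V := 'V[R]_k.
Implicit Types (x y : X) (u v w h : V) (e : R) (n : nat) (K : X -> R).

(** [G (tau x)] inverts [N x]: the inverse carries the index of the fibre on which it is defined.
    With [F] innermost and [G] outermost, induction on [n] moves the base point from [x] to
    [tau x]. *)
Fixpoint pullback (tau : X -> X) (F G : X -> V -> V) n x v : V :=
  if n is n'.+1 then G (tau x) (pullback tau F G n' (tau x) (F x v)) else v.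

Lemma enorm_cvg_uniq (a : nat -> V) (l l' : V) : a @ \oo --> l -> a @ \oo --> l' -> l = l'.
Proof.
move=> /(@cvg_enormP _ _ _ \oo _ _ _).1 al /(@cvg_enormP _ _ _ \oo _ _ _).1 al'.
apply/eqP; rewrite -subr_eq0; apply/eqP/enorm_eq0/le_anti; rewrite enorm_ge0 andbT.
apply/ler_addgt0Pl => e e0; rewrite addr0; have e2 : 0 < e / 2 by rewrite divr_gt0.
have [N _ hN] := al _ e2; have [N' _ hN'] := al' _ e2.
have h1 := ltW (hN _ (leq_maxl N N')); have h2 := ltW (hN' _ (leq_maxr N N')).
move: h1 h2 => /= h1 h2; rewrite enormB in h1; rewrite [e]splitr.
exact: (le_trans (enormD3 _ (a (maxn N N')) _) (lerD h1 h2)).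
Qed.

Variables (tau tauV : X -> X) (q : nat) (F N G : X -> V -> V) (rho r0 : X -> R)
  (E M' m' kap : R).

(** Kept as a predicate because two functions [K] occur: [K0], small enough on the balls to control
    domains, and later one adapted to [theta]. *)
Definition domin K := [/\ forall x, 0 <= K x, forall x, K (tau x) <= E * K x
  & forall x v, enorm v < 2 * rho x -> enorm (F x v - N x v) <= K x * enorm v ^+ q.+1].

Local Notation Th := (E * M' ^+ q.+1 / m').
Local Notation C1 := ((m' * (1 - Th))^-1).
Local Notation Tn := (pullback tau F G).

Variable K0 : X -> R.
Hypotheses (tauK : cancel tau tauV) (E0 : 0 <= E) (m'0 : 0 < m') (M'0 : 0 <= M')
  (M'1 : M' <= 1)
  (Th1 : Th < 1) (rho0 : forall x, 0 < rho x) (r0big : forall x, 4 * rho x <= r0 x)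
  (hFle : forall x v, enorm v < 2 * rho x -> enorm (F x v) <= M' * enorm v)
  (hFmap : forall x v, enorm v < 2 * rho x -> enorm (F x v) < 2 * rho (tau x))
  (hNlow : forall x u w, enorm u < r0 x -> enorm w < r0 x ->
     m' * enorm (u - w) <= enorm (N x u - N x w))
  (hG : forall x w, enorm w < 4 * rho (tau x) ->
     enorm (G (tau x) w) < r0 x /\ N x (G (tau x) w) = w)
  (hGhol : forall x w, enorm w < 4 * rho (tau x) -> exists D, hasd (G (tau x)) w D)
  (hFhol : forall x v, enorm v < 2 * rho x -> exists A, hasd (F x) v A)
  (hNhol : forall x v, enorm v < r0 x -> exists A, hasd (N x) v A)
  (K0d : domin K0) (kap4 : kap <= 4^-1)
  (K0small : forall x, K0 x * C1 * (2 * rho x) ^+ q <= kap).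

Let Th0 : 0 <= Th.
Proof. by rewrite divr_ge0 ?mulr_ge0 ?exprn_ge0// ltW. Qed.

Let C10 : 0 <= C1.
Proof. by rewrite invr_ge0 mulr_ge0 ?subr_ge0// ltW. Qed.

Let ball2_r0 x v : enorm v < 2 * rho x -> enorm v < r0 x.
Proof.
move=> hv; apply: lt_le_trans (r0big x); apply: (lt_trans hv).
by rewrite ltr_pM2r// ltr_nat.
Qed.

(** [C1] solves [m' C1 = E M'^(q+1) C1 + 1]: the first term is the propagated error, the second the
    discrepancy of [F] and [N], so the bound reproduces itself. *)
Lemma pullback_step K x v w : domin K -> enorm v < 2 * rho x -> enorm w < 4 * rho (tau x) ->
  enorm (w - F x v) <= K (tau x) * C1 * enorm (F x v) ^+ q.+1 ->
  enorm (G (tau x) w - v) <= K x * C1 * enorm v ^+ q.+1.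
Proof.
move=> [K_ge0 K_tau K_dom] hv hw hwF; have [Gr NG] := hG hw.
have h1 := hNlow Gr (ball2_r0 hv); rewrite NG in h1.
rewrite -(ler_pM2l m'0); apply: (le_trans h1).
apply: (le_trans (enormD3 _ (F x v) _)); apply: (le_trans (lerD hwF (K_dom _ _ hv))).
have h2 : K (tau x) * C1 * enorm (F x v) ^+ q.+1 <=
    E * K x * C1 * (M' ^+ q.+1 * enorm v ^+ q.+1).
  apply: ler_pM; rewrite ?mulr_ge0 ?exprn_ge0 ?enorm_ge0//.
    by apply: ler_wpM2r.
  rewrite -exprMn; apply: lerXn2r; rewrite ?nnegrE ?mulr_ge0 ?enorm_ge0//.
  exact: hFle.
apply: (le_trans (lerD h2 (lexx _))).
rewrite le_eqVlt; apply/orP; left; apply/eqP.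
have n1 : m' - E * M' ^+ q.+1 != 0.
  by rewrite gt_eqF// subr_gt0; move: Th1; rewrite ltr_pdivrMr// mul1r.
by move: (M' ^+ q.+1) (enorm v ^+ q.+1) n1 => a b n1; field; rewrite n1 gt_eqF.
Qed.

Lemma K0_le x v : enorm v < 2 * rho x -> K0 x * C1 * enorm v ^+ q.+1 <= kap * enorm v.
Proof.
move=> hv; have [K_ge0 _ _] := K0d; rewrite [enorm v ^+ q.+1]exprSr [leLHS]mulrA; apply: ler_wpM2r; first exact: enorm_ge0.
apply: le_trans (K0small x); apply: ler_wpM2l; first by rewrite mulr_ge0.
by apply: lerXn2r; rewrite ?nnegrE ?enorm_ge0// ltW// (le_lt_trans (enorm_ge0 v)).
Qed.

Let kap0 x : 0 <= kap.
Proof.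
have [K_ge0 _ _] := K0d; apply: le_trans (K0small x).
by rewrite !mulr_ge0 ?exprn_ge0 ?mulr_ge0// ltW.
Qed.

Lemma near_id_norm x v w : enorm v < 2 * rho x -> enorm (w - v) <= kap * enorm v ->
  enorm w <= 5 / 4 * enorm v.
Proof.
move=> hv hw; apply: (le_trans (enorm_split w v)); apply: (le_trans (lerD hw (lexx _))).
have := ler_wpM2r (enorm_ge0 v) kap4; lra.
Qed.

Lemma near_id_range x v w : enorm v < 2 * rho x -> enorm (w - v) <= kap * enorm v ->
  enorm w < 4 * rho x.
Proof.
move=> hv hw; apply: (le_lt_trans (near_id_norm hv hw)).
have := enorm_ge0 v; move: hv; have := rho0 x; lra.
Qed.

(** Applying [G] requires the previous iterate to lie in the [4 rho] ball; this follows from the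
    very estimate being proved, since [K0] is small on the balls. *)
Lemma pullback_K0 n x v : enorm v < 2 * rho x ->
  enorm (Tn n x v - v) <= K0 x * C1 * enorm v ^+ q.+1.
Proof.
elim: n x v => [|n IH] x v hv.
  have [K_ge0 _ _] := K0d.
  by rewrite subrr enorm0 !mulr_ge0 ?exprn_ge0 ?enorm_ge0.
have hFv := hFmap hv; apply: pullback_step => //; last exact: IH.
exact: near_id_range hFv (le_trans (IH _ _ hFv) (K0_le hFv)).
Qed.

Lemma pullback_near n x v : enorm v < 2 * rho x -> enorm (Tn n x v - v) <= kap * enorm v.
Proof. by move=> hv; exact: le_trans (pullback_K0 n hv) (K0_le hv). Qed.

Lemma pullback_range n x v : enorm v < 2 * rho x -> enorm (Tn n x v) < 4 * rho x.
Proof. by move=> hv; exact: near_id_range hv (pullback_near n hv). Qed.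

(** The ranges being known from [K0], the same induction runs for any dominating [K], without
    smallness. *)
Lemma pullback_dist K n x v : domin K -> enorm v < 2 * rho x ->
  enorm (Tn n x v - v) <= K x * C1 * enorm v ^+ q.+1.
Proof.
move=> Kd; have [K_ge0 _ _] := Kd; elim: n x v => [|n IH] x v hv.
  by rewrite subrr enorm0 !mulr_ge0 ?exprn_ge0 ?enorm_ge0.
have hFv := hFmap hv; apply: pullback_step => //; last exact: IH.
exact: pullback_range.
Qed.

Lemma N_pullback n x v : enorm v < 2 * rho x -> N x (Tn n.+1 x v) = Tn n (tau x) (F x v).
Proof. by move=> /hFmap/(pullback_range n)/hG[]. Qed.

Lemma pullback_r0 n x v : enorm v < 2 * rho x -> enorm (Tn n x v) < r0 x.
Proof. by move=> /(pullback_range n)/lt_le_trans; apply. Qed.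

(** [N x] maps two consecutive iterates at [x] to the preceding two at [tau x]; going back, each
    step multiplies the bound by [E M'^(q+1) / m']. *)
Lemma pullback_succ n x v : enorm v < 2 * rho x ->
  enorm (Tn n.+1 x v - Tn n x v) <= K0 x * C1 * enorm v ^+ q.+1 * Th ^+ n.
Proof.
have [K_ge0 K_tau _] := K0d; elim: n x v => [|n IH] x v hv.
  by rewrite expr0 mulr1; exact: pullback_K0.
have hFv := hFmap hv.
have h1 := hNlow (pullback_r0 n.+2 hv) (pullback_r0 n.+1 hv).
rewrite (N_pullback n.+1 hv) (N_pullback n hv) in h1.
rewrite -(ler_pM2l m'0); apply: (le_trans h1); apply: (le_trans (IH _ _ hFv)).
have h2 : K0 (tau x) * C1 * enorm (F x v) ^+ q.+1 <=
    E * K0 x * C1 * (M' ^+ q.+1 * enorm v ^+ q.+1).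
  apply: ler_pM; rewrite ?mulr_ge0 ?exprn_ge0 ?enorm_ge0//.
    by apply: ler_wpM2r.
  rewrite -exprMn; apply: lerXn2r; rewrite ?nnegrE ?mulr_ge0 ?enorm_ge0//.
  exact: hFle.
apply: (le_trans (ler_wpM2r (exprn_ge0 n Th0) h2)).
rewrite le_eqVlt; apply/orP; left; apply/eqP.
rewrite [Th ^+ n.+1]exprS; move: C1 (Th ^+ n) => c t.
by move: (M' ^+ q.+1) (enorm v ^+ q.+1) => a b; field; rewrite gt_eqF.
Qed.

Definition conj_lim x v : V := lim ((fun n => Tn n x v) @ \oo).

Lemma cvg_conj_lim x v : enorm v < 2 * rho x -> (fun n => Tn n x v) @ \oo --> conj_lim x v.
Proof.
move=> hv; have [K_ge0 _ _] := K0d.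
have c0 : 0 <= K0 x * C1 * enorm v ^+ q.+1 by rewrite !mulr_ge0 ?exprn_ge0 ?enorm_ge0.
have [l hl _] := geometric_cvg c0 Th0 Th1 (fun n => pullback_succ n hv).
by have := cvgP _ hl.
Qed.

Lemma conj_lim_dist K x v : domin K -> enorm v < 2 * rho x ->
  enorm (conj_lim x v - v) <= K x * C1 * enorm v ^+ q.+1.
Proof.
move=> Kd hv; have c : (fun n => Tn n x v - v) @ \oo --> conj_lim x v - v.
  by apply: cvgB; [exact: cvg_conj_lim|exact: cvg_cst].
exact: (enorm_lim_le c (fun n => pullback_dist n Kd hv)).
Qed.

Lemma conj_lim_near x v : enorm v < 2 * rho x -> enorm (conj_lim x v - v) <= kap * enorm v.
Proof. by move=> hv; exact: le_trans (conj_lim_dist K0d hv) (K0_le hv). Qed.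

Lemma conj_lim_norm x v : enorm v < 2 * rho x -> enorm (conj_lim x v) <= 5 / 4 * enorm v.
Proof. by move=> hv; exact: near_id_norm hv (conj_lim_near hv). Qed.

Lemma conj_lim_conj x v : enorm v < 2 * rho x ->
  conj_lim (tau x) (F x v) = N x (conj_lim x v).
Proof.
move=> hv; have Tr : enorm (conj_lim x v) < r0 x.
  exact: lt_le_trans (near_id_range hv (conj_lim_near hv)) (r0big x).
have [D hD] := hNhol Tr.
apply: (@enorm_cvg_uniq (fun n => Tn n (tau x) (F x v))).
  exact: cvg_conj_lim (hFmap hv).
apply/(@cvg_enormP _ _ _ \oo) => e e0; have [d d0 hd] := hasd_cont hD e0.
have [n0 _ hn0] := (@cvg_enormP _ _ _ \oo _ _ _).1 (cvg_conj_lim hv) d d0.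
exists n0 => // n /= n0n; rewrite -(N_pullback n hv); apply: hd.
exact: hn0 (leq_trans n0n (leqnSn n)).
Qed.

Lemma pullback_hasd n x v : enorm v < 2 * rho x -> exists A, hasd (Tn n x) v A.
Proof.
elim: n x v => [|n IH] x v hv.
  exists 1%:M; have h := @hasd_linear R k 1%:M v.
  by apply: (@hasd_eq R k _ _ v 1 _ ltr01 _ h) => w _; rewrite mulmx1.
have [A hA] := hFhol hv; have [B hB] := IH _ _ (hFmap hv).
have [D hD] := hGhol (pullback_range n (hFmap hv)).
exists (A *m B *m D); exact: (hasd_comp (hasd_comp hA hB) hD).
Qed.

Lemma conj_lim_hol x : hol (conj_lim x) 0 (2 * rho x).
Proof.
apply: (@hol_limit R k (fun n => Tn n x) _ _ _ (4 * rho x)).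
- by move=> n w; rewrite subr0; exact: pullback_hasd.
- by move=> n w; rewrite subr0 => hw; exact: ltW (pullback_range n hw).
- by move=> w; rewrite subr0; exact: cvg_conj_lim.
Qed.

Lemma sub_id_hol x : hol (fun v => conj_lim x v - v) 0 (2 * rho x).
Proof.
move=> w hw; have [A hA] := conj_lim_hol hw.
exists (A - 1%:M); apply: hasdB => //; have h := @hasd_linear R k 1%:M w.
by apply: (@hasd_eq R k _ _ w 1 _ ltr01 _ h) => w' _; rewrite mulmx1.
Qed.

(** On the ball of radius [2 rho x] the map is bounded by [kap] times the radius, so the radius
    cancels in [hol_lip] and the constant is the same in every fibre. *)
Lemma sub_id_lip x u w : enorm u < rho x -> enorm w < rho x ->
  enorm ((conj_lim x u - u) - (conj_lim x w - w)) <=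
  2 * @cV R k ^+ 2 * kap * enorm (u - w).
Proof.
move=> hu hw; have rx : 0 < 2 * rho x by rewrite mulr_gt0.
have r2 : 2 * rho x / 2 = rho x by field.
have bd : bnd (fun v => conj_lim x v - v) 0 (2 * rho x) (kap * (2 * rho x)).
  move=> v; rewrite subr0 => hv; apply: (le_trans (conj_lim_near hv)).
  by apply: ler_wpM2l (kap0 x) _ _ _; exact: ltW.
have := @hol_lip R k _ 0 _ _ u w rx (@sub_id_hol x) bd.
rewrite !subr0 r2 => /(_ hu hw) /le_trans; apply.
rewrite le_eqVlt; apply/orP; left; apply/eqP; field; rewrite gt_eqF//.
Qed.

Lemma sub_id_growth x : growth q.+1 (fun v => conj_lim x v - v).
Proof.
have [K_ge0 _ _] := K0d; have rx : 0 < 2 * rho x by rewrite mulr_gt0.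
split; last first.
  exists (K0 x * C1), (2 * rho x); split; rewrite ?mulr_ge0//.
  by move=> v; exact: conj_lim_dist.
exists (2 * rho x), (kap * (2 * rho x)); split=> //; first exact: sub_id_hol.
move=> v; rewrite subr0 => hv; apply: (le_trans (conj_lim_near hv)).
by apply: ler_wpM2l (kap0 x) _ _ _; exact: ltW.
Qed.

Lemma conj_lim_spec :
  [/\ forall x v, enorm v < 2 * rho x -> (fun n => Tn n x v) @ \oo --> conj_lim x v,
      forall K x v, domin K -> enorm v < 2 * rho x ->
        enorm (conj_lim x v - v) <= K x * C1 * enorm v ^+ q.+1,
      forall x v, enorm v < 2 * rho x -> enorm (conj_lim x v) <= 5 / 4 * enorm v,
      forall x v, enorm v < 2 * rho x -> conj_lim (tau x) (F x v) = N x (conj_lim x v) &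
      forall x, [/\ hol (conj_lim x) 0 (2 * rho x), growth q.+1 (fun v => conj_lim x v - v) &
        forall u w, enorm u < rho x -> enorm w < rho x ->
          enorm ((conj_lim x u - u) - (conj_lim x w - w)) <=
          2 * @cV R k ^+ 2 * kap * enorm (u - w)]].
Proof.
split; [exact: cvg_conj_lim|exact: conj_lim_dist|exact: conj_lim_norm|exact: conj_lim_conj|].
by move=> x; split; [exact: conj_lim_hol|exact: sub_id_growth|exact: sub_id_lip].
Qed.

Lemma iter_bmapF n x v : iter n (bmap tau F) (x, v) = (iter n tau x, fiter tau F n x v).
Proof.
rewrite /fiter; suff : (iter n (bmap tau F) (x, v)).1 = iter n tau x.
  by case: (iter n _ _) => a b /= ->.
by elim: n => //= n ->.
Qed.

Lemma iter_bmapG n x v : iter n (bmap tauV G) (iter n (bmap tau F) (x, v)) = (x, Tn n x v).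
Proof.
elim: n x v => [|n IH] x v //.
by rewrite [iter n.+1 (bmap tau F) _]iterSr -[bmap tau F (x, v)]/(tau x, F x v) iterS IH /bmap /= tauK.
Qed.

Lemma pullback_fiter n x v : fiter tauV G n (iter n tau x) (fiter tau F n x v) = Tn n x v.
Proof. by rewrite /fiter -/(fiter tau F n x v) -iter_bmapF iter_bmapG. Qed.

Lemma pullback_iter_defined n x v : enorm v < 2 * rho x ->
  iter_defined tauV (fun y => 4 * rho y) G n (iter n (bmap tau F) (x, v)).
Proof.
elim: n x v => [|n IH] x v hv j //; rewrite iterSr -[bmap tau F (x, v)]/(tau x, F x v).
(* The last of the backward steps starts at [T^n_{tau x} (F_x v)]; the earlier ones are those of the
   orbit of [(tau x, F_x v)]. *)
rewrite ltnS leq_eqVlt => /predU1P[->|jn]; last exact: (IH _ _ (hFmap hv)).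
by rewrite iter_bmapG /tube /fball /=; exact: pullback_range (hFmap hv).
Qed.

End Conjugacy.

(** * Slow functions and tame bundle maps *)

Section SlowFunctions.
Context {R : realType} {X : Type}.
Variables (tau tauV : X -> X).
Hypothesis tauK : cancel tau tauV.
Implicit Types (e c : R) (f g : X -> R) (x : X).
Local Notation slow := (slow tau tauV).

Lemma slow_gt0 e f x : slow e f -> 0 < f x.
Proof. by move=> [/(_ x)/andP[]]. Qed.

Lemma slow_le1 e f x : slow e f -> f x <= 1.
Proof. by move=> [/(_ x)/andP[]]. Qed.

Lemma slow_tau_ge e f x : slow e f -> f x <= expR e * f (tau x).
Proof.
move=> [_ /(_ x)[h _]]; rewrite -(ler_pM2l (expR_gt0 (- e))) mulrA -expRD.
by rewrite addNr expR0 mul1r.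
Qed.

Lemma slow_tau_le e f x : slow e f -> f (tau x) <= expR e * f x.
Proof.
move=> [_ /(_ (tau x))[_ h]]; rewrite -(ler_pM2l (expR_gt0 (- e))) mulrA -expRD.
by rewrite addNr expR0 mul1r; rewrite tauK in h.
Qed.

Lemma slow_inv_tau e f x : slow e f -> (f (tau x))^-1 <= expR e * (f x)^-1.
Proof.
move=> hf; have h := slow_tau_ge x hf.
have p1 := slow_gt0 x hf; have p2 := slow_gt0 (tau x) hf.
by rewrite ler_pdivlMr// mulrC ler_pdivrMr.
Qed.

Lemma slow_mono e e' f : slow e f -> e <= e' -> slow e' f.
Proof.
move=> [h1 h2] ee; split=> // x; have [k1 k2] := h2 x.
have fx : 0 <= f x by have /andP[/ltW] := h1 x.
have h : expR (- e') * f x <= expR (- e) * f x.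
  by apply: ler_wpM2r => //; rewrite ler_expR lerN2.
by split; [exact: le_trans h k1|exact: le_trans h k2].
Qed.

Lemma slow_mul e e' f g : slow e f -> slow e' g -> slow (e + e') (fun x => f x * g x).
Proof.
move=> [f1 f2] [g1 g2]; split=> x.
  have /andP[a0 a1] := f1 x; have /andP[b0 b1] := g1 x.
  by rewrite mulr_gt0//= mulr_ile1// ltW.
have [h1 h2] := f2 x; have [k1 k2] := g2 x.
have /andP[/ltW a0 _] := f1 x; have /andP[/ltW b0 _] := g1 x.
by rewrite opprD expRD mulrACA; split; apply: ler_pM; rewrite ?mulr_ge0 ?expR_ge0.
Qed.

Lemma slow_cst c : 0 < c <= 1 -> slow 0 (fun=> c).
Proof. by move=> hc; split=> // x; rewrite oppr0 expR0 mul1r. Qed.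

Lemma slow_scale e c f : 0 < c <= 1 -> slow e f -> slow e (fun x => c * f x).
Proof. by move=> hc hf; rewrite -[e]add0r; apply: slow_mul hf; exact: slow_cst. Qed.

Lemma slow_exp e f n : slow e f -> slow (n%:R * e) (fun x => f x ^+ n).
Proof.
move=> hf; elim: n => [|n IH].
  by rewrite mul0r; apply: (@slow_cst 1); rewrite ltr01 lexx.
rewrite -natr1 mulrDl mul1r addrC (_ : (fun x => _) = (fun x => f x * f x ^+ n)).
  exact: slow_mul.
by apply/funext => x; rewrite exprS.
Qed.

Lemma expr_le_base (a : R) n : 0 <= a -> a <= 1 -> (0 < n)%N -> a ^+ n <= a.
Proof. by move=> a0 a1; case: n => // n _; rewrite exprS ler_piMr// exprn_ile1. Qed.

End SlowFunctions.

(** * Uniform estimates drawn from tameness *)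

Section TameEstimates.
Context {R : realType} {X : Type} {k : nat}.
Local Notation C := (Cplx R).
Local Notation V := 'V[R]_k.
Local Notation cV := (@cV R k).
Variables (tau tauV : X -> X).
Hypothesis tauK : cancel tau tauV.
Implicit Types (u v w h : V) (K F N : X -> V -> V) (x : X) (P : X -> R).

(** A single slow function [P] replaces the four of tameness: it is the product of the two radii and
    the reciprocals of the two fast functions, taken at rate [d / 4] so that [P] has rate [d]; all
    factors being at most [1], [P] is below each. The 2 in [2 / P x] pays for passing from [tau x]
    to [x], as [e^d <= 2]. *)
Lemma tame_bounded rF F rN N : tame tau tauV rF F -> tame tau tauV rN N ->
  exists2 d0 : R, 0 < d0 & forall d, 0 < d < d0 -> exists2 P, slow tau tauV d P &
    forall x v, enorm v < P x ->
    [/\ fball rF x v, fball rN x v, enorm (F x v) <= 2 / P x & enorm (N x v) <= 2 / P x].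
Proof.
move=> [a a0 ha] [b b0 hb].
exists (Num.min (Num.min (4 * a) (4 * b)) (ln 2)).
  by rewrite !lt_min !mulr_gt0// ln_gt0// ltr1n.
move=> d; rewrite !lt_min => /andP[d0 /andP[/andP[da db] d2]].
have da' : 0 < d / 4 < a by rewrite divr_gt0//= ltr_pdivrMr// mulrC.
have db' : 0 < d / 4 < b by rewrite divr_gt0//= ltr_pdivrMr// mulrC.
have [r [s [hr [s1 hs] [rt Ft]]]] := ha _ da'.
have [r' [s' [hr' [s1' hs'] [rt' Ft']]]] := hb _ db'.
pose P x := r x * r' x * ((s x)^-1 * (s' x)^-1).
have sP : slow tau tauV d P.
  have -> : d = d / 4 + d / 4 + (d / 4 + d / 4) by field.
  by apply: slow_mul; exact: slow_mul.
have le_fac (p t : R) : 0 < p -> p <= 1 -> 0 < t -> t <= 1 -> p * t <= p /\ p * t <= t.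
  by move=> p0 p1 t0 t1; rewrite ler_piMr ?ler_piMl// ltW.
have Ple x : [/\ P x <= r x, P x <= r' x, P x <= (s x)^-1 & P x <= (s' x)^-1].
  have [A1 A2] := le_fac _ _ (slow_gt0 x hr) (slow_le1 x hr) (slow_gt0 x hr') (slow_le1 x hr').
  have [B1 B2] := le_fac _ _ (slow_gt0 x hs) (slow_le1 x hs) (slow_gt0 x hs') (slow_le1 x hs').
  have [C1 C2] := le_fac _ _ (slow_gt0 x (slow_mul hr hr')) (slow_le1 x (slow_mul hr hr'))
    (slow_gt0 x (slow_mul hs hs')) (slow_le1 x (slow_mul hs hs')).
  by split; [exact: le_trans C1 A1|exact: le_trans C1 A2|exact: le_trans C2 B1|exact: le_trans C2 B2].
have tauP x (t : R) : 0 < t -> P (tau x) <= t^-1 -> t <= 2 / P x.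
  move=> t0 ht; apply: (@le_trans _ _ (P (tau x))^-1).
    by rewrite -[t]invrK lef_pV2 ?posrE ?invr_gt0// (slow_gt0 _ sP).
  apply: (le_trans (slow_inv_tau x sP)); apply: ler_wpM2r.
    by rewrite invr_ge0 ltW// (slow_gt0 _ sP).
  by rewrite -[leRHS](@lnK _ 2) ?posrE// ler_expR ltW.
exists P => // x v hv; have [P1 P2 _ _] := Ple x; have [_ _ P3 P4] := Ple (tau x).
have t1 : tube r (x, v) by exact: lt_le_trans hv P1.
have t2 : tube r' (x, v) by exact: lt_le_trans hv P2.
split; [exact: (rt _ t1)|exact: (rt' _ t2)| |].
- apply: (@le_trans _ _ (s (tau x))); last first.
    by apply: tauP P3; apply: lt_le_trans (s1 _).
  by apply: ltW; have := Ft _ (ex_intro2 _ _ (x, v) t1 erefl).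
- apply: (@le_trans _ _ (s' (tau x))); last first.
    by apply: tauP P4; apply: lt_le_trans (s1' _).
  by apply: ltW; have := Ft' _ (ex_intro2 _ _ (x, v) t2 erefl).
Qed.

(** The Lipschitz constant of the nonlinear part is proportional to the radius [r]; the cube is
    [p^2] from the variation of the differential times [p] from the bound [2 / p]. *)
Lemma bounded_hol_lip (f : V -> V) (p r : R) A u w : 0 < p -> hol f 0 p -> bnd f 0 p (2 / p) ->
  hasd f 0 A -> r <= p / 4 -> enorm u < r -> enorm w < r ->
  enorm ((f u - u *m A) - (f w - w *m A)) <= 16 * cV ^+ 4 / p ^+ 3 * r * enorm (u - w).
Proof.
move=> p0 hf bf hA rp hu hw.
rewrite (_ : _ * _ * r = cV * (8 * cV ^+ 3 * (2 / p) / p ^+ 2 * r)); last first.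
  by field; rewrite gt_eqF.
apply: (@bounded_deriv_lip _ _ (fun v => f v - v *m A) 0 r); rewrite ?subr0//.
move=> z; rewrite subr0 => hz.
have zp := lt_le_trans hz rp.
have [|B hB] := hf z; first by rewrite subr0 (lt_trans zp)// gtr_pMr// invf_lt1// ltr1n.
exists (B - A); first by apply: hasdB => //; exact: hasd_linear.
move=> h; have hB' : hasd f (0 + z) B by rewrite add0r.
apply: (le_trans (hol_deriv_lip h zp hf bf hA hB')); apply: ler_wpM2r; first exact: enorm_ge0.
apply: ler_wpM2l; last exact: ltW.
by rewrite !mulr_ge0 ?invr_ge0 ?exprn_ge0 ?cV_ge0// ltW.
Qed.

(** [vanishing_growth] for the difference, bounded by [4 / p]; this bound and the scaling of [|v|]
    by [p] make up the power [p ^+ q.+1]. *)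
Lemma tangent_growth q : exists2 c : R, 0 <= c & forall (f g : V -> V) (p : R), 0 < p ->
  hol f 0 p -> bnd f 0 p (2 / p) -> hol g 0 p -> bnd g 0 p (2 / p) ->
  (forall a, (\sum_(i < k) a i < q)%N -> taylor_coef a f = taylor_coef a g) ->
  forall v, enorm v < p / 4 ^+ q -> enorm (f v - g v) <= c / p ^+ q.+1 * enorm v ^+ q.
Proof.
have [c c0 hc] := @vanishing_growth R k q; exists (4 * c); first by rewrite mulr_ge0.
move=> f g p p0 hf bf hg bg ht v hv.
have := hc (fun w => f w - g w) p (4 / p) p0 _ _ _ v hv.
have -> : c * (4 / p) * (enorm v / p) ^+ q = 4 * c / p ^+ q.+1 * enorm v ^+ q.
  rewrite expr_div_n exprS; move: (enorm v ^+ q) (p ^+ q) (exprn_gt0 q p0) => a b b0.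
  by field; rewrite !gt_eqF.
apply.
- move=> w hw; have [A hA] := hf w hw; have [B hB] := hg w hw.
  by exists (A - B); exact: hasdB.
- move=> w hw; apply: (le_trans (enormD _ _)); rewrite enormN.
  apply: (le_trans (lerD (bf _ hw) (bg _ hw))).
  by rewrite -mulrDl le_eqVlt; apply/orP; left; apply/eqP; congr (_ / _); ring.
- move=> a ha; rewrite mderivB.
  + by have /taylor_coef_mderiv -> := ht a ha; rewrite subrr.
  + by exists p, (2 / p).
  + by exists p, (2 / p).
Qed.

End TameEstimates.

(** * Decay of orbits at the exact linear rate *)

Section IterateDecay.
Context {R : realType} {X : Type} {k : nat}.
Local Notation V := 'V[R]_k.
Variables (tau : X -> X) (F : X -> V -> V) (rho L : X -> R) (E M M' eta : R).
Hypotheses (E0 : 0 <= E) (M0 : 0 < M) (M'0 : 0 <= M') (EM : E * M' < 1) (eta0 : 0 <= eta)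
  (L0 : forall x, 0 <= L x) (Ltau : forall x, L (tau x) <= E * L x)
  (Lrho : forall x, L x * rho x <= eta)
  (hFle : forall x (v : V), enorm v < rho x -> enorm (F x v) <= M' * enorm v)
  (hFmap : forall x (v : V), enorm v < rho x -> enorm (F x v) < rho (tau x))
  (hFL : forall x (v : V), enorm v < rho x -> enorm (F x v) <= (M + L x * enorm v) * enorm v).

Lemma fiterS n x (v : V) :
  fiter tau F n.+1 x v = F (iter n tau x) (fiter tau F n x v).
Proof. by rewrite /fiter iterS iter_bmapF. Qed.

Lemma iterate_range n x (v : V) : enorm v < rho x ->
  enorm (fiter tau F n x v) < rho (iter n tau x) /\
  enorm (fiter tau F n x v) <= M' ^+ n * enorm v.
Proof.
move=> hv; elim: n => [|n [IH1 IH2]]; first by rewrite expr0 mul1r.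
rewrite fiterS; split; first exact: hFmap.
by apply: (le_trans (hFle IH1)); rewrite exprS -mulrA; exact: ler_wpM2l.
Qed.

Lemma iter_tau_le (Q : X -> R) (e : R) n x : 0 <= e ->
  (forall x, Q (tau x) <= e * Q x) -> Q (iter n tau x) <= e ^+ n * Q x.
Proof.
move=> e0 hQ; elim: n => [|n IH]; first by rewrite expr0 mul1r.
by rewrite iterS; apply: (le_trans (hQ _)); rewrite exprS -mulrA; exact: ler_wpM2l.
Qed.

(** At step [j] the norm is multiplied by at most [M + L_j |v_j|], where
    [L_j |v_j| <= eta (E M')^j]. The product of these factors is at most [M^n] times the exponential
    of a geometric sum, whence a constant independent of [n]. *)
Lemma iterate_decay n x (v : V) : enorm v < rho x ->
  enorm (fiter tau F n x v) <= expR (eta / M / (1 - E * M')) * M ^+ n * enorm v.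
Proof.
move=> hv; pose La := E * M'; have La0 : 0 <= La by rewrite mulr_ge0.
have La1 : 0 < 1 - La by rewrite subr_gt0.
have eM0 : 0 <= eta / M by rewrite divr_ge0// ltW.
have : enorm (fiter tau F n x v) <=
    expR (eta / M * (1 - La ^+ n) / (1 - La)) * M ^+ n * enorm v.
  elim: n => [|n IH]; first by rewrite subrr mulr0 mul0r expR0 !mul1r.
  have [H1 H2] := iterate_range n hv; rewrite fiterS.
  apply: (le_trans (hFL H1)).
  have LL : L (iter n tau x) * enorm (fiter tau F n x v) <= eta * La ^+ n.
    apply: le_trans (ler_pM (L0 _) (enorm_ge0 _) (iter_tau_le n x E0 Ltau) H2) _.
    rewrite [leLHS](_ : _ = L x * enorm v * La ^+ n); last by rewrite exprMn; ring.
    apply: ler_wpM2r; first exact: exprn_ge0.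
    by apply: le_trans (Lrho x); apply: ler_wpM2l => //; exact: ltW.
  have step : M + L (iter n tau x) * enorm (fiter tau F n x v) <= expR (eta / M * La ^+ n) * M.
    apply: (@le_trans _ _ ((1 + eta / M * La ^+ n) * M)).
      rewrite mulrDl mul1r lerD2l (le_trans LL)// le_eqVlt; apply/orP; left; apply/eqP.
      by field; rewrite gt_eqF.
    by rewrite ler_pM2r// expR_ge1Dx.
  have s0 : 0 <= M + L (iter n tau x) * enorm (fiter tau F n x v).
    by rewrite addr_ge0 ?mulr_ge0 ?enorm_ge0// ltW.
  apply: (le_trans (ler_pM s0 (enorm_ge0 _) step IH)).
  rewrite (_ : eta / M * (1 - La ^+ n.+1) / (1 - La) =
    eta / M * La ^+ n + eta / M * (1 - La ^+ n) / (1 - La)); last first.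
    by rewrite exprS; move: (La ^+ n) => t; field; rewrite !gt_eqF.
  by rewrite expRD exprS le_eqVlt; apply/orP; left; apply/eqP; ring.
move/le_trans; apply; apply: ler_wpM2r; first exact: enorm_ge0.
apply: ler_wpM2r; first by rewrite exprn_ge0// ltW.
rewrite ler_expR ler_pM2r ?invr_gt0// ler_piMr// gerBl exprn_ge0//.
Qed.

End IterateDecay.

(** * Choice of the constants *)

Section Constants.
Context {R : realType}.
Implicit Types (a b m M : R) (n : nat).

(** On [[0, 1]] the [n]-th power has slope at most [n]. *)
Lemma expr_sub_le M a n : 0 <= M -> M <= a -> a <= 1 -> a ^+ n <= M ^+ n + n%:R * (a - M).
Proof.
move=> M0 Ma a1; have a0 := le_trans M0 Ma; elim: n => [|n IH].
  by rewrite !expr0 mul0r addr0.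
rewrite !exprS; apply: (le_trans (ler_wpM2l a0 IH)).
have t1 : (a - M) * M ^+ n <= a - M.
  by rewrite ler_piMr ?subr_ge0// exprn_ile1// (le_trans Ma).
have t2 : a * (n%:R * (a - M)) <= n%:R * (a - M).
  by rewrite ler_piMl// mulr_ge0// subr_ge0.
by rewrite -natr1; move: t1 t2; clear; lra.
Qed.

Lemma exists_eta m M n : 0 < m -> m <= M -> M < 1 -> M ^+ n < m ->
  exists eta : R, [/\ 0 < eta, eta < m, M + eta < 1 & (M + eta) ^+ n < m - eta].
Proof.
move=> m0 mM M1 Mm; have M0 : 0 <= M := le_trans (ltW m0) mM.
have n1 : 0 < 2 * (n%:R + 1) :> R by rewrite mulr_gt0// ltr_wpDl.
have g0 : 0 < m - M ^+ n by rewrite subr_gt0.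
pose eta := Num.min ((1 - M) / 2) ((m - M ^+ n) / (2 * (n%:R + 1))).
have e0 : 0 < eta by rewrite lt_min !divr_gt0// subr_gt0.
have e1 : eta <= (1 - M) / 2 by rewrite ge_min lexx.
have : eta <= (m - M ^+ n) / (2 * (n%:R + 1)) by rewrite ge_min lexx orbT.
rewrite ler_pdivlMr// => e2.
have M'1 : M + eta < 1 by move: e1 M1; clear; lra.
have ne : 0 <= n%:R * eta by rewrite mulr_ge0// ltW.
have Mn0 : 0 <= M ^+ n by rewrite exprn_ge0.
exists eta; split=> //; first by move: e2 ne Mn0 e0; clear; lra.
have le_Me : M <= M + eta by rewrite lerDl ltW.
apply: (le_lt_trans (expr_sub_le n M0 le_Me (ltW M'1))).
by move: e2 ne g0 e0; clear; lra.
Qed.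

Lemma exists_dilation a b : 0 <= a -> a < 1 -> b < 1 ->
  exists E : R, [/\ 1 < E, E <= 2, E * a < 1 & E * b < 1].
Proof.
move=> a0 a1 b1; pose s := Num.max a b.
have s1 : s < 1 by rewrite gt_max a1.
have as_ : a <= s by rewrite le_max lexx.
have bs : b <= s by rewrite le_max lexx orbT.
have s0 : 0 <= s := le_trans a0 as_.
have p : 0 < 1 + s by rewrite ltr_wpDr.
(* As [s < 1], both [1 + s < 2] and [2 s < 1 + s]. *)
exists (2 / (1 + s)); split.
- by rewrite ltr_pdivlMr// mul1r; move: s1; clear; lra.
- by rewrite ler_pdivrMr// mulrDr mulr1 lerDl mulr_ge0.
- by rewrite mulrAC ltr_pdivrMr//; move: s1 as_; clear; lra.
- by rewrite mulrAC ltr_pdivrMr//; move: s1 bs; clear; lra.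
Qed.

Lemma exists_small (a1 a2 a3 b1 b2 b3 : R) : 0 <= a1 -> 0 <= a2 -> 0 <= a3 ->
  0 < b1 -> 0 < b2 -> 0 < b3 ->
  exists c : R, [/\ 0 < c, c <= 1, a1 * c <= b1, a2 * c <= b2 & a3 * c <= b3].
Proof.
move=> a10 a20 a30 b10 b20 b30.
have [p1 p2 p3] : [/\ 0 < a1 + 1, 0 < a2 + 1 & 0 < a3 + 1] by split; rewrite ltr_wpDl.
exists (Num.min (Num.min 1 (b1 / (a1 + 1))) (Num.min (b2 / (a2 + 1)) (b3 / (a3 + 1)))).
set c := Num.min _ _.
have c0 : 0 < c by rewrite !lt_min ltr01 !divr_gt0.
have aux (a b : R) : 0 < a + 1 -> c <= b / (a + 1) -> a * c <= b.
  move=> a0; rewrite ler_pdivlMr// => h; apply: le_trans h.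
  by rewrite mulrDr mulr1 mulrC lerDl ltW.
split=> //.
- by rewrite !ge_min lexx.
- by apply: aux => //; rewrite !ge_min lexx orbT.
- by apply: aux => //; rewrite !ge_min lexx !orbT.
- by apply: aux => //; rewrite !ge_min lexx !orbT.
Qed.
End Constants.

(** * Lipschitz constants and tangency of bundle maps *)

Section BundleFacts.
Context {R : realType} {X : Type} {k : nat}.
Local Notation V := 'V[R]_k.
Implicit Types (u v w h : V) (K : X -> V -> V) (r : X -> R).

Lemma Lip_le r K (b : R) : 0 <= b ->
  (forall x u w, enorm u < r x -> enorm w < r x -> enorm (K x u - K x w) <= b * enorm (u - w)) ->
  (Lip r K <= b%:E)%E.
Proof.
move=> b0 hK; apply: ge_ereal_sup => _ [x _ <-]; apply: ge_ereal_sup => _ [[u w] [/= hu hw] <-].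
rewrite lee_fin; have [uw|uw] := eqVneq (enorm (u - w)) 0; first by rewrite uw invr0 mulr0.
by rewrite ler_pdivrMr ?hK// lt_def uw enorm_ge0.
Qed.

(** As [q >= 1], an error of order [|v|^(q+1)] is negligible against [|v|]; this is how [N] inherits
    the linear part of [F]. *)
Lemma tangent_hasd q (f g : V -> V) A (c r : R) : (1 <= q)%N -> 0 < r -> 0 <= c ->
  hasd f 0 A -> (forall v, enorm v < r -> enorm (f v - g v) <= c * enorm v ^+ q.+1) ->
  hasd g 0 A.
Proof.
move=> q1 r0 c0 hf hfg e e0; have e2 : 0 < e / 2 by rewrite divr_gt0.
have [d d0 hd] := hf _ e2; have c1 : 0 < 2 * (c + 1) by rewrite mulr_gt0// ltr_wpDl.
exists (Num.min (Num.min d r) (Num.min 1 (e / (2 * (c + 1))))).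
  by rewrite !lt_min d0 r0 ltr01 divr_gt0.
move=> h; rewrite !lt_min => /andP[/andP[/hd h1 /hfg h2] /andP[h3 h4]].
have fg0 : f 0 = g 0.
  apply/eqP; rewrite -subr_eq0; apply/eqP/enorm_eq0/le_anti; rewrite enorm_ge0 andbT.
  by have := hfg 0; rewrite enorm0 expr0n mulr0; apply.
rewrite add0r in h1 *; rewrite -fg0.
rewrite (_ : _ - _ - _ = (f h - f 0 - h *m A) - (f h - g h)); last first.
  by move: (h *m A) (f h) (g h) (f 0) => x y z t; vring.
apply: (le_trans (enormD _ _)); rewrite enormN; apply: (le_trans (lerD h1 h2)).
rewrite [in leRHS](splitr e) mulrDl lerD2l exprS mulrCA [leRHS]mulrC.
apply: ler_wpM2l; first exact: enorm_ge0.
have hq : enorm h ^+ q <= enorm h by apply: expr_le_base; rewrite ?enorm_ge0// ltW.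
apply: (le_trans (ler_wpM2l c0 hq)).
move: h4; rewrite ltr_pdivlMr// => h4.
have := enorm_ge0 h; move: h4; clear; lra.
Qed.

Lemma tangent_sub_id q (T : X -> V -> V) :
  (forall x, growth q (fun v => T x v - v)) -> (forall x, hol0 (T x)) ->
  tangent q T idbundle.
Proof.
move=> hg hT x a aq; apply/taylor_coef_mderiv; apply/eqP; rewrite -subr_eq0; apply/eqP.
rewrite -mderivB//; first exact: growth_mderiv (hg x) aq.
exists 1, 1; split=> //.
  move=> w _; exists 1%:M; have h := @hasd_linear R k 1%:M w.
  by apply: (@hasd_eq R k _ _ w 1 _ ltr01 _ h) => w' _; rewrite mulmx1.
by move=> w; rewrite subr0 => /ltW.
Qed.

End BundleFacts.

(** * The theorem *)

Section Linearization.
Context {R : realType} {X : Type} {k : nat}.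
Local Notation C := (Cplx R).
Local Notation V := 'V[R]_k.
Variables (tau tauV : X -> X) (tauK : cancel tau tauV) (tauVK : cancel tauV tau)
  (q : nat) (hq : (1 <= q)%N)
  (rF rN : X -> R) (F N : X -> V -> V) (hF : bundle_map rF F) (hN : bundle_map rN N)
  (tameF : tame tau tauV rF F) (tameN : tame tau tauV rN N) (tangFN : tangent q.+1 F N)
  (m M : R) (m_gt0 : 0 < m) (le_mM : m <= M) (M_lt1 : M < 1) (hMm : M ^+ q.+1 < m)
  (hA : forall (x : X) (v : V),
        m * enorm v <= enorm ('d (F x) (0 : V) v) <= M * enorm v).

Let Ad x : 'M[C]_k := lin1_mx ('d (F x) (0 : V)).

Let M_gt0 : 0 < M. Proof. exact: lt_le_trans le_mM. Qed.

Let Ad_bounds x (v : V) : m * enorm v <= enorm (v *m Ad x) <= M * enorm v.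
Proof. by rewrite mul_rV_lin1; exact: hA. Qed.

Let F_hasd0 x : hasd (F x) 0 (Ad x).
Proof.
have [r0 d0 _] := hF; apply: differentiable_hasd; apply: (d0 x).
by rewrite /fball /= enorm0.
Qed.

(** [d0] and [c] precede [d]: the estimates are used once at the rate that fixes [rho] and once more
    at a rate adapted to [theta], with the same constant [c]. *)
Lemma tame_estimates : exists2 d0 : R, 0 < d0 & exists2 c : R, 0 < c &
  forall d, 0 < d < d0 -> exists2 P, slow tau tauV d P & forall x,
  [/\ (forall v : V, enorm v < P x -> fball rF x v /\ fball rN x v),
      hol (F x) 0 (P x) /\ hol (N x) 0 (P x),
      (forall r (u w : V), r <= P x / 4 -> enorm u < r -> enorm w < r ->
         enorm ((F x u - u *m Ad x) - (F x w - w *m Ad x)) <= c / P x ^+ 3 * r * enorm (u - w) /\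
         enorm ((N x u - u *m Ad x) - (N x w - w *m Ad x)) <= c / P x ^+ 3 * r * enorm (u - w))
    & (forall v : V, enorm v < P x / 4 ^+ q.+1 ->
         enorm (F x v - N x v) <= c / P x ^+ q.+2 * enorm v ^+ q.+1)].
Proof.
have [d0 d00 hd0] := tame_bounded tameF tameN.
have [c1 c10 hc1] := @tangent_growth R k q.+1.
exists d0 => //; pose c2 := 16 * @cV R k ^+ 4.
have c20 : 0 <= c2 by rewrite mulr_ge0// exprn_ge0// cV_ge0.
exists (c1 + c2 + 1); first by rewrite ltr_wpDl// addr_ge0.
move=> d /hd0[P sP hP]; exists P => // x.
have P0 := slow_gt0 x sP; have [_ dF _] := hF; have [_ dN _] := hN.
have holF : hol (F x) 0 (P x).
  move=> w; rewrite subr0 => /hP[wF _ _ _].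
  by exists (lin1_mx ('d (F x) w)); apply: differentiable_hasd; exact: dF.
have holN : hol (N x) 0 (P x).
  move=> w; rewrite subr0 => /hP[_ wN _ _].
  by exists (lin1_mx ('d (N x) w)); apply: differentiable_hasd; exact: dN.
have bF : bnd (F x) 0 (P x) (2 / P x) by move=> w; rewrite subr0 => /hP[].
have bN : bnd (N x) 0 (P x) (2 / P x) by move=> w; rewrite subr0 => /hP[].
have FN v : enorm v < P x / 4 ^+ q.+1 ->
    enorm (F x v - N x v) <= c1 / P x ^+ q.+2 * enorm v ^+ q.+1.
  by apply: hc1 => // a; exact: tangFN.
have N_hasd0 : hasd (N x) 0 (Ad x).
  by apply: (@tangent_hasd R k q _ _ _ _ _ hq _ _ (F_hasd0 x) FN);
    rewrite ?divr_gt0 ?divr_ge0 ?exprn_ge0// ltW.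
split=> //; first by move=> v /hP[].
- move=> r u w rP hu hw.
  have r0 : 0 <= r := ltW (le_lt_trans (enorm_ge0 u) hu).
  have le_c : c2 / P x ^+ 3 * r * enorm (u - w) <= (c1 + c2 + 1) / P x ^+ 3 * r * enorm (u - w).
    apply: ler_wpM2r; first exact: enorm_ge0.
    apply: ler_wpM2r => //; apply: ler_wpM2r; first by rewrite invr_ge0 exprn_ge0// ltW.
    by rewrite addrAC lerDr addr_ge0.
  split; apply: le_trans le_c.
    exact: (bounded_hol_lip P0 holF bF (F_hasd0 x)).
  exact: (bounded_hol_lip P0 holN bN N_hasd0).
- move=> v /FN h; apply: (le_trans h); apply: ler_wpM2r; first by rewrite exprn_ge0 ?enorm_ge0.
  apply: ler_wpM2r; first by rewrite invr_ge0 exprn_ge0// ltW.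
  by rewrite -addrA lerDl addr_ge0.
Qed.

Let F0 x : F x 0 = 0. Proof. by have [_ _] := hF. Qed.
Let N0 x : N x 0 = 0. Proof. by have [_ _] := hN. Qed.

(** [xget] returns [0] where no preimage exists; on the balls in use the preimage exists and is
    unique. *)
Definition local_inv (r0 : X -> R) y (w : V) : V :=
  xget 0 [set v : V | enorm v < r0 (tauV y) /\ N (tauV y) v = w].

Lemma conjugacy (kappa : R) : 0 < kappa ->
  exists2 eps1 : R, 0 < eps1 &
  forall eps : R, 0 < eps < eps1 ->
  exists (rho : X -> R) (T : X -> V -> V),
    let rho2 := fun x => 2 * rho x in
    [/\ slow tau tauV eps rho,
        bundle_map rho T
      & maps_tube idfun rho T rho rho2] /\
    [/\ contracts rho F,
        maps_tube tau rF F rho rho,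
        contracts rho2 N
      & maps_tube tau rN N rho2 rho2] /\
    (exists (s : X -> R) (G : X -> V -> V),
      [/\ local_inverse tau tauV rN N s G,
          forall (x : X) (v : V) (n : nat), fball rho x v ->
            iter_defined tauV s G n (iter n (bmap tau F) (x, v))
        & forall (x : X) (v : V), fball rho x v ->
            (fun n : nat => fiter tauV G n (iter n tau x) (fiter tau F n x v))
              @ \oo --> (T x v : V)]) /\
    (tangent q.+1 T idbundle /\
     (Lip rho (subbundle T idbundle) < kappa%:E)%E) /\
    (forall (x : X) (v : V), fball rho x v ->
      T (tau x) (F x v) = N x (T x v)) /\
    (forall theta : R, M ^+ q.+1 / m < theta < 1 ->
      exists2 phi : X -> R, fast tau tauV eps phi &
        forall (x : X) (n : nat) (v : V), (1 <= n)%N -> fball rho x v ->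
          enorm (fiter tau N n x (T x v) - fiter tau F n x v)
            <= phi x * (m * theta) ^+ n * enorm v ^+ q.+1).
Proof.
move=> kappa0.
(* The slack [eta] will bound the Lipschitz constant of the nonlinear parts on the [r0] balls,
   turning the rates [m] and [M] into [m'] and [M']. *)
have [eta [eta0 etam Meta1 Meta]] := exists_eta m_gt0 le_mM M_lt1 hMm.
set M' := M + eta in Meta1 Meta.
have M'0 : 0 < M' by rewrite addr_gt0.
set m' := m - eta in Meta.
have m'0 : 0 < m' by rewrite subr_gt0.
have m'1 : m' <= 1.
  by apply: le_trans (le_trans le_mM (ltW M_lt1)); rewrite gerBl ltW.
have Mm1 : M' ^+ q.+1 / m' < 1 by rewrite ltr_pdivrMr// mul1r.
(* [E] bounds [e^eps] for all admissible [eps]; [E <= 2] lets the factor between [4 rho] and [8 rho]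
   absorb one step along the orbit. *)
have [E [E1 E2 EM ETh]] := exists_dilation (ltW M'0) Meta1 Mm1.
have E0 : 0 < E := lt_trans ltr01 E1.
rewrite mulrA in ETh; set Th := E * M' ^+ q.+1 / m' in ETh.
have Th0 : 0 <= Th by rewrite divr_ge0 ?mulr_ge0 ?exprn_ge0// ltW.
pose C1 := (m' * (1 - Th))^-1.
have C10 : 0 < C1 by rewrite invr_gt0 mulr_gt0// subr_gt0.
have [d0 d00 [c c0 hc]] := tame_estimates.
pose w2 := 2 * @cV R k ^+ 2; have w20 : 0 <= w2 by rewrite mulr_ge0// sqr_ge0.
have w21 : 0 < w2 + 1 by rewrite ltr_wpDl.
(* The bound [1/4] keeps the iterates in the [4 rho] ball; the other one brings the Lipschitz
   constant of [T - I] below [kappa]. *)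
pose kap := Num.min 4^-1 (kappa / (w2 + 1)).
have kap0 : 0 < kap by rewrite lt_min invr_gt0 ltr0n/= divr_gt0.
have kap4 : kap <= 4^-1 by rewrite ge_min lexx.
have kapk : w2 * kap < kappa.
  have : kap <= kappa / (w2 + 1) by rewrite ge_min lexx orbT.
  rewrite ler_pdivlMr// mulrDr mulr1 [kap * w2]mulrC => h; apply: lt_le_trans h.
  by rewrite ltrDl.
have b80 : 0 < 8 / m' by rewrite divr_gt0.
(* The three demands on [c4]: [r0] well inside [P], nonlinear parts [eta]-Lipschitz on the [r0]
   balls, and [K0] small on the [2 rho] balls. *)
have z1 : 0 <= 8 / m' * 4 ^+ q.+2 by rewrite mulr_ge0 ?exprn_ge0// ltW.
have z2 : 0 <= c * (8 / m') by rewrite mulr_ge0// ltW.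
have z3 : 0 <= c * C1 * 2 ^+ q by rewrite !mulr_ge0 ?exprn_ge0// ltW.
have [c4 [c40 c41 c4a c4b c4c]] := exists_small z1 z2 z3 ltr01 eta0 kap0.
(* [p] is the exponent of [P] in [rho]: with [P] of rate [eps / p], [rho] has rate [eps]. *)
pose p : R := q.+3%:R; have p0 : 0 < p by rewrite ltr0n.
exists (Num.min (p * d0) (ln E)); first by rewrite lt_min mulr_gt0// ln_gt0.
move=> eps; rewrite lt_min => /andP[eps0 /andP[epsd epsE]].
have expE : expR eps <= E by rewrite -[leRHS](@lnK _ E) ?posrE// ler_expR ltW.
have dd : 0 < eps / p < d0 by rewrite divr_gt0//= ltr_pdivrMr// mulrC.
have [P sP hP] := hc _ dd.
have P0 x := slow_gt0 x sP; have P1 x := slow_le1 x sP.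
have PX0 n x : 0 < P x ^+ n by rewrite exprn_gt0.
(* The factor [8 / m'] makes the image of the [r0] ball under [N] contain the [8 rho] ball, which in
   turn is at least as large as the [4 rho] ball of the next fibre. *)
pose rho x := c4 * P x ^+ q.+3; pose r0 x := 8 / m' * rho x.
have srho : slow tau tauV eps rho.
  apply: slow_scale; first by rewrite c40.
  have -> : eps = p * (eps / p) by rewrite mulrC mulfVK// gt_eqF.
  exact: slow_exp.
have rho0 x : 0 < rho x := slow_gt0 x srho.
have rho_tau x : rho x <= E * rho (tau x).
  by apply: (le_trans (slow_tau_ge x srho)); apply: ler_wpM2r => //; exact: ltW.
have rho_tau' x : rho (tau x) <= E * rho x.
  by apply: (le_trans (slow_tau_le tauK x srho)); apply: ler_wpM2r => //; exact: ltW.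
have r0P x : r0 x <= P x / 4 ^+ q.+2.
  rewrite ler_pdivlMr ?exprn_gt0// /r0 /rho.
  rewrite [leLHS]mulrAC [leLHS]mulrA.
  rewrite -[leRHS]mul1r; apply: ler_pM => //.
  - exact: mulr_ge0 z1 (ltW c40).
  - exact: ltW (PX0 _ _).
  - by apply: expr_le_base => //; exact: ltW.
have four n : 1 <= 4 ^+ n :> R by rewrite exprn_ege1// ler1n.
have r0P1 x : r0 x <= P x / 4 ^+ q.+1.
  apply: (le_trans (r0P x)); rewrite ler_pM2l// lef_pV2 ?posrE ?exprn_gt0//.
  by rewrite [leRHS]exprS ler_peMl ?exprn_ge0// ler1n.
have r0P4 x : r0 x <= P x / 4.
  apply: (le_trans (r0P1 x)); rewrite ler_pM2l// lef_pV2 ?posrE ?exprn_gt0//.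
  by rewrite exprS ler_peMr.
have r0lP x : r0 x <= P x.
  by apply: (le_trans (r0P4 x)); rewrite ler_piMr ?(ltW (P0 x))// invf_le1 ?ler1n.
have m'r0 x : m' * r0 x = 8 * rho x by rewrite /r0; field; rewrite gt_eqF.
have rho8 x : 8 * rho x <= r0 x.
  by rewrite -m'r0 ler_piMl// mulr_ge0 ?ltW.
have r0big x : 4 * rho x <= r0 x.
  by apply: le_trans (rho8 x); rewrite ler_pM2r// ler_nat.
have lipe x : c / P x ^+ 3 * r0 x <= eta.
  rewrite /r0 /rho (_ : _ * _ = c * (8 / m') * c4 * P x ^+ q); last first.
    rewrite -(addn3 q) exprD; move: (P x ^+ 3) (P x ^+ q) (PX0 3 x) => a b a0.
    by field; rewrite !gt_eqF.
  apply: le_trans c4b; rewrite ler_piMr//; last by rewrite exprn_ile1// ltW.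
  exact: mulr_ge0 z2 (ltW c40).
have lipF x (u w : V) : enorm u < r0 x -> enorm w < r0 x ->
    enorm ((F x u - u *m Ad x) - (F x w - w *m Ad x)) <= eta * enorm (u - w) /\
    enorm ((N x u - u *m Ad x) - (N x w - w *m Ad x)) <= eta * enorm (u - w).
  move=> hu hw; have [_ _ h _] := hP x; have [h1 h2] := h _ _ _ (r0P4 x) hu hw.
  have le_eta := ler_wpM2r (enorm_ge0 (u - w)) (lipe x).
  by split; [exact: le_trans h1 le_eta|exact: le_trans h2 le_eta].
have upper (f : V -> V) x (u w : V) :
    enorm ((f u - u *m Ad x) - (f w - w *m Ad x)) <= eta * enorm (u - w) ->
    enorm (f u - f w) <= M' * enorm (u - w).
  move=> h; have /andP[_ h2] := Ad_bounds x (u - w).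
  have := enorm_split (f u - f w) ((u - w) *m Ad x); move/le_trans; apply.
  rewrite mulrDl addrC; apply: lerD => //.
  have -> : f u - f w - (u - w) *m Ad x = (f u - u *m Ad x) - (f w - w *m Ad x).
    by rewrite mulmxBl; move: (u *m Ad x) (w *m Ad x) (f u) (f w) => a b a' b'; vring.
  exact: h.
have Fup x (u w : V) : enorm u < r0 x -> enorm w < r0 x ->
    enorm (F x u - F x w) <= M' * enorm (u - w).
  by move=> hu hw; exact: upper (F x) x u w (lipF x u w hu hw).1.
have Nup x (u w : V) : enorm u < r0 x -> enorm w < r0 x ->
    enorm (N x u - N x w) <= M' * enorm (u - w).
  by move=> hu hw; exact: upper (N x) x u w (lipF x u w hu hw).2.
have r00 x : 0 < r0 x by rewrite mulr_gt0.
have Fle x (v : V) : enorm v < r0 x -> enorm (F x v) <= M' * enorm v.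
  by move=> hv; have := Fup x v 0 hv; rewrite F0 !subr0 enorm0; apply.
have Nle x (v : V) : enorm v < r0 x -> enorm (N x v) <= M' * enorm v.
  by move=> hv; have := Nup x v 0 hv; rewrite N0 !subr0 enorm0; apply.
(* [E M' < 1]: the contraction outweighs the shrinking of [rho] along the orbit. *)
have shrink x b (a : R) : 0 < b -> a < b * rho x -> M' * a < b * rho (tau x).
  move=> b0 hab; apply: (@lt_le_trans _ _ (M' * (b * rho x))); first by rewrite ltr_pM2l.
  apply: (@le_trans _ _ (M' * (b * (E * rho (tau x))))).
    by rewrite ler_pM2l// ler_pM2l.
  rewrite (_ : _ * _ = E * M' * (b * rho (tau x))); last by ring.
  by apply: ler_piMl (ltW EM); rewrite mulr_ge0 ?(ltW b0) ?(ltW (rho0 _)).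
have ball_r0 x b (v : V) : b <= 8 -> enorm v < b * rho x -> enorm v < r0 x.
  move=> b8 hv; apply: lt_le_trans hv _; apply: le_trans (rho8 x).
  by rewrite ler_pM2r.
have Nlow x (u w : V) : enorm u < r0 x -> enorm w < r0 x ->
    m' * enorm (u - w) <= enorm (N x u - N x w).
  apply: (@perturbation_lower R k (N x) (Ad x) (r0 x) m eta).
    by move=> h; case/andP: (Ad_bounds x h).
  by move=> u' w' hu hw; exact: (lipF x u' w' hu hw).2.
pose G := local_inv r0.
have GP x (w : V) : enorm w < m' * r0 x -> enorm (G (tau x) w) < r0 x /\ N x (G (tau x) w) = w.
  move=> hw; rewrite /G /local_inv tauK.
  have [v v1 v2] : exists2 v : V, enorm v < r0 x & N x v = w.
    apply: (@perturbation_onto R k (N x) (Ad x) (r0 x) m eta) hw => //.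
    - exact: ltW.
    - by move=> h; case/andP: (Ad_bounds x h).
    - by move=> u' w' hu hw; exact: (lipF x u' w' hu hw).2.
  by apply: (@xgetPex _ 0 [set v : V | enorm v < r0 x /\ N x v = w]); exists v.
have range_G x (w : V) : enorm w < 4 * rho (tau x) -> enorm w < m' * r0 x.
  move=> hw; rewrite m'r0; apply: (lt_le_trans hw).
  apply: (@le_trans _ _ (4 * (E * rho x))); first by rewrite ler_pM2l.
  rewrite mulrA; apply: ler_wpM2r; first exact: ltW.
  by rewrite (_ : 8 = 4 * 2 :> R) ?ler_pM2l//; ring.
have hG x (w : V) : enorm w < 4 * rho (tau x) ->
    enorm (G (tau x) w) < r0 x /\ N x (G (tau x) w) = w.
  by move=> /range_G; exact: GP.
have hGhol x (w : V) : enorm w < 4 * rho (tau x) -> exists D, hasd (G (tau x)) w D.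
  move=> /range_G hw.
  apply: (@perturbation_inverse_hasd R k (N x) (Ad x) (r0 x) m eta) hw _ => //.
  - by move=> h; case/andP: (Ad_bounds x h).
  - by move=> u' w' hu hw; exact: (lipF x u' w' hu hw).2.
  - by have [_ [_ h] _ _] := hP x; apply: hol_sub h; rewrite subrr enorm0 add0r.
  - by move=> w' hw'; exact: GP.
have hFhol x (v : V) : enorm v < r0 x -> exists A, hasd (F x) v A.
  by move=> hv; have [_ [h _] _ _] := hP x; apply: h; rewrite subr0 (lt_le_trans hv).
have hNhol x (v : V) : enorm v < r0 x -> exists A, hasd (N x) v A.
  by move=> hv; have [_ [_ h] _ _] := hP x; apply: h; rewrite subr0 (lt_le_trans hv).
have two8 : (2 : R) <= 8 by rewrite ler_nat.
have hFle x (v : V) : enorm v < 2 * rho x -> enorm (F x v) <= M' * enorm v.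
  by move=> hv; apply: Fle; exact: ball_r0 hv.
have hFmap x (v : V) : enorm v < 2 * rho x -> enorm (F x v) < 2 * rho (tau x).
  by move=> hv; apply: (le_lt_trans (hFle _ _ hv)); exact: shrink.
have hFhol2 x (v : V) : enorm v < 2 * rho x -> exists A, hasd (F x) v A.
  by move=> hv; apply: hFhol; exact: ball_r0 hv.
pose K0 x := c / P x ^+ q.+2.
have PinvE (d : R) Q n x : slow tau tauV d Q -> n%:R * d <= eps ->
    (Q (tau x) ^+ n)^-1 <= E * (Q x ^+ n)^-1.
  move=> sQ nd; apply: (le_trans (slow_inv_tau x (slow_exp n sQ))).
  apply: ler_wpM2r; first by rewrite invr_ge0 exprn_ge0// ltW// (slow_gt0 _ sQ).
  by apply: le_trans expE; rewrite ler_expR.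
have ndeps n : (n <= q.+3)%N -> n%:R * (eps / p) <= eps.
  by move=> nq; rewrite mulrCA ler_piMr ?(ltW eps0)// ler_pdivrMr// mul1r ler_nat.
have K0d : domin tau q F N rho E K0.
  split=> x.
  - by rewrite divr_ge0 ?exprn_ge0// ltW.
  - by rewrite mulrCA ler_pM2l//; exact: (PinvE _ _ q.+2 x sP (ndeps _ (leqnSn _))).
  - move=> v hv; have [_ _ _ h] := hP x; apply: h.
    by apply: lt_le_trans (r0P1 x); exact: ball_r0 hv.
have K0small x : K0 x * C1 * (2 * rho x) ^+ q <= kap.
  rewrite /K0 /rho [(2 * _) ^+ q]exprMn [(c4 * _) ^+ q]exprMn.
  (* Here [q >= 1] matters: [q (q + 3) >= q + 2], so [rho^q] cancels the negative power of [P] in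
     [K0]. *)
  have -> : (P x ^+ q.+3) ^+ q = P x ^+ q.+2 * P x ^+ (q * q.+3 - q.+2).
    by rewrite -exprM -exprD mulnC subnKC// (leq_trans (leqnSn _))// leq_pmull.
  have cancel_a (a b c' d f g : R) : 0 < a ->
      c' / a * d * (f * (g * (a * b))) = c' * d * f * (g * b).
    by move=> a0; field; rewrite gt_eqF.
  rewrite cancel_a//.
  apply: le_trans c4c; apply: ler_wpM2l.
    by rewrite !mulr_ge0 ?exprn_ge0 ?(ltW c0) ?(ltW C10).
  rewrite -[leRHS]mulr1; apply: ler_pM.
  - by rewrite exprn_ge0// ltW.
  - by rewrite exprn_ge0// ltW.
  - by apply: expr_le_base => //; exact: ltW.
  - by rewrite exprn_ile1// ltW.
have M'1 : M' <= 1 := ltW Meta1.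
have up2 x (v : V) : enorm v < rho x -> enorm v < 2 * rho x.
  by move=> hv; apply: lt_le_trans hv _; rewrite ler_peMl ?ler1n// ltW.
have [Tcvg Tdist Tnorm Tconj Tall] := conj_lim_spec (ltW E0) m'0 (ltW M'0) ETh rho0 r0big
  hFle hFmap Nlow hG hGhol hFhol2 hNhol K0d kap4 K0small.
have Tdef x (v : V) n : enorm v < 2 * rho x ->
    iter_defined tauV (fun y => 4 * rho y) G n (iter n (bmap tau F) (x, v)).
  move=> hv j; exact: (pullback_iter_defined tauK m'0 (ltW M'0) ETh rho0 r0big
    hFle hFmap Nlow hG K0d kap4 K0small hv).
set T := conj_lim tau F G in Tcvg Tdist Tnorm Tconj Tall.
have Tin x (v : V) : enorm v < rho x -> enorm (T x v) < 2 * rho x.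
  move=> hv; apply: (le_lt_trans (Tnorm x v (up2 x v hv))).
  apply: (@lt_le_trans _ _ (5 / 4 * rho x)); first by rewrite ltr_pM2l.
  apply: ler_wpM2r; first exact: ltW.
  by rewrite ler_pdivrMr// -natrM ler_nat.
have Tder x (v : V) : enorm v < 2 * rho x -> exists A, hasd (T x) v A.
  by move=> hv; have [h _ _] := Tall x; apply: h; rewrite subr0.
have T0 x : T x 0 = 0.
  apply: enorm_eq0; apply/le_anti; rewrite enorm_ge0 andbT.
  have h0 : enorm (0 : V) < 2 * rho x by rewrite enorm0 mulr_gt0.
  by have := Tnorm x 0 h0; rewrite enorm0 mulr0.
have Fin1 x (v : V) : enorm v < rho x -> enorm (F x v) < rho (tau x).
  move=> hv; apply: (le_lt_trans (hFle x v (up2 x v hv))).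
  by rewrite -[ltRHS]mul1r; apply: shrink => //; rewrite mul1r.
have inP x (v : V) : enorm v < r0 x -> fball rF x v /\ fball rN x v.
  by move=> hv; have [h _ _ _] := hP x; apply: h; exact: lt_le_trans (r0lP x).
have two_r0 x (v : V) : enorm v < 2 * rho x -> enorm v < r0 x by exact: ball_r0.
have hGy y (w : V) : enorm w < 4 * rho y ->
    enorm (G y w) < r0 (tauV y) /\ N (tauV y) (G y w) = w.
  by move=> hw; have := hG (tauV y) w; rewrite tauVK; apply.
have N_inj x (u w : V) : enorm u < r0 x -> enorm w < r0 x -> N x u = N x w -> u = w.
  move=> hu hw huw; apply/eqP; rewrite -subr_eq0; apply/eqP/enorm_eq0/le_anti.
  by have := Nlow x u w hu hw; rewrite huw subrr enorm0 pmulr_rle0// enorm_ge0 andbT.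
exists rho, T => rho2.
split; [split=> //|split; [split|split; [|split; [split|split]]]].
- split=> // x v hv; have [A hA'] := Tder x v (up2 x v hv).
  exact: (hasd_diff hA').1.
- split=> // _ [[x v] hv <-]; exact: Tin.
- apply: (@le_lt_trans _ _ M'%:E); last by rewrite lte_fin.
  apply: Lip_le (ltW M'0) _ => x u w hu hw.
  by apply: Fup; [exact: two_r0 (up2 x u hu)|exact: two_r0 (up2 x w hw)].
- split; first by move=> [x v] hv; exact: (inP x v (two_r0 x v (up2 x v hv))).1.
  by move=> _ [[x v] hv <-]; exact: Fin1.
- apply: (@le_lt_trans _ _ M'%:E); last by rewrite lte_fin.
  apply: Lip_le (ltW M'0) _ => x u w hu hw.
  by apply: Nup; [exact: two_r0 hu|exact: two_r0 hw].
- split; first by move=> [x v] hv; exact: (inP x v (two_r0 x v hv)).2.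
  move=> _ [[x v] hv <-]; apply: (le_lt_trans (Nle x v (two_r0 x v hv))).
  exact: shrink.
- exists (fun y => 4 * rho y), G; split; first split.
  + split.
    * by move=> y; rewrite mulr_gt0.
    * move=> y w; rewrite /fball /= -[y]tauVK => /hGhol[D hD].
      exact: (hasd_diff hD).1.
    * move=> y; have h0 : enorm (0 : V) < 4 * rho y by rewrite enorm0 mulr_gt0.
      have [g1 g2] := hGy y 0 h0; apply: (N_inj (tauV y)) => //; first by rewrite enorm0.
      by rewrite g2 N0.
  + split=> //; move=> _ [[y w] hw <-]; exact: (inP (tauV y) _ (hGy y w hw).1).2.
  + by move=> [y w] hw; rewrite /bmap /= tauVK (hGy y w hw).2.
  + move=> y; have mi0 : 0 < Num.min (r0 (tauV y)) (4 * rho y) by rewrite lt_min r00 mulr_gt0.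
    apply/nbhs_enormP; exists (Num.min (r0 (tauV y)) (4 * rho y)) => // v.
    rewrite subr0 lt_min => /andP[v1 v2].
    have Nv : enorm (N (tauV y) v) < 4 * rho y.
      apply: le_lt_trans v2; apply: (le_trans (Nle _ _ v1)).
      by apply: ler_piMl M'1; exact: enorm_ge0.
    have [g1 g2] := hGy y _ Nv; exact: N_inj g1 v1 g2.
  + by move=> x v n hv; exact: Tdef x v n (up2 x v hv).
  + move=> x v hv.
    rewrite (_ : (fun n => _) = (fun n => pullback tau F G n x v)).
      exact: Tcvg (up2 x v hv).
    by apply/funext => n; exact: pullback_fiter.
- apply: tangent_sub_id => x; have [h1 h2 _] := Tall x => //.
  exists (2 * rho x), (5 / 4 * (2 * rho x)); split=> //; first by rewrite mulr_gt0.
  move=> v; rewrite subr0 => hv; apply: (le_trans (Tnorm x v hv)).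
  by apply: ler_wpM2l; [rewrite divr_ge0|exact: ltW].
- apply: (@le_lt_trans _ _ (w2 * kap)%:E); last by rewrite lte_fin.
  apply: Lip_le (mulr_ge0 w20 (ltW kap0)) _ => x u w hu hw.
  by have [_ _ h] := Tall x; exact: h.
- by move=> x v hv; exact: Tconj (up2 x v hv).
move=> theta /andP[th1 th2].
have Mq0 : 0 < M ^+ q.+1 by rewrite exprn_gt0.
have mth : M ^+ q.+1 < m * theta by rewrite mulrC -ltr_pdivrMr.
(* [g] is the ratio by which the constant may grow at each step; [e2 <= ln g] gives
   [e^e2 M^(q+1) <= m theta]. *)
pose g := m * theta / M ^+ q.+1.
have g1 : 1 < g by rewrite ltr_pdivlMr// mul1r.
have g0 : 0 < g := lt_trans ltr01 g1.
pose e2 := Num.min eps (ln g).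
have e20 : 0 < e2 by rewrite lt_min eps0 ln_gt0.
have e2eps : e2 <= eps by rewrite ge_min lexx.
have e2g : expR e2 <= g.
  by rewrite -[leRHS](@lnK _ g) ?posrE// ler_expR ge_min lexx orbT.
have dd2 : 0 < e2 / p < d0.
  have /andP[_ h] := dd; rewrite divr_gt0//=; apply: le_lt_trans h.
  by rewrite ler_pM2r ?invr_gt0.
have [Q sQ hQ] := hc _ dd2.
have Q0 x := slow_gt0 x sQ; have Q1 x := slow_le1 x sQ.
have q2e : q.+2%:R * (e2 / p) <= e2.
  by rewrite mulrCA ler_piMr ?(ltW e20)// ler_pdivrMr// mul1r ler_nat.
have Qtau x : (Q (tau x) ^+ q.+2)^-1 <= expR e2 * (Q x ^+ q.+2)^-1.
  apply: (le_trans (slow_inv_tau x (slow_exp q.+2 sQ))); apply: ler_wpM2r.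
    by rewrite invr_ge0 exprn_ge0// ltW.
  by rewrite ler_expR.
(* The bound from [Q] holds only for [|v| < Q / 4^(q+1)], possibly less than [2 rho]. Farther out,
   [|F v - N v| <= 2 |v|], and the lower bound on [|v|] turns [2 |v|] into at most
   [2 (4^(q+1))^q Q^-q |v|^(q+1)]; so [rho] and [T] stay unchanged. *)
pose cc := c + 2 * (4 ^+ q.+1) ^+ q; have cc0 : 0 < cc.
  by rewrite addr_gt0// mulr_gt0// !exprn_gt0.
pose Kt x := cc / Q x ^+ q.+2.
have Kt0 x : 0 <= Kt x by rewrite divr_ge0 ?exprn_ge0// ltW.
have Kttau x : Kt (tau x) <= expR e2 * Kt x.
  by rewrite /Kt mulrCA ler_pM2l.
have Ktd : domin tau q F N rho E Kt.
  split=> // x.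
    apply: (le_trans (Kttau x)); apply: ler_wpM2r => //.
    by apply: le_trans expE; rewrite ler_expR.
  move=> v hv; have [hvQ|hvQ] := ltP (enorm v) (Q x / 4 ^+ q.+1).
    have [_ _ _ h] := hQ x; apply: (le_trans (h v hvQ)).
    apply: ler_wpM2r; first by rewrite exprn_ge0 ?enorm_ge0.
    apply: ler_wpM2r; first by rewrite invr_ge0 exprn_ge0// ltW.
    by rewrite /cc lerDl mulr_ge0// !exprn_ge0.
  have vr := two_r0 x v hv.
  have h2 : enorm (F x v - N x v) <= 2 * enorm v.
    apply: (le_trans (enormD _ _)); rewrite enormN.
    apply: (le_trans (lerD (Fle x v vr) (Nle x v vr))).
    have Mv : M' * enorm v <= enorm v by apply: ler_piMl M'1; exact: enorm_ge0.
    by rewrite [leRHS]mulr_natl mulr2n; exact: (lerD Mv Mv).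
  apply: (le_trans h2).
  have Qv : Q x ^+ q.+2 <= (4 ^+ q.+1) ^+ q * enorm v ^+ q.
    apply: (@le_trans _ _ (Q x ^+ q)).
      rewrite -addn2 exprD ler_piMr ?exprn_ge0 ?(ltW (Q0 x))//.
      by rewrite exprn_ile1// ltW.
    rewrite -exprMn; apply: lerXn2r; rewrite ?nnegrE ?mulr_ge0 ?exprn_ge0 ?enorm_ge0 ?(ltW (Q0 x))//.
    by rewrite mulrC -ler_pdivrMr// exprn_gt0.
  have h3 : 2 * (4 ^+ q.+1) ^+ q / Q x ^+ q.+2 * enorm v ^+ q.+1 <= Kt x * enorm v ^+ q.+1.
    apply: ler_wpM2r; first by rewrite exprn_ge0 ?enorm_ge0.
    apply: ler_wpM2r; first by rewrite invr_ge0 exprn_ge0// ltW.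
    by rewrite /cc lerDr ltW.
  apply: le_trans h3; rewrite mulrAC ler_pdivlMr ?exprn_gt0//.
  have v20 : 0 <= 2 * enorm v by rewrite mulr_ge0 ?enorm_ge0.
  apply: (le_trans (ler_wpM2l v20 Qv)); rewrite [enorm v ^+ q.+1]exprS.
  move: ((4 ^+ q.+1) ^+ q) (enorm v ^+ q) => a b.
  by rewrite le_eqVlt; apply/orP; left; apply/eqP; ring.
(* Twice [c / P^3], since [v] is compared with [0] in the open ball of radius [2 |v|]. *)
pose L x := c / P x ^+ 3 * 2.
have L0 x : 0 <= L x by rewrite mulr_ge0// divr_ge0 ?exprn_ge0// ltW.
have Ltau x : L (tau x) <= E * L x.
  rewrite /L mulrA ler_pM2r// mulrCA ler_pM2l//.
  by apply: (PinvE _ _ 3 x sP (ndeps _ _)); rewrite !ltnS.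
have Lrho x : L x * (2 * rho x) <= eta.
  apply: le_trans (lipe x); rewrite /L -mulrA; apply: ler_wpM2l.
    by rewrite divr_ge0 ?exprn_ge0// ltW.
  by rewrite mulrA -natrM; exact: r0big.
have hFL x (v : V) : enorm v < 2 * rho x -> enorm (F x v) <= (M + L x * enorm v) * enorm v.
  move=> hv; have [->|v0] := eqVneq v 0; first by rewrite F0 enorm0 mulr0.
  have nv := enorm_gt0 v0; have [_ _ h _] := hP x.
  have r2 : 2 * enorm v <= P x / 4.
    apply: le_trans (r0P4 x); apply: le_trans (r0big x).
    have -> : 4 * rho x = 2 * (2 * rho x) by ring.
    by rewrite ler_pM2l// ltW.
  have v2 : enorm v < 2 * enorm v by rewrite ltr_pMl// ltr1n.
  have zv2 : enorm (0 : V) < 2 * enorm v by rewrite enorm0 mulr_gt0.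
  have [h1 _] := h _ _ _ r2 v2 zv2.
  rewrite F0 mul0mx !subr0 in h1.
  have /andP[_ h2] := Ad_bounds x v.
  apply: (le_trans (enorm_split (F x v) (v *m Ad x))); rewrite mulrDl addrC; apply: lerD => //.
  by apply: (le_trans h1); rewrite /L !mulrA.
pose D := expR (eta / M / (1 - E * M')).
have decay n x (v : V) : enorm v < 2 * rho x ->
    enorm (fiter tau F n x v) <= D * M ^+ n * enorm v.
  by move=> hv; exact: (iterate_decay (ltW E0) M_gt0 (ltW M'0) EM (ltW eta0) L0 Ltau Lrho
    hFle hFmap hFL n hv).
(* The summand [1] makes the fast function at least [1]. *)
pose W := 1 + cc * C1 * D ^+ q.+1.
have D0 : 0 < D by rewrite expR_gt0.
have CD0 : 0 <= cc * C1 * D ^+ q.+1.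
  by rewrite mulr_ge0 ?exprn_ge0 ?(ltW D0)// mulr_ge0 ?(ltW C10) ?(ltW cc0).
have W1 : 1 <= W by rewrite lerDl.
have W0 : 0 < W := lt_le_trans ltr01 W1.
exists (fun x => W / Q x ^+ q.+2).
  split.
    move=> x; rewrite -[1]mulr1; apply: ler_pM => //.
    by rewrite invf_ge1 ?exprn_gt0// exprn_ile1// ltW.
  rewrite (_ : (fun x => _) = (fun x => W^-1 * Q x ^+ q.+2)); last first.
    by apply/funext => x; rewrite invfM invrK.
  apply: slow_scale; first by rewrite invr_gt0 W0 invf_le1.
  exact: slow_mono (slow_exp q.+2 sQ) (le_trans q2e e2eps).
move=> x n v _ hv; have hv2 := up2 x v hv.
have hin j := iterate_range (ltW M'0) hFle hFmap j hv2.
have -> : fiter tau N n x (T x v) = T (iter n tau x) (fiter tau F n x v).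
  elim: (n) => [|j IH]; first by [].
  by rewrite fiterS IH fiterS iterS (Tconj _ _ (hin j).1).
apply: (le_trans (Tdist Kt _ _ Ktd (hin n).1)).
have s1 : Kt (iter n tau x) <= expR e2 ^+ n * Kt x.
  exact: iter_tau_le (expR_ge0 e2) Kttau.
have s2 : enorm (fiter tau F n x v) ^+ q.+1 <= (D * M ^+ n * enorm v) ^+ q.+1.
  apply: lerXn2r; rewrite ?nnegrE ?enorm_ge0//.
    by rewrite !mulr_ge0 ?enorm_ge0 ?exprn_ge0 ?(ltW D0) ?(ltW M_gt0).
  exact: decay hv2.
have s3 : Kt (iter n tau x) * C1 <= expR e2 ^+ n * Kt x * C1.
  by apply: ler_wpM2r s1; exact: ltW.
apply: le_trans (ler_pM (mulr_ge0 (Kt0 _) (ltW C10)) (exprn_ge0 _ (enorm_ge0 _)) s3 s2) _.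
have -> : (D * M ^+ n * enorm v) ^+ q.+1 = D ^+ q.+1 * (M ^+ q.+1) ^+ n * enorm v ^+ q.+1.
  by rewrite exprMn [(D * _) ^+ _]exprMn exprAC.
have -> (a b d f h : R) : a * b * C1 * (d * f * h) = (b * C1 * d) * (a * f) * h by ring.
apply: ler_wpM2r; first by rewrite exprn_ge0 ?enorm_ge0.
rewrite -exprMn; apply: ler_pM.
- by rewrite mulr_ge0 ?exprn_ge0 ?(ltW D0)// mulr_ge0 ?Kt0 ?(ltW C10).
- by rewrite exprn_ge0// mulr_ge0 ?expR_ge0 ?(ltW Mq0).
- rewrite /Kt [_ * C1]mulrAC [leLHS]mulrAC; apply: ler_wpM2r.
    by rewrite invr_ge0 exprn_ge0// ltW.
  by rewrite /W lerDr.
- apply: lerXn2r; rewrite ?nnegrE ?mulr_ge0 ?expR_ge0 ?(ltW Mq0) ?(ltW m_gt0)//.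
    by apply: ltW; apply: lt_trans th1; rewrite divr_gt0.
  by rewrite -ler_pdivlMr.
Qed.

(** One value of [kappa] and one small [eps] suffice; the radii are [rho] and [2 rho], and tangency
    at the order [q + 1] contains the order 2 since [q >= 1]. *)
Lemma conjugated_of_tangent : conjugated tau rF F rN N.
Proof.
have [eps1 e10 /(_ (eps1 / 2))] := conjugacy ltr01.
have e2 : 0 < eps1 / 2 < eps1 by rewrite divr_gt0//= gtr_pMr// invf_lt1// ltr1n.
move=> /(_ e2)[rho [T [[srho bT mT] [[_ mF _ mN] [_ [[tT _] [cT _]]]]]]].
have rho0 x := slow_gt0 x srho.
exists rho, (fun x => 2 * rho x), T; split=> //.
- by split=> // x; rewrite mulr_gt0.
- by split=> // x a a2; apply: tT; apply: (leq_trans a2); rewrite ltnS.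
- by move=> [x v] hv; rewrite /bmap /= cT.
Qed.

End Linearization.

Theorem theorem1p1 (R : realType) (X : Type) (tau tauV : X -> X)
    (tauK : cancel tau tauV) (tauVK : cancel tauV tau)
    (k : nat) (hk : (1 <= k)%N) (q : nat) (hq : (1 <= q)%N)
    (rF rN : X -> R) (F N : X -> 'V[R]_k -> 'V[R]_k)
    (hF : bundle_map rF F) (hN : bundle_map rN N)
    (tameF : tame tau tauV rF F) (tameN : tame tau tauV rN N)
    (tangFN : tangent q.+1 F N)
    (m M : R) (m_gt0 : 0 < m) (le_mM : m <= M) (M_lt1 : M < 1)
    (hMm : M ^+ q.+1 < m)
    (hA : forall (x : X) (v : 'V[R]_k),
        m * enorm v <= enorm ('d (F x) (0 : 'V[R]_k) v) <= M * enorm v) :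
  conjugated tau rF F rN N /\
  forall kappa : R, 0 < kappa ->
  exists2 eps1 : R, 0 < eps1 &
  forall eps : R, 0 < eps < eps1 ->
  exists (rho : X -> R) (T : X -> 'V[R]_k -> 'V[R]_k),
    let rho2 := fun x => 2 * rho x in
    [/\ slow tau tauV eps rho,
        bundle_map rho T
      & maps_tube idfun rho T rho rho2] /\
    [/\ contracts rho F,
        maps_tube tau rF F rho rho,
        contracts rho2 N
      & maps_tube tau rN N rho2 rho2] /\
    (exists (s : X -> R) (G : X -> 'V[R]_k -> 'V[R]_k),
      [/\ local_inverse tau tauV rN N s G,
          forall (x : X) (v : 'V[R]_k) (n : nat), fball rho x v ->
            iter_defined tauV s G n (iter n (bmap tau F) (x, v))
        & forall (x : X) (v : 'V[R]_k), fball rho x v ->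
            (fun n : nat => fiter tauV G n (iter n tau x) (fiter tau F n x v))
              @ \oo --> (T x v : 'V[R]_k)]) /\
    (tangent q.+1 T idbundle /\
     (Lip rho (subbundle T idbundle) < kappa%:E)%E) /\
    (forall (x : X) (v : 'V[R]_k), fball rho x v ->
      T (tau x) (F x v) = N x (T x v)) /\
    (forall theta : R, M ^+ q.+1 / m < theta < 1 ->
      exists2 phi : X -> R, fast tau tauV eps phi &
        forall (x : X) (n : nat) (v : 'V[R]_k), (1 <= n)%N -> fball rho x v ->
          enorm (fiter tau N n x (T x v) - fiter tau F n x v)
            <= phi x * (m * theta) ^+ n * enorm v ^+ q.+1).
Proof.
split.
  exact: (conjugated_of_tangent tauK tauVK hq hF hN tameF tameN tangFN m_gt0 le_mM M_lt1 hMm hA).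
move=> kappa kappa0.
exact: (conjugacy tauK tauVK hq hF hN tameF tameN tangFN m_gt0 le_mM M_lt1 hMm hA kappa0).
Qed.
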